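(* Let $\Omega\subset\mathbb{R}^2$ be a bounded convex domain and let $f\in L^2(\Omega)$. Let $\phi\in\Phi_{\rm c}(\Omega)$ satisfy (A0), (aDec)$_2$ and (VA1), and assume that $\phi^*$ satisfies (VA1). For $p>1$ define $F_p:L^2(\Omega)\to[0,\infty]$ by $$F_p(u):=\begin{cases}\displaystyle\int_\Omega\phi(x,|\nabla u|)^p+|u-f|^2\,dx & \text{when } u\in L^{1,\phi^p}(\Omega),\\ \infty&\text{otherwise.}\end{cases}$$ Then $F_p$ $\Gamma$-converges to $\varrho^f_{V,\phi}$ in $L^2(\Omega)$ (as $p\to1^+$).
   Context: A domain is an open connected set; ''increasing'' means non-decreasing. $L^0(\Omega)$ is the set of measurable functions on $\Omega$. Here $n=2$. $\Phi_{\rm w}(\Omega)$ is the set of $\phi:\Omega\times[0,\infty)\to[0,\infty]$ such that for every $x\in\Omega$: $\phi(\cdot,|g|)$ is measurable for every $g\in L^0(\Omega)$; $t\mapsto\phi(x,t)$ is increasing; $\phi(x,0)=\lim_{t\to0^+}\phi(x,t)=0$ and $\lim_{t\to\infty}\phi(x,t)=\infty$; and there is $L\ge1$ independent of $x$ with $\frac{\phi(x,s)}{s}\le L\frac{\phi(x,t)}{t}$ for $0<s\le t$. $\Phi_{\rm c}(\Omega)$ is the set of those $\phi\in\Phi_{\rm w}(\Omega)$ such that $t\mapsto\phi(x,t)$ is convex and left-continuous for every $x\in\Omega$. Conjugate: $\phi^*(x,t):=\sup_{s\ge0}(st-\phi(x,s))$. Modulus of continuity: an increasing function $\omega:[0,\infty)\to[0,\infty]$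 with $\omega(0)=\lim_{t\to0^+}\omega(t)=0$. (A0): there is $\beta\in(0,1]$ with $\phi(x,\beta)\le1\le\phi(x,\frac1\beta)$ for every $x\in\Omega$. (VA1): for every $K>0$ there is a modulus of continuity $\omega$ such that for all $x,y\in\Omega$, $\phi(x,\frac{t}{1+\omega(|x-y|)})\le\phi(y,t)+\omega(|x-y|)$ when $\phi(y,t)\in[0,\frac{K}{|x-y|^n}]$. (aDec)$_2$: there is $L_2\ge1$ such that $\frac{\phi(x,t)}{t^2}\le L_2\frac{\phi(x,s)}{s^2}$ for all $0<s\le t$ and $x\in\Omega$. Generalized Orlicz space, for $\psi\in\Phi_{\rm w}(\Omega)$: $\varrho_\psi(g):=\int_\Omega\psi(x,|g|)\,dx$ and $L^\psi(\Omega):=\{g\in L^0(\Omega)\mid\varrho_\psi(\lambda g)<\infty\text{ for some }\lambda>0\}$. $L^{1,\psi}(\Omega)$ is the set of $u\in W^{1,1}(\Omega)$ with $|\nabla u|\in L^\psi(\Omega)$. In $L^{1,\phi^p}$, $\phi^p$ is the function $(x,t)\mapsto\phi(x,t)^p$. Dual modular, for $u\in L^1(\Omega)$: $\varrho_{V,\phi}(u):=\sup\{\int_\Omega u\,\mathrm{div}\,w-\phi^*(x,|w|)\,dx \mid w\in C^1_0(\Omega;\mathbb{R}^n)\}$, where $C^1_0$ denotes $C^1$-functions with compact support in $\Omega$; the integral is $-\infty$ if $\int_\Omega\phi^*(x,|w|)\,dx=\infty$. With fidelity term: $\varrho^f_{V,\phi}(u):=\varrho_{V,\phi}(u)+\int_\Omega|u-f|^2\,dx$.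 $\Gamma$-convergence: functionals $F_p:L^2(\Omega)\to[0,\infty]$, $p>1$, $\Gamma$-converge to $F:L^2(\Omega)\to[0,\infty]$ in $L^2(\Omega)$ if for every sequence $(p_k)$ converging to one from above: (a) $F(u)\le\liminf_{k\to\infty}F_{p_k}(u_k)$ for every $u\in L^2(\Omega)$ and every sequence $u_k\to u$ in $L^2(\Omega)$; and (b) for every $u\in L^2(\Omega)$ there is some sequence $u_k\to u$ in $L^2(\Omega)$ with $F(u)\ge\limsup_{k\to\infty}F_{p_k}(u_k)$. *)

(* Defs.v *)
From HB Require Import structures.
From mathcomp Require Import all_boot all_order all_algebra.
From mathcomp Require Import all_classical all_reals all_analysis.
From mathcomp Require Import measurable_realfun.
Set Implicit Arguments.
Unset Strict Implicit.
Unset Printing Implicit Defensive.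
Import Order.TTheory GRing.Theory Num.Theory.
Import numFieldNormedType.Exports.
Local Open Scope classical_set_scope.
Local Open Scope ring_scope.

(* A function on a set Om of the plane is represented by a total function on
   R * R, and a function on [0, +oo[ by a total function on R.  Every notion
   below only looks at values at points of Om and at arguments t >= 0.
   Elements of L^0, L^1, L^2 and W^{1,1} are represented by functions rather than
   by classes of functions modulo equality almost everywhere. *)

(* The canonical norm of R * R is the maximum norm. *)
Definition enorm (R : realType) (v : R * R) : R :=
  Num.sqrt (v.1 ^+ 2 + v.2 ^+ 2).

(* leb2 is the complete Lebesgue measure of the plane: its sigma-algebra, carried
   by the copy plane R of R * R, is that of Lebesgue (not only Borel) measurable
   sets. *)
Definition borel_leb2 (R : realType) :
    {measure set (measurableTypeR R * measurableTypeR R) -> \bar R} :=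
  (@lebesgue_measure R \x @lebesgue_measure R)%E.

Notation plane R := (caratheodory_type ((borel_leb2 R)^*)%mu).

Definition leb2 (R : realType) : {measure set (plane R) -> \bar R} :=
  @completed_measure_extension _ _ R (borel_leb2 R).

Definition domain (R : realType) (Om : set (R * R)) : Prop :=
  open Om /\ connected Om.

Definition L0 (R : realType) (Om : set (R * R)) (g : R * R -> R) : Prop :=
  measurable_fun (Om : set (plane R)) (g : plane R -> R).

Definition L1 (R : realType) (Om : set (R * R)) (g : R * R -> R) : Prop :=
  L0 Om g /\ (\int[leb2 R]_(x in Om) `|g x|%:E < +oo)%E.

Definition L2 (R : realType) (Om : set (R * R)) (g : R * R -> R) : Prop :=
  L0 Om g /\ (\int[leb2 R]_(x in Om) (`|g x| ^+ 2)%:E < +oo)%E.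

Definition cvg_L2 (R : realType) (Om : set (R * R))
    (u_ : nat -> R * R -> R) (u : R * R -> R) : Prop :=
  (\int[leb2 R]_(x in Om) (`|u_ k x - u x| ^+ 2)%:E)%E @[k --> \oo] --> 0%E.

Record Phi_w (R : realType) (Om : set (R * R)) (phi : R * R -> R -> \bar R)
  : Prop := {
  Phi_w_ge0 : forall (x : R * R) (t : R), Om x -> 0 <= t -> (0 <= phi x t)%E ;
  Phi_w_meas : forall g : R * R -> R, L0 Om g ->
    measurable_fun (Om : set (plane R))
      ((fun x => phi x `|g x|) : plane R -> \bar R) ;
  Phi_w_incr : forall (x : R * R) (s t : R), Om x -> 0 <= s -> s <= t ->
    (phi x s <= phi x t)%E ;
  Phi_w_0 : forall x : R * R, Om x -> phi x 0 = 0%E ;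
  Phi_w_cvg0 : forall x : R * R, Om x -> phi x t @[t --> 0^'+] --> 0%E ;
  Phi_w_cvgy : forall x : R * R, Om x -> phi x t @[t --> +oo] --> +oo%E ;
  Phi_w_ainc : exists L : R, 1 <= L /\
    forall (x : R * R) (s t : R), Om x -> 0 < s -> s <= t ->
      (phi x s / s%:E <= L%:E * (phi x t / t%:E))%E }.

Record Phi_c (R : realType) (Om : set (R * R)) (phi : R * R -> R -> \bar R)
  : Prop := {
  Phi_c_w : Phi_w Om phi ;
  Phi_c_convex : forall (x : R * R) (s t a : R), Om x -> 0 <= s -> 0 <= t -> 0 <= a <= 1 ->
    (phi x (a * s + (1 - a) * t)%R <=
       a%:E * phi x s + (1 - a)%:E * phi x t)%E ;
  Phi_c_left : forall (x : R * R) (t : R), Om x -> 0 < t -> phi x s @[s --> t^'-] --> phi x t }.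

Definition conjugate (R : realType) (phi : R * R -> R -> \bar R)
    (x : R * R) (t : R) : \bar R :=
  ereal_sup [set ((s * t)%:E - phi x s)%E | s in [set s : R | 0 <= s]].

Definition modulus (R : realType) (w : R -> \bar R) : Prop :=
  [/\ forall r : R, 0 <= r -> (0 <= w r)%E,
      forall r s : R, 0 <= r -> r <= s -> (w r <= w s)%E,
      w 0 = 0%E &
      w r @[r --> 0^'+] --> 0%E].

Definition A0 (R : realType) (Om : set (R * R)) (phi : R * R -> R -> \bar R)
  : Prop :=
  exists b : R, 0 < b <= 1 /\
    forall x : R * R, Om x -> (phi x b <= 1)%E /\ (1 <= phi x b^-1%R)%E.

(* The exponent 2 of |x - y| is the dimension.  The quotient t / (1 + w) is
   computed in \bar R, so it is 0 when w = +oo.  The bound K / |x - y|^2 is +oo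
   when x = y. *)
Definition VA1 (R : realType) (Om : set (R * R)) (phi : R * R -> R -> \bar R)
  : Prop :=
  forall K : R, 0 < K -> exists w : R -> \bar R, modulus w /\
    forall (x y : R * R) (t : R), Om x -> Om y -> 0 <= t ->
      (0 <= phi y t <= K%:E / (enorm (x - y) ^+ 2)%:E)%E ->
      (phi x (fine (t%:E / (1 + w (enorm (x - y)%R))))
         <= phi y t + w (enorm (x - y)%R))%E.

Definition aDec2 (R : realType) (Om : set (R * R)) (phi : R * R -> R -> \bar R)
  : Prop :=
  exists L : R, 1 <= L /\
    forall (x : R * R) (s t : R), Om x -> 0 < s -> s <= t ->
      (phi x t / (t ^+ 2)%:E <= L%:E * (phi x s / (s ^+ 2)%:E))%E.

(* C^1 functions with compact support in Om, extended by 0 outside Om. *)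
Definition C1_0 (R : realType) (V : normedModType R) (Om : set (R * R))
    (w : R * R -> V) : Prop :=
  [/\ forall x, differentiable w x,
      forall v, continuous (fun x => 'D_v w x),
      compact (closure [set x | w x != 0]) &
      closure [set x | w x != 0] `<=` Om].

Definition e1 (R : realType) : R * R := (1, 0).
Definition e2 (R : realType) : R * R := (0, 1).

Definition div (R : realType) (w : R * R -> R * R) (x : R * R) : R :=
  ('D_(e1 R) w x).1 + ('D_(e2 R) w x).2.

Definition is_weak_gradient (R : realType) (Om : set (R * R))
    (u : R * R -> R) (G : R * R -> R * R) : Prop :=
  [/\ L1 Om (fun x => (G x).1), L1 Om (fun x => (G x).2) &
      forall h : R * R -> R, C1_0 Om h ->
        (\int[leb2 R]_(x in Om) (u x * 'D_(e1 R) h x)%:E =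
           - \int[leb2 R]_(x in Om) ((G x).1 * h x)%:E)%E /\
        (\int[leb2 R]_(x in Om) (u x * 'D_(e2 R) h x)%:E =
           - \int[leb2 R]_(x in Om) ((G x).2 * h x)%:E)%E].

Definition W11 (R : realType) (Om : set (R * R)) (u : R * R -> R) : Prop :=
  L1 Om u /\ exists G, is_weak_gradient Om u G.

(* For u in W^{1,1}, a weak gradient of u; it is unique almost everywhere. *)
Definition grad (R : realType) (Om : set (R * R)) (u : R * R -> R)
  : R * R -> R * R :=
  xget (fun=> 0) [set G | is_weak_gradient Om u G].

Definition modular (R : realType) (Om : set (R * R))
    (psi : R * R -> R -> \bar R) (g : R * R -> R) : \bar R :=
  (\int[leb2 R]_(x in Om) psi x `|g x|%R)%E.

Definition Lpsi (R : realType) (Om : set (R * R))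
    (psi : R * R -> R -> \bar R) (g : R * R -> R) : Prop :=
  L0 Om g /\ exists l : R, 0 < l /\ (modular Om psi (fun x => l * g x)%R < +oo)%E.

Definition L1psi (R : realType) (Om : set (R * R))
    (psi : R * R -> R -> \bar R) (u : R * R -> R) : Prop :=
  W11 Om u /\ Lpsi Om psi (fun x => enorm (grad Om u x)).

Definition Phi_pow (R : realType) (phi : R * R -> R -> \bar R) (p : R)
    (x : R * R) (t : R) : \bar R := (phi x t `^ p)%E.

Definition F_p (R : realType) (Om : set (R * R)) (phi : R * R -> R -> \bar R)
    (f : R * R -> R) (p : R) (u : R * R -> R) : \bar R :=
  if `[< L1psi Om (Phi_pow phi p) u >] then
    (\int[leb2 R]_(x in Om)
       (phi x (enorm (grad Om u x)) `^ p + (`|u x - f x| ^+ 2)%:E))%E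
  else +oo%E.

Definition dual_pairing (R : realType) (Om : set (R * R))
    (phi : R * R -> R -> \bar R) (u : R * R -> R) (w : R * R -> R * R)
  : \bar R :=
  if (\int[leb2 R]_(x in Om) conjugate phi x (enorm (w x)) == +oo)%E then -oo%E
  else (\int[leb2 R]_(x in Om)
          ((u x * div w x)%:E - conjugate phi x (enorm (w x))))%E.

Definition dual_modular (R : realType) (Om : set (R * R))
    (phi : R * R -> R -> \bar R) (u : R * R -> R) : \bar R :=
  ereal_sup [set dual_pairing Om phi u w | w in [set w | C1_0 Om w]].

Definition dual_modular_fid (R : realType) (Om : set (R * R))
    (phi : R * R -> R -> \bar R) (f : R * R -> R) (u : R * R -> R) : \bar R :=
  (dual_modular Om phi u +
     \int[leb2 R]_(x in Om) (`|u x - f x| ^+ 2)%:E)%E.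

Definition Gamma_cvg_L2 (R : realType) (Om : set (R * R))
    (F_ : R -> (R * R -> R) -> \bar R) (F : (R * R -> R) -> \bar R) : Prop :=
  forall p : nat -> R, (forall k, 1 < p k) -> p k @[k --> \oo] --> (1 : R) ->
    (forall (u : R * R -> R) (u_ : nat -> R * R -> R),
       L2 Om u -> (forall k, L2 Om (u_ k)) -> cvg_L2 Om u_ u ->
       (F u <= limn_einf (fun k => F_ (p k) (u_ k)))%E) /\
    (forall u : R * R -> R, L2 Om u ->
       exists u_ : nat -> R * R -> R,
         [/\ forall k, L2 Om (u_ k), cvg_L2 Om u_ u &
             (limn_esup (fun k => F_ (p k) (u_ k)) <= F u)%E]).

(* Main.v *)
(* Lower bound: integrating by parts, Young's inequality gives
     int u div w - phi^*(.,|w|) <= int phi(.,|grad u|)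
   for u in W^{1,1} and every test field w; moreover a <= a^p + (p - 1).

   Recovery sequence: contract u towards an interior point of Om and mollify,
   v(x) = int u(y) K(x,y) dy, so that grad v is bounded on Om.  Let s(x) be a
   difference quotient of phi(x,.) at |grad v(x)|, which makes Young's inequality
   between s(x) and |grad v(x)| nearly an equality, and test the dual modular of u
   with the adjoint mollification W of the field - s grad v / |grad v|.  This bounds
   int s |grad v| by the dual modular of u plus int phi^*(.,|W|).  By Jensen's
   inequality and (VA1) for phi^*, the latter is at most int phi^*(.,s) up to a small
   error, whence int phi(.,|grad v|) <= (dual modular of u) + error; (aDec)_2 controls
   s |grad v| by phi(.,|grad v|).  (VA1) can be used because testing
   with a single kernel K(x,.) already gives phi(x,|grad v(x)|) <= C / sg^2, where sg
   is the scale of the mollification and n = 2 is the dimension.  Finally phi^p tends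
   to phi along the bounded gradient of v; conclude by a diagonal argument. *)
Require Import Defs.
From HB Require Import structures.
From mathcomp Require Import all_boot all_order all_algebra.
From mathcomp Require Import all_classical all_reals all_analysis.
From mathcomp Require Import measurable_realfun.
From mathcomp Require Import ring lra.
Set Implicit Arguments.
Unset Strict Implicit.
Unset Printing Implicit Defensive.
Import Order.TTheory GRing.Theory Num.Theory.
Import numFieldNormedType.Exports.
Local Open Scope classical_set_scope.
Local Open Scope ring_scope.

(** * Lebesgue measure of the plane *)

(** The obstacle is a circle: (VA1) for [phi^*] may be applied to the slope [s] only below the
    threshold [K / |x - y|^2], yet keeping [s] below it rests on a bound for [phi(x, |grad v(x)|)]
    whose proof applies (VA1) to slopes. It is broken by reaching the gradient through repeated
    doubling from a small multiple of it. The resulting bound grows like [sg ^- 2] while the points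
    compared are at distance of order [sg], so one [K], hence one modulus, serves all scales. The
    contraction leaves room around each contracted point, by convexity: kernels are then compactly
    supported in [Om], and so is the adjoint mollification of any integrable field. Its price is the
    Jacobian [lam ^- 2] in one variable, compensated by a factor [lam^2] on the field. A difference
    quotient, unlike a selected subgradient, is visibly measurable in [x]. It spoils equality in
    Young's inequality by at most [h s t], which is at most [4 L h phi(x, t)]. All smooth objects
    come from one explicit $C^{1,1}$ bump, with quantitative bounds that pass through integrals. *)

Section plane_measure.
Variable R : realType.
Local Notation borel2 := (measurableTypeR R * measurableTypeR R)%type.

(** The product sigma-algebra is generated by rectangles, so an open set has to be written as a
    countable union of them: open squares with rational centre and half-side [1/(n+1)] contained in
    [U]. [P a b n] is that square if it lies in [U] and is empty otherwise, so that the union can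
    run over all indices. *)
Lemma open_measurable2 (U : set (R * R)) : open U -> measurable (U : set borel2).
Proof.
move=> oU.
pose box (a b : R) (n : nat) : set (R * R) :=
  `](a - n.+1%:R^-1), (a + n.+1%:R^-1)[ `*` `](b - n.+1%:R^-1), (b + n.+1%:R^-1)[.
pose P (a b : rat) n := [set z | box (ratr a) (ratr b) n z /\
   box (ratr a) (ratr b) n `<=` U].
have -> : U = \bigcup_a \bigcup_b \bigcup_n P a b n.
  apply/seteqP; split => [[x y] Uxy|z [a _ [b _ [n _ []]]]]; last by move=> + h; exact: h.
  have /nbhs_ballP[e /= e0 eU] := open_nbhs_nbhs (conj oU Uxy).
  have [n /= ne] : exists n : nat, n.+1%:R^-1 < e / 2.
    exists (Num.trunc (e / 2)^-1); rewrite invf_plt ?posrE ?divr_gt0 //.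
    exact: truncnS_gt.
  have n0 : 0 < n.+1%:R^-1 :> R by rewrite invr_gt0.
  have hq (z d : R) : 0 < d -> exists q : rat, z - d < ratr q < z + d.
    move=> d0; have /rat_in_itvoo[q] : z - d < z + d by lra.
    by rewrite in_itv/=; exists q.
  have [[a ha] [b hb]] := (hq x _ n0, hq y _ n0).
  exists a => //; exists b => //; exists n => //; split => /=.
    by move: ha hb; rewrite /box/= !in_itv/=; move: n.+1%:R^-1 => d; split; lra.
  move=> [s t]; rewrite /box/= !in_itv/= => -[hs ht]; apply: eU.
  rewrite -ball_normE /= prod_normE /= gt_max !ltr_norml.
  move: n.+1%:R^-1 ha hb hs ht ne => d ha hb hs ht ne; apply/andP; split.
  clear -ha hs ne.
    by lra.
  by lra.
have mb a b n : measurable (box a b n : set borel2).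
  by apply: measurableX; exact: measurable_itv.
apply: bigcupT_measurable_rat => i; apply: bigcupT_measurable_rat => j.
apply: bigcupT_measurable => n.
have [h|h] := pselect (box (ratr i) (ratr j) n `<=` U).
  rewrite (_ : P _ _ _ = box (ratr i) (ratr j) n) //.
  by apply/seteqP; split => z // -[].
rewrite (_ : P _ _ _ = set0) //.
by apply/seteqP; split => z // -[].
Qed.

Lemma borel_plane (A : set borel2) : measurable A -> measurable (A : set (plane R)).
Proof. exact: caratheodory_measurable_mu_ext. Qed.

(** Needed for Tonelli and Fubini: the squares of a nondecreasing exhaustion of the line exhaust the
    plane. *)
Lemma leb2_sigma_finite : sigma_finite [set: plane R] (leb2 R).
Proof.
apply: completed_measure_extension_sigma_finite.
have /sigma_finiteP[F [FT ndF mF]] := sigma_finiteT (@lebesgue_measure R).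
exists (fun n => F n `*` F n) => [|n].
  apply/seteqP; split=> // -[x y] _.
  have [n _ Fx] : (\bigcup_n F n) x by rewrite -FT.
  have [m _ Fy] : (\bigcup_n F n) y by rewrite -FT.
  exists (maxn n m) => //; split => /=.
    by move: x Fx; exact/subsetPset/ndF/leq_maxl.
  by move: y Fy; exact/subsetPset/ndF/leq_maxr.
have [? ?] := mF n; split; first exact: measurableX.
by rewrite /= product_measure1E// lte_mul_pinfty// ge0_fin_numE.
Qed.

HB.instance Definition _ := @Measure_isSigmaFinite.Build _ _ _
  (@completed_measure_extension _ _ R (borel_leb2 R)) leb2_sigma_finite.

Let sleb2 : {sigma_finite_measure set (plane R) -> \bar R} :=
  @completed_measure_extension _ _ R (borel_leb2 R).

Local Open Scope ereal_scope.

Lemma tonelli_leb2_measurable (f : plane R * plane R -> \bar R) :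
  measurable_fun setT f -> (forall x, 0 <= f x) ->
  measurable_fun setT (fun x => \int[leb2 R]_y f (x, y)).
Proof. exact: (@measurable_fun_fubini_tonelli_F _ _ _ _ R sleb2). Qed.

Lemma fubini_leb2 (f : plane R * plane R -> \bar R) : measurable_fun setT f ->
  \int[leb2 R]_x \int[leb2 R]_y `|f (x, y)| < +oo ->
  \int[leb2 R]_x \int[leb2 R]_y f (x, y) = \int[leb2 R]_y \int[leb2 R]_x f (x, y).
Proof.
move=> mf fi; have i := (@integrable12ltyP _ _ _ _ R sleb2 sleb2 f mf).2 fi.
exact: (@Fubini _ _ _ _ R sleb2 sleb2).
Qed.

Local Close Scope ereal_scope.

Lemma leb2_borel (A : set borel2) : measurable A -> leb2 R A = borel_leb2 R A.
Proof. by move=> mA; exact: (@measurable_mu_extE _ _ _ (borel_leb2 R) A mA). Qed.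

Lemma id_plane_measurable : measurable_fun [set: plane R] (id : plane R -> borel2).
Proof. by move=> _ A mA; rewrite setTI preimage_id; exact: borel_plane. Qed.

Lemma fst_plane_measurable : measurable_fun [set: plane R] (fst : plane R -> measurableTypeR R).
Proof. exact: (measurableT_comp measurable_fst id_plane_measurable). Qed.
Lemma snd_plane_measurable : measurable_fun [set: plane R] (snd : plane R -> measurableTypeR R).
Proof. exact: (measurableT_comp measurable_snd id_plane_measurable). Qed.

(** The identity from the complete to the Borel structure is measurable and pushes [leb2] forward to
    a measure that agrees with the product measure on Borel sets. Explicit integrals can thus be
    computed on the product of two lines. *)
Lemma ge0_integral_leb2 (f : borel2 -> \bar R) : measurable_fun setT f ->
  (forall x, 0 <= f x)%E ->
  (\int[leb2 R]_x f x = \int[borel_leb2 R]_x f x)%E.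
Proof.
move=> mf f0; have E := ge0_integral_pushforward id_plane_measurable (leb2 R) measurableT mf (fun x _ => f0 x).
rewrite preimage_setT in E; rewrite -E.
apply: eq_measure_integral => [|mid A mA _]; first exact: id_plane_measurable.
exact: leb2_borel.
Qed.

Lemma integral_leb2 (f : borel2 -> \bar R) : measurable_fun setT f ->
  (\int[leb2 R]_x f x = \int[borel_leb2 R]_x f x)%E.
Proof.
move=> mf; rewrite integralE [RHS]integralE !ge0_integral_leb2 //.
  exact: measurable_funeneg.
exact: measurable_funepos.
Qed.

Lemma integral_tensor (f g : R -> R) : measurable_fun setT f -> measurable_fun setT g ->
  (forall x, 0 <= f x) -> (forall x, 0 <= g x) ->
  (\int[leb2 R]_x (f x.1 * g x.2)%:E =
   \int[@lebesgue_measure R]_a (f a)%:E * \int[@lebesgue_measure R]_b (g b)%:E)%E.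
Proof.
move=> mf mg f0 g0.
have mfg : measurable_fun [set: borel2] (fun x : borel2 => (f x.1 * g x.2)%:E).
  apply/measurable_EFinP; apply: measurable_funM.
  - exact: measurableT_comp mf measurable_fst.
  - exact: measurableT_comp mg measurable_snd.
rewrite (@ge0_integral_leb2 (fun x => (f x.1 * g x.2)%:E)) //; last first.
  by move=> x; rewrite lee_fin mulr_ge0.
rewrite fubini_tonelli1//=; last by move=> x; rewrite lee_fin mulr_ge0.
rewrite /fubini_F /=.
under eq_integral => a _.
  under eq_integral => b _ do rewrite EFinM.
  rewrite ge0_integralZl//; first over.
  - exact/measurable_EFinP.
  - by move=> b _; rewrite lee_fin.
  - by rewrite lee_fin.
rewrite ge0_integralZr//.
- exact/measurable_EFinP.
- by move=> b _; rewrite lee_fin.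
- by apply: integral_ge0 => b _; rewrite lee_fin.
Qed.

Lemma continuous_borel2 (f : R * R -> R) : continuous f ->
  measurable_fun [set: borel2] f.
Proof.
move=> cf; apply: (measurability _ (RGenOpens.measurableE R)).
move=> _ [_ [a [b ->] <-]]; rewrite setTI; apply: open_measurable2.
by apply: (open_comp _ _); [move=> x _; exact: cf|exact: interval_open].
Qed.

Lemma continuous_plane {D : set (plane R)} (f : R * R -> R) : continuous f ->
  measurable_fun D (f : plane R -> R).
Proof.
by move=> /continuous_borel2 mf; apply: measurable_funTS; exact: (measurableT_comp mf id_plane_measurable).
Qed.

Lemma open_plane (U : set (R * R)) : open U -> measurable (U : set (plane R)).
Proof. by move=> oU; apply: borel_plane; exact: open_measurable2. Qed.

Lemma bounded_leb2 (U : set (R * R)) : open U -> bounded_set U ->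
  (leb2 R U < +oo)%E.
Proof.
move=> oU [M [Mr MU]].
have {}MU : forall x, U x -> `|x| <= M + 1 by move=> x Ux; apply: (MU (M + 1)) => //; rewrite ltrDl.
pose B : set (R * R) := `[- (M + 1), M + 1] `*` `[- (M + 1), M + 1].
have mB : measurable (B : set borel2) by apply: measurableX; exact: measurable_itv.
apply: (@le_lt_trans _ _ (leb2 R B)).
  apply: le_measure; rewrite ?inE.
  - exact: open_plane.
  - exact: borel_plane.
  move=> x /MU; rewrite prod_normE ge_max /B /= !in_itv/= => /andP[].
  by rewrite !ler_norml => -> ->.
have fin : (@lebesgue_measure R `[(- (M + 1))%R, (M + 1)%R] < +oo)%E.
  by rewrite lebesgue_measure_itv/=; case: ifPn => _; rewrite -?EFinD ltry.
rewrite leb2_borel //= product_measure1E//; try exact: measurable_itv.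
by rewrite lte_mul_pinfty// ge0_fin_numE.
Qed.

End plane_measure.

Lemma pair_ext (R : realType) (p q : R * R) : p.1 = q.1 -> p.2 = q.2 -> p = q.
Proof. by move: p q => [? ?] [? ?] /= -> ->. Qed.

(** The candidate differential, packaged as a linear map so that uniqueness of the differential
    applies to it. *)
Definition linear2 (R : realType) (a b : R) (q : R * R) : R := a * q.1 + b * q.2.

Lemma linear2_is_linear (R : realType) (a b : R) : linear (linear2 a b).
Proof. by move=> k [x1 x2] [y1 y2]; rewrite /linear2 /= /GRing.scale /=; ring. Qed.

HB.instance Definition _ (R : realType) (a b : R) :=
  GRing.isLinear.Build R (R * R)%type R _ (linear2 a b) (@linear2_is_linear R a b).

(** * Functions of class $C^{1,1}$ with explicit constants *)

Section c11.
Variable R : realType.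
Implicit Types (k : R * R -> R) (C : R) (p q : R * R).

(* [c11 k k1 k2 C]: [k] is of class C^{1,1} with partial derivatives [k1], [k2],
   all bounds being controlled by [C]. *)
Definition c11 k k1 k2 C : Prop :=
  [/\ forall p q, `|k (p + q) - k p - linear2 (k1 p) (k2 p) q| <= C * `|q| ^+ 2,
      (forall p q, `|k1 (p + q) - k1 p| <= C * `|q|) /\
      (forall p q, `|k2 (p + q) - k2 p| <= C * `|q|) &
      forall p, [/\ `|k p| <= C, `|k1 p| <= C & `|k2 p| <= C]].

Lemma norm_prod_ge (q : R * R) : `|q.1| <= `|q| /\ `|q.2| <= `|q|.
Proof. by rewrite prod_normE !le_max !lexx orbT. Qed.

Lemma linear2_continuous a b : continuous (linear2 a b : R * R -> R).
Proof.
move=> q; rewrite /linear2.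
by apply: cvgD; apply: cvgM; [exact: cvg_cst|exact: cvg_fst|exact: cvg_cst|exact: cvg_snd].
Qed.

Lemma c11_ge0 k k1 k2 C : c11 k k1 k2 C -> 0 <= C.
Proof. by move=> [_ _ /(_ 0)[+ _ _]]; exact: le_trans. Qed.

(** The remainder is at most [C * |q|^2], hence at most [e * |q|] once [|q| <= e / (C + 1)]; the
    [+ 1] covers [C = 0]. *)
Lemma c11_is_diff k k1 k2 C p : c11 k k1 k2 C ->
  is_diff p k (linear2 (k1 p) (k2 p)).
Proof.
move=> kc; have C0 := c11_ge0 kc; have [kd _ _] := kc.
pose l : {linear (R * R)%type -> R} := linear2 (k1 p) (k2 p).
have cl : continuous l by exact: linear2_continuous.
have eC (e : {posnum R}) : 0 < e%:num / (C + 1) by rewrite divr_gt0 // ltr_wpDl.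
have H : k \o shift p = cst (k p) + l +o_ (0 : R * R) id.
  apply/eqaddoP => _/posnumP[e]; near=> q => /=.
  rewrite /= [X in `|X|](_ : _ = k (p + q) - k p - linear2 (k1 p) (k2 p) q).
    apply: le_trans (kd p q) _; rewrite expr2 mulrA ler_wpM2r //.
    apply: (@le_trans _ _ ((C + 1) * `|q|)); first by rewrite ler_wpM2r // lerDl.
    rewrite mulrC -ler_pdivlMr; last by rewrite ltr_wpDl.
    near: q; exact: (@nbhs0_le R (R * R)%type _ (eC e)).
  change (k (q + p) - (k p + linear2 (k1 p) (k2 p) q) = k (p + q) - k p - linear2 (k1 p) (k2 p) q).
  by rewrite (addrC q) opprD addrA.
have := diff_unique cl H => dE.
split; last by rewrite dE.
by apply/diff_locallyP; rewrite dE; split.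
Unshelve. all: by end_near. Qed.

Lemma c11_derive k k1 k2 C p v : c11 k k1 k2 C ->
  'D_v k p = linear2 (k1 p) (k2 p) v.
Proof. by move=> kc; have dk := c11_is_diff p kc; rewrite deriveE // diff_val. Qed.

Lemma c11_differentiable k k1 k2 C p : c11 k k1 k2 C -> differentiable k p.
Proof. by move=> kc; have dk := c11_is_diff p kc. Qed.

Lemma c11_continuous k k1 k2 C : c11 k k1 k2 C -> continuous k.
Proof. by move=> kc p; apply: differentiable_continuous; exact: c11_differentiable kc. Qed.

Lemma lipschitz_continuous (V : normedModType R) (f : V -> R) C :
  (forall p q : V, `|f (p + q) - f p| <= C * `|q|) -> continuous f.
Proof.
move=> fC p; apply/cvgrPdist_le => e e0.
have C1 : 0 < `|C| + 1 by rewrite ltr_wpDl.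
near=> q; have := fC p (q - p); rewrite [p + _]addrC subrK distrC => /le_trans; apply.
rewrite (@le_trans _ _ ((`|C| + 1) * `|q - p|)) //.
  by rewrite ler_wpM2r // (le_trans (ler_norm _)) // lerDl.
rewrite mulrC -ler_pdivlMr // distrC; near: q.
by have /cvgrPdist_le/(_ _ (divr_gt0 e0 C1)) := @cvg_id _ (nbhs p).
Unshelve. all: by end_near. Qed.

Lemma c11_continuous1 k k1 k2 C : c11 k k1 k2 C -> continuous k1.
Proof. by move=> [_ [+ _] _]; exact: lipschitz_continuous. Qed.

Lemma c11_continuous2 k k1 k2 C : c11 k k1 k2 C -> continuous k2.
Proof. by move=> [_ [_ +] _]; exact: lipschitz_continuous. Qed.

Lemma c11_continuous_derive k k1 k2 C v : c11 k k1 k2 C -> continuous ('D_v k).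
Proof.
move=> kc; rewrite (_ : 'D_v k = fun p => linear2 (k1 p) (k2 p) v); last first.
  by apply/funext => p; exact: c11_derive kc.
move=> p; rewrite /linear2; apply: cvgD; apply: cvgMl.
- exact: (c11_continuous1 kc).
- exact: (c11_continuous2 kc).
Qed.

Lemma c11W k k1 k2 C C' : C <= C' -> c11 k k1 k2 C -> c11 k k1 k2 C'.
Proof.
move=> CC' [a [b c] d]; split.
- by move=> p q; rewrite (le_trans (a p q)) // ler_wpM2r // exprn_ge0.
- by split => p q; [rewrite (le_trans (b p q))|rewrite (le_trans (c p q))] => //;
    rewrite ler_wpM2r.
- by move=> p; have [u v w] := d p; split; [move: u|move: v|move: w] => /le_trans; apply.
Qed.

Lemma c11_scale a k k1 k2 C : c11 k k1 k2 C ->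
  c11 (fun p => a * k p) (fun p => a * k1 p) (fun p => a * k2 p) (`|a| * C).
Proof.
move=> [h [b c] d]; split.
- move=> p q; rewrite (_ : _ - _ = a * (k (p + q) - k p - linear2 (k1 p) (k2 p) q)).
    by rewrite normrM -mulrA ler_wpM2l.
  by rewrite /linear2; ring.
- by split => p q; rewrite -mulrBr normrM -mulrA ler_wpM2l.
- by move=> p; have [u v w] := d p; rewrite !normrM; split; rewrite ler_wpM2l.
Qed.

(** The chain rule produces the factors [1], [|s|] and [s^2]; [(1 + |s|)^2] dominates all three, so
    a single constant remains enough. *)
Lemma c11_affine (b : R * R) (s : R) k k1 k2 C : c11 k k1 k2 C ->
  c11 (fun p => k (b + s *: p)) (fun p => s * k1 (b + s *: p))
      (fun p => s * k2 (b + s *: p)) (C * (1 + `|s|) ^+ 2).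
Proof.
move=> kc; have C0 := c11_ge0 kc; have [h [l1 l2] d] := kc.
have s2 : `|s| ^+ 2 <= (1 + `|s|) ^+ 2.
  by rewrite ler_pXn2r ?nnegrE ?addr_ge0 // lerDr.
have s1 : `|s| <= (1 + `|s|) ^+ 2.
  by have := normr_ge0 s; move: `|s| => t t0; nra.
have s0 : 1 <= (1 + `|s|) ^+ 2.
  by have := normr_ge0 s; move: `|s| => t t0; nra.
split.
- move=> p q; have := h (b + s *: p) (s *: q).
  rewrite scalerDr addrA (_ : linear2 _ _ (s *: q) = linear2 (s * k1 (b + s *: p)) (s * k2 (b + s *: p)) q).
    move=> /le_trans; apply; rewrite normrZ exprMn mulrA.
    by rewrite ler_wpM2r ?exprn_ge0 // ler_wpM2l.
  by rewrite /linear2 /= /GRing.scale /=; ring.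
- have lip k' : (forall p q, `|k' (p + q) - k' p| <= C * `|q|) ->
      forall p q, `|s * k' (b + s *: (p + q)) - s * k' (b + s *: p)| <= C * (1 + `|s|) ^+ 2 * `|q|.
    move=> l p q; rewrite scalerDr addrA -mulrBr normrM.
    apply: le_trans (ler_wpM2l (normr_ge0 s) (l _ _)) _; rewrite normrZ.
    rewrite (_ : `|s| * (C * (`|s| * `|q|)) = C * `|s| ^+ 2 * `|q|); last by ring.
    by rewrite ler_wpM2r // ler_wpM2l.
  by split; apply: lip.
- move=> p; have [u v w] := d (b + s *: p); rewrite !normrM; split.
  + by rewrite (le_trans u) // ler_peMr.
  + by rewrite mulrC ler_pM.
  + by rewrite mulrC ler_pM.
Qed.

End c11.

(** * Real-valued integrals and differentiation under the integral sign *)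

Section rintegral.
Context d (T : measurableType d) (R : realType).
Variables (mu : {measure set T -> \bar R}) (D : set T) (mD : measurable D).
Implicit Types (f g Z H : T -> R).
Local Notation intg f := (mu.-integrable D (EFin \o f)).

Lemma intg_measurable f : intg f -> measurable_fun D f.
Proof. by move=> /measurable_int/measurable_EFinP. Qed.

Lemma le_intg f g : measurable_fun D f -> (forall x, D x -> `|f x| <= `|g x|) ->
  intg g -> intg f.
Proof.
move=> mf fg; by apply: le_integrable => //; exact/measurable_EFinP.
Qed.

Lemma intgD f g : intg f -> intg g -> intg (fun x => f x + g x).
Proof. by move=> fi gi; apply: (integrableD _ fi gi). Qed.

Lemma intgB f g : intg f -> intg g -> intg (fun x => f x - g x).
Proof. by move=> fi gi; apply: (integrableB _ fi gi). Qed.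

Lemma intgZ c f : intg f -> intg (fun x => c * f x).
Proof. by move=> fi; apply: (integrableZl _ c fi). Qed.

Lemma intgZr c f : intg f -> intg (fun x => f x * c).
Proof. by move=> fi; under eq_fun do rewrite mulrC; exact: intgZ. Qed.

Lemma intg_norm f : intg f -> intg (fun x => `|f x|).
Proof. by move=> fi; apply: (integrable_norm fi). Qed.

Lemma intgM_bounded Z H M : intg Z -> measurable_fun D H ->
  (forall x, D x -> `|H x| <= M) -> intg (fun x => Z x * H x).
Proof.
move=> Zi mH HM; apply: (le_intg (g := fun x => M * Z x)); last exact: intgZ.
  by apply: measurable_funM => //; exact: intg_measurable.
move=> x Dx; rewrite !normrM mulrC ler_wpM2r //.
exact: le_trans (HM _ Dx) (ler_norm _).
Qed.

Lemma norm_Rintegral_le f g : intg f -> intg g -> (forall x, D x -> `|f x| <= g x) ->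
  `|\int[mu]_(x in D) f x| <= \int[mu]_(x in D) g x.
Proof.
move=> fi gi fg; apply: le_trans (le_normr_Rintegral mD fi) _.
by apply: le_Rintegral => //; exact: intg_norm.
Qed.

Lemma Rintegral_bounded_mul_le Z H M : intg Z -> measurable_fun D H ->
  (forall x, D x -> `|H x| <= M) ->
  `|\int[mu]_(x in D) (Z x * H x)| <= M * \int[mu]_(x in D) `|Z x|.
Proof.
move=> Zi mH HM; rewrite -RintegralZl //; last exact: intg_norm.
apply: norm_Rintegral_le; [exact: (intgM_bounded Zi mH HM)|by apply/intgZ/intg_norm|].
by move=> x Dx; rewrite normrM mulrC ler_wpM2r // HM.
Qed.

Variables (Z : T -> R) (K K1 K2 : T -> R * R -> R) (C : R).
Hypothesis Zi : intg Z.
Hypothesis KC : forall x, D x -> c11 (K x) (K1 x) (K2 x) C.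
Hypothesis mK : forall p, measurable_fun D (K^~ p).
Hypothesis mK1 : forall p, measurable_fun D (K1^~ p).
Hypothesis mK2 : forall p, measurable_fun D (K2^~ p).

(** All bounds in [c11] are pointwise inequalities, uniform in the parameter [x], so they integrate
    against [|Z|]: differentiation under the integral sign needs no limit theorem. It serves both
    for mollified functions and for mollified fields. *)
Lemma c11_Rintegral : c11 (fun p => \int[mu]_(x in D) (Z x * K x p))
  (fun p => \int[mu]_(x in D) (Z x * K1 x p))
  (fun p => \int[mu]_(x in D) (Z x * K2 x p)) (C * \int[mu]_(x in D) `|Z x|).
Proof.
have bK p x : D x -> `|K x p| <= C by move=> /KC[_ _ /(_ p)[]].
have bK1 p x : D x -> `|K1 x p| <= C by move=> /KC[_ _ /(_ p)[]].
have bK2 p x : D x -> `|K2 x p| <= C by move=> /KC[_ _ /(_ p)[]].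
have iK p : intg (fun x => Z x * K x p) by exact: (intgM_bounded Zi (mK p) (bK p)).
have iK1 p : intg (fun x => Z x * K1 x p) by exact: (intgM_bounded Zi (mK1 p) (bK1 p)).
have iK2 p : intg (fun x => Z x * K2 x p) by exact: (intgM_bounded Zi (mK2 p) (bK2 p)).
split.
- move=> p q.
  pose H x := K x (p + q) - K x p - linear2 (K1 x p) (K2 x p) q.
  rewrite [X in `|X|](_ : _ = \int[mu]_(x in D) (Z x * H x)).
    rewrite mulrAC; apply: Rintegral_bounded_mul_le => //.
      apply: measurable_funB; first by apply: measurable_funB.
      by apply: measurable_funD; apply: measurable_funM.
    by move=> x /KC[+ _ _]; apply.
  have iL1 := intgZr q.1 (iK1 p); have iL2 := intgZr q.2 (iK2 p).
  have iL := intgD iL1 iL2; have iB := intgB (iK (p + q)) (iK p).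
  rewrite /linear2 -RintegralZr // -RintegralZr // -RintegralD // -RintegralB // -RintegralB //.
  by apply: eq_Rintegral => x _; rewrite /H /linear2; ring.
- split=> p q; rewrite -RintegralB //.
  + rewrite [X in `|X|](_ : _ = \int[mu]_(x in D) (Z x * (K1 x (p + q) - K1 x p))).
      rewrite mulrAC; apply: Rintegral_bounded_mul_le => //.
        exact: measurable_funB.
      by move=> x /KC[_ [+ _] _]; apply.
    by apply: eq_Rintegral => x _; rewrite mulrBr.
  + rewrite [X in `|X|](_ : _ = \int[mu]_(x in D) (Z x * (K2 x (p + q) - K2 x p))).
      rewrite mulrAC; apply: Rintegral_bounded_mul_le => //.
        exact: measurable_funB.
      by move=> x /KC[_ [_ +] _]; apply.
    by apply: eq_Rintegral => x _; rewrite mulrBr.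
- move=> p; split; apply: Rintegral_bounded_mul_le => // x Dx.
  + exact: bK.
  + exact: bK1.
  + exact: bK2.
Qed.

End rintegral.

(** * An explicit $C^{1,1}$ bump of unit mass *)

Section hump.
Variable R : realType.
Implicit Types a b x y : R.

Definition tent a : R := Num.max 0 (1 - a ^+ 2).
Definition hump a : R := 15 / 16 * tent a ^+ 2.
Definition hump1 a : R := - (15 / 4) * (a * tent a).

Lemma tent_ge0 a : 0 <= tent a. Proof. by rewrite /tent le_max lexx. Qed.

Lemma tent_le1 a : tent a <= 1.
Proof. by rewrite /tent ge_max ler01 gerBl sqr_ge0. Qed.

Lemma tent_out a : 1 <= `|a| -> tent a = 0.
Proof.
move=> a1; rewrite /tent; apply/max_idPl; rewrite subr_le0.
by rewrite -real_normK ?num_real // expr_ge1.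
Qed.

Lemma hump_ge0 a : 0 <= hump a.
Proof. by rewrite /hump mulr_ge0 ?exprn_ge0 ?tent_ge0. Qed.

Lemma humpN a : hump (- a) = hump a.
Proof. by rewrite /hump /tent sqrrN. Qed.

Lemma hump_out a : 1 <= `|a| -> hump a = 0.
Proof. by move=> /tent_out; rewrite /hump => ->; rewrite expr0n mulr0. Qed.

Lemma hump1_out a : 1 <= `|a| -> hump1 a = 0.
Proof. by move=> /tent_out; rewrite /hump1 => ->; rewrite !mulr0. Qed.

Lemma max0_sqr_taylor x y :
  `|Num.max 0 (x + y) ^+ 2 - Num.max 0 x ^+ 2 - 2 * Num.max 0 x * y| <= y ^+ 2.
Proof.
rewrite ler_norml; case: (leP 0 (x + y)) => h1; case: (leP 0 x) => h2; apply/andP; split; nra.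
Qed.

Lemma max0_lip x y : `|Num.max 0 (x + y) - Num.max 0 x| <= `|y|.
Proof.
rewrite ler_norml; have [h0|h0] := ler0P y; case: (leP 0 (x + y)) => h1; case: (leP 0 x) => h2; apply/andP; split; nra.
Qed.

Lemma hump_le a : `|hump a| <= 1.
Proof.
by have := tent_ge0 a; have := tent_le1 a; rewrite /hump ler_norml; move: (tent a) => t ? ?; apply/andP; split; nra.
Qed.

Lemma mul_tent_le a : `|a * tent a| <= 1.
Proof.
have [/ltW a1|a1] := ltP `|a| 1; last by rewrite tent_out // mulr0 normr0.
rewrite normrM mulr_ile1 //.
by rewrite ger0_norm ?tent_ge0 // tent_le1.
Qed.

Lemma hump1_le a : `|hump1 a| <= 4.
Proof.
rewrite /hump1 normrM normrN (@ger0_norm _ (15 / 4)) //.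
by have := mul_tent_le a; lra.
Qed.

(** If [|b| >= 1] the bounds on the values suffice; if [|b| < 1] and [|a| >= 2], both points lie
    outside the support. Otherwise the product rule gives [1 + 2 * 5 = 11], and [11 * 15/4 < 44]. *)
Lemma hump1_lip a b : `|hump1 (a + b) - hump1 a| <= 44 * `|b|.
Proof.
rewrite /hump1 -mulrBr normrM normrN (@ger0_norm _ (15 / 4)) //.
have lip : `|(a + b) * tent (a + b) - a * tent a| <= 11 * `|b|.
  have [b1|b1] := leP 1 `|b|.
    apply: le_trans (ler_normB _ _) _.
    have := mul_tent_le a; have := mul_tent_le (a + b); lra.
  have [a2|a2] := leP 2 `|a|.
    have ab1 : 1 <= `|a + b|.
      by have := lerB_normD a b; lra.
    rewrite !tent_out //; last by lra.
    by rewrite !mulr0 subrr normr0 mulr_ge0.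
  rewrite [X in `|X|](_ : _ = b * tent (a + b) + a * (tent (a + b) - tent a)); last by ring.
  apply: le_trans (ler_normD _ _) _; rewrite !normrM.
  have t1 : `|tent (a + b)| <= 1 by rewrite ger0_norm ?tent_ge0 ?tent_le1.
  have t2 : `|tent (a + b) - tent a| <= 5 * `|b|.
    rewrite /tent (_ : 1 - (a + b) ^+ 2 = 1 - a ^+ 2 + (- (2 * a + b) * b)); last by ring.
    apply: le_trans (max0_lip _ _) _; rewrite normrM ler_wpM2r // normrN.
    by apply: le_trans (ler_normD _ _) _; rewrite normrM (@ger0_norm _ 2) //; lra.
  have : `|b| * `|tent (a + b)| <= `|b| by rewrite ler_piMr.
  have : `|a| * `|tent (a + b) - tent a| <= 2 * (5 * `|b|).
    by apply: ler_pM => //; exact: ltW.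
  by lra.
by move: lip; have := normr_ge0 b; lra.
Qed.

Lemma hump_taylor a b : `|hump (a + b) - hump a - hump1 a * b| <= 30 * b ^+ 2.
Proof.
have bb : b ^+ 2 = `|b| ^+ 2 by rewrite real_normK ?num_real.
have [b1|b1] := leP 1 `|b|.
  apply: le_trans (ler_normB _ _) _; rewrite normrM.
  have := ler_normB (hump (a + b)) (hump a).
  have := hump_le a; have := hump_le (a + b).
  have : `|hump1 a| * `|b| <= 4 * `|b| by rewrite ler_wpM2r // hump1_le.
  by rewrite bb; move: `|b| b1 => t; nra.
have [a2|a2] := leP 2 `|a|.
  have ab1 : 1 <= `|a + b|.
    by have := lerB_normD a b; lra.
  rewrite !hump_out ?hump1_out //; try lra.
  by rewrite mul0r !subr0 normr0 mulr_ge0 ?sqr_ge0.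
(* [tent (a + b)] is the positive part of [1 - a^2] moved by [-(2a + b) b]. The part of this
   increment linear in [b] yields [hump1], the rest the term [2 tent(a) b^2]; in total
   [15/16 * (25 + 2) < 30]. *)
have := max0_sqr_taylor (1 - a ^+ 2) (- (2 * a + b) * b).
rewrite (_ : 1 - a ^+ 2 + _ = 1 - (a + b) ^+ 2); last by ring.
rewrite -!/(tent _) => h.
rewrite [X in `|X|](_ : _ = 15 / 16 *
  ((tent (a + b) ^+ 2 - tent a ^+ 2 - 2 * tent a * (- (2 * a + b) * b)) - 2 * tent a * b ^+ 2));
  last by rewrite /hump /hump1; field.
rewrite normrM (@ger0_norm _ (15 / 16)) //.
have h1 : `|2 * tent a * b ^+ 2| <= 2 * b ^+ 2.
  rewrite normrM (@ger0_norm _ (b ^+ 2)) ?sqr_ge0 // ler_wpM2r ?sqr_ge0 //.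
  by rewrite ger0_norm ?mulr_ge0 ?tent_ge0 //; have := tent_le1 a; lra.
have h2 : (- (2 * a + b) * b) ^+ 2 <= 25 * b ^+ 2.
  rewrite exprMn ler_wpM2r ?sqr_ge0 // sqrrN.
  rewrite -real_normK ?num_real //.
  have : `|2 * a + b| <= 5.
    by apply: le_trans (ler_normD _ _) _; rewrite normrM (@ger0_norm _ 2) //; lra.
  by have := normr_ge0 (2 * a + b); move: `|_| => t; nra.
have := ler_normB (tent (a + b) ^+ 2 - tent a ^+ 2 - 2 * tent a * (- (2 * a + b) * b)) (2 * tent a * b ^+ 2).
have := sqr_ge0 b; move: (b ^+ 2) h h1 h2 => B h h1 h2; lra.
Qed.

Lemma hump_lip a b : `|hump (a + b) - hump a| <= 34 * `|b|.
Proof.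
have [b1|b1] := leP 1 `|b|.
  apply: le_trans (ler_normB _ _) _.
  by have := hump_le a; have := hump_le (a + b); lra.
have := hump_taylor a b.
have : `|hump1 a * b| <= 4 * `|b| by rewrite normrM ler_wpM2r // hump1_le.
have : b ^+ 2 <= `|b|.
  by rewrite -real_normK ?num_real // expr2 ler_piMr // ltW.
have := ler_normD (hump (a + b) - hump a - hump1 a * b) (hump1 a * b); rewrite subrK.
by have := normr_ge0 b; lra.
Qed.

Definition hump2 (p : R * R) : R := hump p.1 * hump p.2.
Definition hump21 (p : R * R) : R := hump1 p.1 * hump p.2.
Definition hump22 (p : R * R) : R := hump p.1 * hump1 p.2.

(** The second-order remainder splits into the two one-dimensional ones, at most [30 |q|^2] each,
    and a cross term, at most [4 * 34 |q|^2]. The value 1000 is generous, since only its existence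
    matters. *)
Lemma c11_hump2 : c11 hump2 hump21 hump22 1000.
Proof.
split.
- move=> [a b] [x y]; rewrite /hump2 /hump21 /hump22 /linear2 /=.
  have [] := norm_prod_ge (x, y); move: `|(x, y)| => n /= xn yn.
  have n0 : 0 <= n by apply: le_trans xn.
  rewrite [X in `|X|](_ : _ = (hump (a + x) - hump a - hump1 a * x) * hump (b + y)
    + hump a * (hump (b + y) - hump b - hump1 b * y)
    + hump1 a * x * (hump (b + y) - hump b)); last by ring.
  have x2 : x ^+ 2 <= n ^+ 2 by rewrite -real_normK ?num_real // ler_pXn2r ?nnegrE.
  have y2 : y ^+ 2 <= n ^+ 2 by rewrite -real_normK ?num_real // ler_pXn2r ?nnegrE.
  have l1 : `|(hump (a + x) - hump a - hump1 a * x) * hump (b + y)| <= 30 * n ^+ 2.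
    rewrite normrM (le_trans (ler_piMr _ (hump_le _))) //.
    by apply: le_trans (hump_taylor _ _) _; lra.
  have l2 : `|hump a * (hump (b + y) - hump b - hump1 b * y)| <= 30 * n ^+ 2.
    rewrite normrM (le_trans (ler_piMl _ (hump_le _))) //.
    by apply: le_trans (hump_taylor _ _) _; lra.
  have l3 : `|hump1 a * x * (hump (b + y) - hump b)| <= (4 * n) * (34 * n).
    rewrite normrM; apply: ler_pM => //.
      by rewrite normrM; apply: ler_pM => //; exact: hump1_le.
    by apply: le_trans (hump_lip _ _) _; lra.
  have := ler_normD ((hump (a + x) - hump a - hump1 a * x) * hump (b + y)
    + hump a * (hump (b + y) - hump b - hump1 b * y)) (hump1 a * x * (hump (b + y) - hump b)).
  have := ler_normD ((hump (a + x) - hump a - hump1 a * x) * hump (b + y))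
    (hump a * (hump (b + y) - hump b - hump1 b * y)).
  by nra.
- split=> -[a b] [x y]; rewrite /hump21 /hump22 /=;
  have [] := norm_prod_ge (x, y); move: `|(x, y)| => n /= xn yn.
  + rewrite [X in `|X|](_ : _ = (hump1 (a + x) - hump1 a) * hump (b + y) +
      hump1 a * (hump (b + y) - hump b)); last by ring.
    apply: le_trans (ler_normD _ _) _; rewrite (normrM (_ - _)) (normrM (hump1 a)).
    have : `|hump1 (a + x) - hump1 a| * `|hump (b + y)| <= 44 * n * 1.
      apply: ler_pM => //; last exact: hump_le.
      by apply: le_trans (hump1_lip _ _) _; lra.
    have : `|hump1 a| * `|hump (b + y) - hump b| <= 4 * (34 * n).
      apply: ler_pM => //; first exact: hump1_le.
      by apply: le_trans (hump_lip _ _) _; lra.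
    by have := normr_ge0 x; lra.
  + rewrite [X in `|X|](_ : _ = (hump (a + x) - hump a) * hump1 (b + y) +
      hump a * (hump1 (b + y) - hump1 b)); last by ring.
    apply: le_trans (ler_normD _ _) _; rewrite (normrM (_ - _)) (normrM (hump a)).
    have : `|hump (a + x) - hump a| * `|hump1 (b + y)| <= 34 * n * 4.
      apply: ler_pM => //; last exact: hump1_le.
      by apply: le_trans (hump_lip _ _) _; lra.
    have : `|hump a| * `|hump1 (b + y) - hump1 b| <= 1 * (44 * n).
      apply: ler_pM => //; first exact: hump_le.
      by apply: le_trans (hump1_lip _ _) _; lra.
    by have := normr_ge0 x; lra.
- move=> [a b]; rewrite /hump2 /hump21 /hump22 /=
    (normrM (hump a) (hump b)) (normrM (hump1 a)) (normrM (hump a) (hump1 b)).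
  have := hump_le a; have := hump_le b; have := hump1_le a; have := hump1_le b.
  move=> h1 h2 h3 h4; split.
  + by apply: (@le_trans _ _ (1 * 1)); [exact: ler_pM|lra].
  + by apply: (@le_trans _ _ (4 * 1)); [exact: ler_pM|lra].
  + by apply: (@le_trans _ _ (1 * 4)); [exact: ler_pM|lra].
Qed.

(* Hides the numeral [1000], which the unifier would unfold in unary. *)
Lemma hump_C_sig : {C : R | 0 <= C & c11 hump2 hump21 hump22 C}.
Proof. by exists 1000; [rewrite ler0n|exact: c11_hump2]. Qed.

Definition hump_C : R := s2val hump_C_sig.

Lemma hump_C_ge0 : 0 <= hump_C. Proof. exact: s2valP hump_C_sig. Qed.

Lemma c11_hump2_C : c11 hump2 hump21 hump22 hump_C.
Proof. exact: s2valP' hump_C_sig. Qed.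

End hump.

Section hump_integral.
Variable R : realType.
Local Notation mu := (@lebesgue_measure R).

Lemma integral_is_derive (F f : R -> R) (a b : R) : a < b -> continuous f ->
  (forall x : R, is_derive x (1 : R) F (f x)) ->
  (\int[mu]_(x in `[a, b]) (f x)%:E = (F b - F a)%:E)%E.
Proof.
move=> ab cf dF; have cF (x : R) : {for x, continuous F}.
  by apply: differentiable_continuous; apply/derivable1_diffP; have [] := dF x.
rewrite (@continuous_FTC2 _ f F) //.
- exact: continuous_subspaceT.
- split.
  + by move=> x _; have [] := dF x.
  + exact/cvg_at_right_filter/cF.
  + exact/cvg_at_left_filter/cF.
- by move=> x _; rewrite derive1E; have [_ ->] := dF x.
Qed.

Lemma integral_deriv_poly (q : {poly R}) (a b : R) : a < b ->
  (\int[mu]_(x in `[a, b]) (q^`()).[x]%:E = (q.[b] - q.[a])%:E)%E.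
Proof.
by move=> ab; apply: (integral_is_derive ab); exact: continuous_horner.
Qed.

Lemma hump_continuous : continuous (@hump R).
Proof. by apply: (@lipschitz_continuous R R _ 34) => a b; exact: hump_lip. Qed.

Lemma hump_affine_measurable (s c : R) :
  measurable_fun setT (fun a : R => hump (c + s * a)).
Proof.
apply: continuous_measurable_fun => a.
apply: (@continuous_comp _ _ _ (fun a : R => c + s * a) (@hump R)).
  by apply: cvgD; [exact: cvg_cst|apply: cvgM; [exact: cvg_cst|exact: cvg_id]].
exact: hump_continuous.
Qed.

Lemma integral_hump (s c : R) : 0 < s ->
  (\int[mu]_a (hump (c + s * a))%:E = s^-1%:E)%E.
Proof.
move=> s0.
pose lo := (- 1 - c) / s; pose hi := (1 - c) / s.
have lohi : lo < hi by rewrite ltr_pM2r ?invr_gt0 //; lra.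
(* [P] is an antiderivative of [15/16 (1 - X^2)^2] with [P(1) - P(-1) = 1], so that [Q] is one of
   [hump (c + s X)] on its support [[lo, hi]]. *)
pose P : {poly R} := (15 / 16) *: ('X - (2 / 3) *: 'X^3 + (1 / 5) *: 'X^5).
pose Q : {poly R} := s^-1 *: (P \Po (c%:P + s *: 'X)).
rewrite (_ : \int[mu]_a _ = \int[mu]_(a in `[lo, hi]) (Q^`()).[a]%:E)%E; last first.
  rewrite [RHS]integral_mkcond; apply: eq_integral => a _.
  rewrite patchE; case: ifPn => [/set_mem|/negP].
    rewrite /= in_itv/= => /andP[]; rewrite ler_pdivrMr // ler_pdivlMr // => h1 h2.
    rewrite /hump /tent (max_idPr _); last first.
      have : -1 <= c + s * a <= 1 by lra.
      by move: (c + s * a) => x; nra.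
    rewrite /Q /P derivZ deriv_comp derivZ !derivD !derivN !derivZ derivX !derivXn derivC.
    rewrite !(hornerE, horner_comp, hornerXn) /=; congr EFin.
    by field; exact: lt0r_neq0.
  move=> h; rewrite hump_out // leNgt; apply/negP; rewrite ltr_norml => h'; apply: h.
  by rewrite inE/= in_itv/= ler_pdivrMr // ler_pdivlMr //; lra.
rewrite integral_deriv_poly // /Q /P !(hornerE, horner_comp, hornerXn) /= /lo /hi.
by congr EFin; field; exact: lt0r_neq0.
Qed.

Lemma integral_hump2 (s : R) (c : R * R) : s != 0 ->
  (\int[leb2 R]_p (hump2 (c + s *: p))%:E = (s ^- 2)%:E)%E.
Proof.
move=> s0; rewrite (integral_tensor (f := fun a => hump (c.1 + s * a)) (g := fun a => hump (c.2 + s * a))).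
- have [s1|s1] := ltP 0 s.
    by rewrite !integral_hump // -EFinM -invfM.
  (* Evenness reduces a negative [s], which occurs when the kernel is integrated in its second
     variable, to a positive one. *)
  have {}s1 : 0 < - s by rewrite oppr_gt0 lt_neqAle s0.
  under eq_integral do rewrite -humpN opprD -mulNr.
  under [X in (_ * X)%E]eq_integral do rewrite -humpN opprD -mulNr.
  by rewrite !integral_hump // -EFinM -invfM mulrNN.
- exact: hump_affine_measurable.
- exact: hump_affine_measurable.
- by move=> x; exact: hump_ge0.
- by move=> x; exact: hump_ge0.
Qed.

End hump_integral.

(** * The contracted mollification kernel *)

Section mollifier.
Variables (R : realType) (x0 : R * R) (lam dl : R).
Hypotheses (lam0 : 0 < lam) (dl0 : 0 < dl).
Implicit Types x y p q : R * R.

Definition shrink x : R * R := x0 + lam *: (x - x0).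

(** The kernel is centred at the contracted point [shrink x], not at [x]. The gradient of [moll x]
    is minus [(moll1, moll2)], that of [moll^~ y] is [lam] times it: derivatives in [x] are traded
    for derivatives in [y] at the cost of the factor [- lam]. *)
Definition moll x y : R := dl ^- 2 * hump2 (dl^-1 *: (shrink x - y)).
Definition moll1 x y : R := dl ^- 3 * hump21 (dl^-1 *: (shrink x - y)).
Definition moll2 x y : R := dl ^- 3 * hump22 (dl^-1 *: (shrink x - y)).

Let dln0 : dl != 0. Proof. exact: lt0r_neq0. Qed.
Let lamn0 : lam != 0. Proof. exact: lt0r_neq0. Qed.

Let dl2_ge0 : 0 <= dl ^- 2. Proof. by rewrite invr_ge0 exprn_ge0 // ltW. Qed.

(** The argument is scaled by [1 / dl] in [y] and by [lam / dl] in [x]; [(lam + 1) / dl] bounds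
    both, so one constant controls the kernel in either variable. *)
Definition moll_C : R := `|dl ^- 2| * (hump_C R * (1 + (lam + 1) / dl) ^+ 2).

Lemma c11_moll_r x : c11 (moll x) (fun y => - moll1 x y) (fun y => - moll2 x y) moll_C.
Proof.
have := c11_scale (dl ^- 2) (c11_affine (dl^-1 *: shrink x) (- dl^-1) (c11_hump2_C R)).
move=> /(@c11W _ _ _ _ _ moll_C).
rewrite (_ : (fun p => dl ^- 2 * hump2 _) = moll x); last first.
  by apply/funext => y; rewrite /moll scaleNr -scalerBr.
rewrite (_ : (fun p => dl ^- 2 * (- dl^-1 * hump21 _)) = (fun y => - moll1 x y)); last first.
  by apply/funext => y; rewrite /moll1 scaleNr -scalerBr; field.
rewrite (_ : (fun p => dl ^- 2 * (- dl^-1 * hump22 _)) = (fun y => - moll2 x y)); last first.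
  by apply/funext => y; rewrite /moll2 scaleNr -scalerBr; field.
apply; apply: ler_wpM2l => //; apply: ler_wpM2l; first exact: hump_C_ge0.
rewrite normrN gtr0_norm ?invr_gt0 //.
have i0 : 0 < dl^-1 by rewrite invr_gt0.
have i1 : 0 < lam / dl by rewrite divr_gt0.
by apply: lerXn2r; rewrite ?nnegrE ?[_ / dl]mulrDl ?mul1r; lra.
Qed.

Lemma c11_moll_l y : c11 (moll^~ y) (fun x => lam * moll1 x y) (fun x => lam * moll2 x y) moll_C.
Proof.
have := c11_scale (dl ^- 2) (c11_affine (dl^-1 *: (x0 - lam *: x0 - y)) (lam / dl) (c11_hump2_C R)).
move=> /(@c11W _ _ _ _ _ moll_C).
have e x : dl^-1 *: (x0 - lam *: x0 - y) + (lam / dl) *: x = dl^-1 *: (shrink x - y).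
  rewrite /shrink (mulrC lam) -scalerA -scalerDr; congr (_ *: _).
  by rewrite scalerBr addrAC (addrAC x0) addrA.
rewrite (_ : (fun p => dl ^- 2 * hump2 _) = moll^~ y); last first.
  by apply/funext => x; rewrite /moll e.
rewrite (_ : (fun p => dl ^- 2 * (lam / dl * hump21 _)) = (fun x => lam * moll1 x y)); last first.
  by apply/funext => x; rewrite /moll1 e; field.
rewrite (_ : (fun p => dl ^- 2 * (lam / dl * hump22 _)) = (fun x => lam * moll2 x y)); last first.
  by apply/funext => x; rewrite /moll2 e; field.
apply; apply: ler_wpM2l => //; apply: ler_wpM2l; first exact: hump_C_ge0.
rewrite gtr0_norm ?divr_gt0 //.
have i0 : 0 < dl^-1 by rewrite invr_gt0.
have i1 : 0 < lam / dl by rewrite divr_gt0.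
by apply: lerXn2r; rewrite ?nnegrE ?[_ / dl]mulrDl ?mul1r; lra.
Qed.

Lemma moll_ge0 x y : 0 <= moll x y.
Proof.
by rewrite /moll mulr_ge0 // mulr_ge0 ?hump_ge0.
Qed.

Lemma moll_le x y : moll x y <= dl ^- 2.
Proof.
rewrite /moll ler_piMr // /hump2.
have := hump_le (dl^-1 *: (shrink x - y)).1; have := hump_le (dl^-1 *: (shrink x - y)).2.
by rewrite !ger0_norm ?hump_ge0 // => a b; rewrite mulr_ile1 ?hump_ge0.
Qed.

Lemma moll_out x y : dl <= `|shrink x - y| ->
  [/\ moll x y = 0, moll1 x y = 0 & moll2 x y = 0].
Proof.
move=> h; have : 1 <= `|dl^-1 *: (shrink x - y)|.
  by rewrite normrZ gtr0_norm ?invr_gt0 // mulrC ler_pdivlMr // mul1r.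
rewrite /moll /moll1 /moll2 /hump2 /hump21 /hump22.
move: (dl^-1 *: _) => [a b]; rewrite prod_normE /= le_max => /orP[a1|b1].
- by rewrite (hump_out a1) (hump1_out a1) !mul0r !mulr0.
- by rewrite (hump_out b1) (hump1_out b1) !mulr0.
Qed.

Let measurable_arg (i : bool) : measurable_fun setT
  (fun z : plane R * plane R => dl^-1 * ((if i then x0.1 else x0.2) + lam * ((if i then (z.1).1 else (z.1).2) - (if i then x0.1 else x0.2)) - (if i then (z.2).1 else (z.2).2))).
Proof.
have m1 : measurable_fun setT (fun z : plane R * plane R => if i then (z.1).1 else (z.1).2).
  by case: i; [apply: (measurableT_comp (@fst_plane_measurable R)); exact: measurable_fst
    |apply: (measurableT_comp (@snd_plane_measurable R)); exact: measurable_fst].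
have m2 : measurable_fun setT (fun z : plane R * plane R => if i then (z.2).1 else (z.2).2).
  by clear m1; case: i; [apply: (measurableT_comp (@fst_plane_measurable R)); exact: measurable_snd
    |apply: (measurableT_comp (@snd_plane_measurable R)); exact: measurable_snd].
apply: measurable_funM; first exact: measurable_cst.
apply: measurable_funB; last exact: m2.
apply: measurable_funD; first exact: measurable_cst.
apply: measurable_funM; first exact: measurable_cst.
by apply: measurable_funB; [exact: m1|exact: measurable_cst].
Qed.

Let measurable_hump : measurable_fun setT (@hump R).
Proof. by apply: continuous_measurable_fun; exact: hump_continuous. Qed.

Let measurable_hump1 : measurable_fun setT (@hump1 R).
Proof.
apply: continuous_measurable_fun; apply: (@lipschitz_continuous R R _ 44) => a b.
exact: hump1_lip.
Qed.

Lemma moll_measurable : measurable_fun setT (fun z : plane R * plane R => moll z.1 z.2).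
Proof.
apply: measurable_funM; [exact: measurable_cst|apply: measurable_funM].
- exact: (measurableT_comp measurable_hump (measurable_arg true)).
- exact: (measurableT_comp measurable_hump (measurable_arg false)).
Qed.

Lemma moll1_measurable : measurable_fun setT (fun z : plane R * plane R => moll1 z.1 z.2).
Proof.
apply: measurable_funM; [exact: measurable_cst|apply: measurable_funM].
- exact: (measurableT_comp measurable_hump1 (measurable_arg true)).
- exact: (measurableT_comp measurable_hump (measurable_arg false)).
Qed.

Lemma moll2_measurable : measurable_fun setT (fun z : plane R * plane R => moll2 z.1 z.2).
Proof.
apply: measurable_funM; [exact: measurable_cst|apply: measurable_funM].
- exact: (measurableT_comp measurable_hump (measurable_arg true)).
- exact: (measurableT_comp measurable_hump1 (measurable_arg false)).
Qed.

Lemma moll_r_measurable {D : set (plane R)} x : measurable_fun D (moll x : plane R -> R).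
Proof. exact: continuous_plane (c11_continuous (c11_moll_r x)). Qed.

Lemma moll_l_measurable {D : set (plane R)} y : measurable_fun D (moll^~ y : plane R -> R).
Proof. exact: continuous_plane (c11_continuous (c11_moll_l y)). Qed.

Lemma moll1_r_measurable {D : set (plane R)} x : measurable_fun D (moll1 x : plane R -> R).
Proof.
rewrite (_ : moll1 x = fun y => - - moll1 x y); last by apply/funext => y; rewrite opprK.
apply: measurable_funN; exact: continuous_plane (c11_continuous1 (c11_moll_r x)).
Qed.

Lemma moll2_r_measurable {D : set (plane R)} x : measurable_fun D (moll2 x : plane R -> R).
Proof.
rewrite (_ : moll2 x = fun y => - - moll2 x y); last by apply/funext => y; rewrite opprK.
apply: measurable_funN; exact: continuous_plane (c11_continuous2 (c11_moll_r x)).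
Qed.

Lemma moll1_l_measurable {D : set (plane R)} y : measurable_fun D (moll1^~ y : plane R -> R).
Proof.
rewrite (_ : moll1^~ y = fun x => lam^-1 * (lam * moll1 x y)); last by apply/funext => x; rewrite mulKf.
apply: measurable_funM; [exact: measurable_cst|exact: continuous_plane (c11_continuous1 (c11_moll_l y))].
Qed.

Lemma moll2_l_measurable {D : set (plane R)} y : measurable_fun D (moll2^~ y : plane R -> R).
Proof.
rewrite (_ : moll2^~ y = fun x => lam^-1 * (lam * moll2 x y)); last by apply/funext => x; rewrite mulKf.
apply: measurable_funM; [exact: measurable_cst|exact: continuous_plane (c11_continuous2 (c11_moll_l y))].
Qed.

Lemma integral_moll_r x : (\int[leb2 R]_y (moll x y)%:E = 1)%E.
Proof.
have m : measurable_fun [set: plane R] (fun y : plane R => hump2 (dl^-1 *: shrink x + (- dl^-1) *: y)).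
  exact: continuous_plane (c11_continuous (c11_affine (dl^-1 *: shrink x) (- dl^-1) (c11_hump2_C R))).
have e y : dl^-1 *: (shrink x - y) = dl^-1 *: shrink x + (- dl^-1) *: y.
  by rewrite scaleNr -scalerBr.
under eq_integral => y _ do rewrite /moll e EFinM.
rewrite ge0_integralZl; first last.
- by rewrite lee_fin.
- by move=> z _; rewrite lee_fin mulr_ge0 // hump_ge0.
- exact/measurable_EFinP.
- exact: measurableT.
- rewrite integral_hump2 ?oppr_eq0 ?invr_eq0 // -EFinM.
  by rewrite (_ : dl ^- 2 * (- dl^-1) ^- 2 = 1) //; field.
Qed.

(** The contraction has Jacobian [lam^2], hence the mass [lam ^- 2] instead of 1 in this
    variable. *)
Lemma integral_moll_l y : (\int[leb2 R]_x (moll x y)%:E = (lam ^- 2)%:E)%E.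
Proof.
have e x : dl^-1 *: (shrink x - y) = dl^-1 *: (x0 - lam *: x0 - y) + (lam / dl) *: x.
  rewrite /shrink (mulrC lam) -scalerA -scalerDr; congr (_ *: _).
  by rewrite scalerBr [RHS]addrAC addrA; congr (_ - y); rewrite addrAC.
have m : measurable_fun [set: plane R] (fun x : plane R => hump2 (dl^-1 *: (x0 - lam *: x0 - y) + (lam / dl) *: x)).
  exact: continuous_plane (c11_continuous (c11_affine (dl^-1 *: (x0 - lam *: x0 - y)) (lam / dl) (c11_hump2_C R))).
under eq_integral => x _ do rewrite /moll e EFinM.
rewrite ge0_integralZl; first last.
- by rewrite lee_fin.
- by move=> z _; rewrite lee_fin mulr_ge0 // hump_ge0.
- exact/measurable_EFinP.
- exact: measurableT.
- rewrite integral_hump2 ?mulf_neq0 ?invr_neq0 // -EFinM; congr (_%:E).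
  by field; rewrite dln0 lamn0.
Qed.

End mollifier.

Lemma cvge0_near (R : realType) (u : nat -> \bar R) : u n @[n --> \oo] --> 0%E ->
  forall e : R, 0 < e -> \forall n \near \oo, (u n <= e%:E)%E.
Proof.
move=> u0 e e0.
have h : \forall n \near \oo, (u n < e%:E)%E := u0 _ (@nbhs_open_ereal_lt R 0 (fun=> e) e0).
by near=> n; apply: ltW; near: n; exact: h.
Unshelve. all: by end_near. Qed.

(** * Density of bounded Lipschitz functions in $L^1$ *)

Section density.
Variables (R : realType) (Om : set (plane R)).
Hypotheses (mOm : measurable Om) (Omfin : (leb2 R Om < +oo)%E).
Local Notation mu := (leb2 R).
Local Notation borel2 := (measurableTypeR R * measurableTypeR R)%type.

Definition lipb (h : R * R -> R) : Prop :=
  (exists C, forall p q : R * R, `|h (p + q) - h p| <= C * `|q|) /\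
  (exists B, forall p : R * R, `|h p| <= B).

Lemma lipb_measurable h : lipb h -> measurable_fun Om (h : plane R -> R).
Proof.
move=> [[C hC] _]; apply: continuous_plane.
exact: lipschitz_continuous hC.
Qed.

Lemma lipb_cst c : lipb (fun=> c).
Proof.
split; last by exists `|c|.
by exists 0 => p q; rewrite subrr normr0 mul0r.
Qed.

Lemma lipbD f g : lipb f -> lipb g -> lipb (fun x => f x + g x).
Proof.
move=> [[C fC] [B fB]] [[C' gC] [B' gB]]; split.
- exists (C + C') => p q; rewrite opprD addrACA mulrDl.
  by apply: le_trans (ler_normD _ _) _; apply: lerD.
- by exists (B + B') => p; apply: le_trans (ler_normD _ _) _; apply: lerD.
Qed.

Lemma lipbM f g : lipb f -> lipb g -> lipb (fun x => f x * g x).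
Proof.
move=> [[C fC] [B fB]] [[C' gC] [B' gB]]; split.
- exists (C * B' + B * C') => p q.
  rewrite [X in `|X|](_ : _ = (f (p + q) - f p) * g (p + q) + f p * (g (p + q) - g p)); last by ring.
  apply: le_trans (ler_normD _ _) _; rewrite !normrM mulrDl mulrAC -[X in _ <= _ + X]mulrA.
  by apply: lerD; apply: ler_pM.
- by exists (B * B') => p; rewrite normrM; apply: ler_pM.
Qed.

(** This class is shown to contain, in turn, indicators of quadrants, of Borel sets and of Lebesgue
    measurable sets, then simple functions and finally all integrable functions on [Om]. *)
Definition approx (g : plane R -> R) : Prop := measurable_fun Om g /\
  forall e : R, 0 < e -> exists2 h, lipb h &
    (\int[mu]_(x in Om) `|g x - h x|%:E <= e%:E)%E.

Lemma integral_normB_le (f g h : plane R -> R) : measurable_fun Om f ->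
  measurable_fun Om g -> measurable_fun Om h ->
  (\int[mu]_(x in Om) `|f x - h x|%:E <=
   \int[mu]_(x in Om) `|f x - g x|%:E + \int[mu]_(x in Om) `|g x - h x|%:E)%E.
Proof.
move=> mf mg mh.
have m (u v : plane R -> R) : measurable_fun Om u -> measurable_fun Om v ->
    measurable_fun Om (fun x => `|u x - v x|%:E).
  move=> mu' mv; apply/measurable_EFinP; apply: measurableT_comp; first exact: normr_measurable.
  exact: measurable_funB.
rewrite -ge0_integralD; first last.
- exact: m.
- by move=> x _; rewrite lee_fin.
- exact: m.
- by move=> x _; rewrite lee_fin.
- exact: mOm.
apply: ge0_le_integral.
- exact: mOm.
- by move=> x _; rewrite lee_fin.
- exact: m.
- by apply: emeasurable_funD; exact: m.
- move=> x _; rewrite -EFinD lee_fin.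
  by rewrite (le_trans _ (ler_normD _ _)) // addrA subrK.
Qed.

Lemma approx_close (g : plane R -> R) : measurable_fun Om g ->
  (forall e : R, 0 < e -> exists2 g', approx g' &
     (\int[mu]_(x in Om) `|g x - g' x|%:E <= e%:E)%E) -> approx g.
Proof.
move=> mg H; split=> // e e0; have e20 : 0 < e / 2 by rewrite divr_gt0.
have [g' [mg' ag'] gg'] := H _ e20; have [h lh g'h] := ag' _ e20.
exists h => //; apply: le_trans (integral_normB_le mg mg' (lipb_measurable lh)) _.
by rewrite [e]splitr EFinD; apply: leeD.
Qed.

Lemma approx_lipb h : lipb h -> approx h.
Proof.
move=> lh; split; first exact: lipb_measurable.
move=> e e0; exists h => //.
rewrite integral0_eq ?lee_fin ?ltW // => x _.
by rewrite subrr normr0.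
Qed.

Lemma approxD f g : approx f -> approx g -> approx (fun x => f x + g x).
Proof.
move=> [mf af] [mg ag]; have mfg : measurable_fun Om (fun x => f x + g x).
  exact: measurable_funD.
split=> // e e0; have e20 : 0 < e / 2 by rewrite divr_gt0.
have [h lh fh] := af _ e20; have [h' lh' gh'] := ag _ e20.
exists (fun x => h x + h' x); first exact: lipbD.
have mh := lipb_measurable lh; have mh' := lipb_measurable lh'.
have mid : measurable_fun Om (fun x => h x + g x) by exact: measurable_funD.
apply: le_trans (integral_normB_le mfg mid _) _; first exact: measurable_funD.
rewrite [e]splitr EFinD; apply: leeD.
- have E x : f x + g x - (h x + g x) = f x - h x by ring.
  by under eq_integral do rewrite E.
- have E x : h x + g x - (h x + h' x) = g x - h' x by ring.
  by under eq_integral do rewrite E.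
Qed.

Lemma approxZ c f : approx f -> approx (fun x => c * f x).
Proof.
move=> [mf af]; have mcf : measurable_fun Om (fun x => c * f x).
  by apply: measurable_funM => //; exact: measurable_cst.
split=> // e e0; have c0 : 0 < `|c| + 1 by rewrite ltr_wpDl.
have e20 : 0 < e / (`|c| + 1) by rewrite divr_gt0.
have [h lh fh] := af _ e20.
exists (fun x => c * h x); first by apply: lipbM => //; exact: lipb_cst.
have mh := lipb_measurable lh.
have mfh : measurable_fun Om (fun x => `|f x - h x|%:E).
  apply/measurable_EFinP; apply: measurableT_comp; first exact: normr_measurable.
  exact: measurable_funB.
under eq_integral do rewrite -mulrBr normrM EFinM.
rewrite ge0_integralZl; first last.
- by rewrite lee_fin.
- by move=> x _; rewrite lee_fin.
- exact: mfh.
- exact: mOm.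
apply: (@le_trans _ _ ((`|c| + 1)%:E * (e / (`|c| + 1))%:E)%E).
  apply: lee_pmul => //.
    by apply: integral_ge0 => x _; rewrite lee_fin.
  by rewrite lee_fin lerDl.
by rewrite -EFinM lee_fin mulrC divfK // lt0r_neq0.
Qed.

Lemma approx_lim (g_ : nat -> plane R -> R) (g F : plane R -> R) :
  (forall n, approx (g_ n)) -> measurable_fun Om g ->
  (forall x, Om x -> g_ n x @[n --> \oo] --> g x) ->
  mu.-integrable Om (EFin \o F) ->
  (forall n x, Om x -> `|g_ n x| <= F x) -> approx g.
Proof.
move=> ag mg gg iF gF; apply: approx_close => // e e0.
have mgn n : measurable_fun Om (fun x => (g_ n x)%:E).
  by apply/measurable_EFinP; have [] := ag n.
have mgE : measurable_fun Om (fun x => (g x)%:E) by exact/measurable_EFinP.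
have cv : {ae mu, forall x, Om x -> (g_ n x)%:E @[n --> \oo] --> (g x)%:E}.
  by apply: aeW => x Ox; apply: cvg_EFin; [exact: nearW|exact: gg].
have dm : {ae mu, forall x n, Om x -> (`|(g_ n x)%:E| <= (EFin \o F) x)%E}.
  by apply: aeW => x n Ox; rewrite /= lee_fin gF.
have [_ + _] := dominated_convergence mOm mgn mgE cv iF dm.
move=> /cvge0_near/(_ e e0)[N _ /(_ N (leqnn N))] /= h.
exists (g_ N) => //; apply: le_trans h.
by under eq_integral do rewrite distrC.
Qed.

Lemma intg_cst c : mu.-integrable Om (EFin \o (fun=> c)).
Proof.
apply/integrableP; split; first by apply/measurable_EFinP; exact: measurable_cst.
under eq_integral do rewrite /=.
rewrite (@integral_cst _ _ _ mu Om mOm `|c|%:E).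
by rewrite lte_mul_pinfty // ?lee_fin.
Qed.

Lemma cvg_eventually_cst (u : nat -> R) l N : (forall n, (N <= n)%N -> u n = l) ->
  u n @[n --> \oo] --> l.
Proof. by move=> h; apply: cvg_near_cst; exists N. Qed.

Lemma approx_indicC (A : set (plane R)) : measurable A ->
  approx \1_A -> approx \1_(~` A).
Proof.
move=> mA aA; rewrite (_ : \1_(~` A) = (fun x => 1 + (-1) * \1_A x)).
  by apply: approxD; [apply: approx_lipb; exact: lipb_cst|exact: approxZ].
apply/funext => x; rewrite !indicE in_setC; case: (x \in A) => /=; rewrite ?mulr1 ?mulr0 ?addr0 ?subrr //.
Qed.

Lemma approx_indic_bigcup (F : (set (plane R))^nat) :
  (forall n, measurable (F n)) -> trivIset setT F ->
  (forall n, approx \1_(F n)) -> approx \1_(\bigcup_k F k).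
Proof.
move=> mF tF aF; pose U n := \big[setU/set0]_(k < n) F k.
have mU n : measurable (U n) by apply: bigsetU_measurable => k _; exact: mF.
have aU n : approx \1_(U n).
  elim: n => [|n IH].
    rewrite /U big_ord0 indic0; apply: approx_lipb; exact: lipb_cst.
  rewrite (_ : \1_(U n.+1) = (fun x => \1_(U n) x + \1_(F n) x)).
    exact: approxD.
  apply/funext => x; rewrite !indicE /U big_ord_recr /= in_setU.
  have [h1|] := boolP (x \in \big[setU/set0]_(k < n) F k); last by rewrite add0r.
  have [h2|] := boolP (x \in F n); last by rewrite addr0.
  exfalso; move: h1 h2; rewrite !inE -bigcup_mkord => -[k /= kn Fk] Fn.
  have := tF k n I I (ex_intro _ x (conj Fk Fn)) => kn'.
  by rewrite kn' ltnn in kn.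
apply: (approx_lim aU (F := fun=> 1)).
- apply: measurable_funTS; apply: measurable_indic; exact: bigcup_measurable.
- move=> x _; have [[k _ Fk]|nF] := pselect ((\bigcup_k F k) x).
    apply: (@cvg_eventually_cst _ _ k.+1) => n kn.
    rewrite !indicE !mem_set //; first by exists k.
    by rewrite /U -bigcup_mkord; exists k.
  apply: (@cvg_eventually_cst _ _ 0) => n _.
  rewrite !indicE !memNset // /U -bigcup_mkord => -[k _ Fk].
  by apply: nF; exists k.
- exact: intg_cst.
- by move=> n x _; rewrite indicE; case: (_ \in _); rewrite ?normr1 ?normr0.
Qed.

(** It vanishes up to [a] and reaches 1 at [a + 1/n], so that the limit is the indicator of the open
    ray, with value 0 at [a] itself. *)
Definition ramp (a : R) (n : nat) (t : R) : R :=
  Num.min 1 (Num.max 0 (n%:R * (t - a))).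

Lemma ramp_itv a n t : 0 <= ramp a n t <= 1.
Proof. by rewrite /ramp le_min ler01 le_max lexx /= ge_min lexx. Qed.

Lemma ramp_lip a n s t : `|ramp a n (s + t) - ramp a n s| <= n%:R * `|t|.
Proof.
have n0 : 0 <= n%:R :> R by [].
have mx (x y : R) : `|Num.min 1 (Num.max 0 x) - Num.min 1 (Num.max 0 y)| <= `|x - y|.
  rewrite ler_norml; case: (ler0P (x - y)) => ?; rewrite /Num.min /Num.max;
  repeat case: ifPn; rewrite -?leNgt => *; apply/andP; split; lra.
apply: le_trans (mx _ _) _; rewrite -mulrBr normrM ger0_norm //.
by rewrite (_ : s + t - a - (s - a) = t) //; ring.
Qed.

Lemma ramp_cvg a t : ramp a n t @[n --> \oo] --> (\1_(`]a, +oo[%classic : set R) t : R).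
Proof.
rewrite indicE; have [ta|ta] := leP t a.
  rewrite memNset /= ?in_itv/= ?andbT -?leNgt //; last by apply/negP; rewrite -leNgt.
  apply: (@cvg_eventually_cst _ _ 0) => n _; rewrite /ramp (max_idPl _).
    by rewrite (min_idPr _).
  by rewrite mulr_ge0_le0 // subr_le0.
rewrite mem_set /= ?in_itv/= ?andbT //.
have ta0 : 0 < t - a by rewrite subr_gt0.
apply: (@cvg_eventually_cst _ _ (Num.trunc (t - a)^-1).+1) => n hn; rewrite /ramp.
have h : 1 <= n%:R * (t - a).
  rewrite -ler_pdivrMr // mul1r; apply: le_trans (_ : _ <= (Num.trunc (t - a)^-1).+1%:R) _.
    exact/ltW/truncnS_gt.
  by rewrite ler_nat.
rewrite (max_idPr _); last by apply: le_trans h.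
by rewrite (min_idPl _).
Qed.

(** The whole line is included so that quadrants contain half-planes, which make the two coordinates
    measurable for the generated sigma-algebra. *)
Definition ray : set (set R) := [set A | A = setT \/ exists x : R, A = `]x, +oo[%classic].

Lemma rayI A B : ray A -> ray B -> ray (A `&` B).
Proof.
move=> [->|[x ->]] [->|[y ->]]; rewrite ?setTI ?setIT; [by left|by right; exists y|by right; exists x|].
right; exists (Num.max x y); apply/seteqP; split=> t /=; rewrite !in_itv/= !andbT.
  by move=> []; rewrite gt_max => -> ->.
by rewrite gt_max => /andP[].
Qed.

Lemma ray_approx A : ray A -> exists f : nat -> R -> R,
  [/\ forall n, exists C, forall s t, `|f n (s + t) - f n s| <= C * `|t|,
      forall n t, 0 <= f n t <= 1 & forall t, f n t @[n --> \oo] --> (\1_A t : R)].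
Proof.
move=> [->|[x ->]].
  exists (fun _ _ => 1); split.
  - by move=> n; exists 0 => s t; rewrite subrr normr0 mul0r.
  - by move=> n t; rewrite ler01 lexx.
  - by move=> t; rewrite indicT; exact: cvg_cst.
exists (ramp x); split; [|exact: ramp_itv|exact: ramp_cvg].
by move=> n; exists n%:R; exact: ramp_lip.
Qed.

Definition quadrant : set (set borel2) := [set A `*` B | A in ray & B in ray].

Lemma quadrantI : setI_closed quadrant.
Proof.
move=> _ _ [A rA [B rB <-]] [A' rA' [B' rB' <-]].
exists (A `&` A'); first exact: rayI.
by exists (B `&` B'); [exact: rayI|rewrite setXI].
Qed.

Lemma measurable_ray A : ray A -> measurable (A : set (measurableTypeR R)).
Proof. by move=> [->|[x ->]]; [exact: measurableT|exact: measurable_itv]. Qed.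

Lemma measurable_quadrantE : @measurable _ borel2 = <<s quadrant >>.
Proof.
apply/seteqP; split.
  apply: smallest_sub; first exact: smallest_sigma_algebra.
  have mf : measurable_fun setT (fst : g_sigma_algebraType quadrant -> measurableTypeR R).
    apply: (measurability _ (RGenOInfty.measurableE R)) => _ [_ [x ->] <-].
    apply: sub_sigma_algebra; exists `]x, +oo[%classic; first by right; exists x.
    by exists setT; [left|rewrite setTI setXT].
  have ms : measurable_fun setT (snd : g_sigma_algebraType quadrant -> measurableTypeR R).
    apply: (measurability _ (RGenOInfty.measurableE R)) => _ [_ [x ->] <-].
    apply: sub_sigma_algebra; exists setT; first by left.
    by exists `]x, +oo[%classic; [right; exists x|rewrite setTI setTX].
  move=> _ [[A mA <-]|[A mA <-]]; [exact: mf|exact: ms].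
apply: smallest_sub; first exact: sigma_algebra_measurable.
by move=> _ [A rA [B rB <-]]; apply: measurableX; exact: measurable_ray.
Qed.

Lemma approx_indic_quadrant A : quadrant A -> approx \1_A.
Proof.
move=> qA; have mA : measurable (A : set borel2).
  by rewrite measurable_quadrantE; exact: sub_sigma_algebra.
case: qA mA => B rB [C rC <-] mBC.
have [f [fl f1 fB]] := ray_approx rB; have [g [gl g1 gC]] := ray_approx rC.
apply: (@approx_lim (fun n x => f n x.1 * g n x.2) _ (fun=> 1)).
- move=> n; apply: approx_lipb; apply: lipbM; (split; last first).
  + by exists 1 => p; have /andP[? ?] := f1 n p.1; rewrite ger0_norm.
  + have [D hD] := fl n; exists `|D| => -[p1 p2] [q1 q2] /=; apply: le_trans (hD _ _) _.
    apply: (@le_trans _ _ (`|D| * `|q1|)); first by rewrite ler_wpM2r // ler_norm.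
    by rewrite ler_wpM2l //; have [] := norm_prod_ge (q1, q2).
  + by exists 1 => p; have /andP[? ?] := g1 n p.2; rewrite ger0_norm.
  + have [D hD] := gl n; exists `|D| => -[p1 p2] [q1 q2] /=; apply: le_trans (hD _ _) _.
    apply: (@le_trans _ _ (`|D| * `|q2|)); first by rewrite ler_wpM2r // ler_norm.
    by rewrite ler_wpM2l //; have [] := norm_prod_ge (q1, q2).
- by apply: measurable_funTS; apply: measurable_indic; exact: borel_plane.
- move=> [x y] _ /=; rewrite (_ : \1_(B `*` C) (x, y) = \1_B x * \1_C y :> R).
    by apply: cvgM; [exact: fB|exact: gC].
  by rewrite !indicE in_setX -natrM mulnb.
- exact: intg_cst.
- move=> n x _; have /andP[? ?] := f1 n x.1; have /andP[? ?] := g1 n x.2.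
  by rewrite ger0_norm ?mulr_ge0 // mulr_ile1.
Qed.

(** Dynkin's argument: quadrants form a pi-system generating the Borel sets, and Borel sets with
    approximable indicator are stable under complements and countable disjoint unions. *)
Lemma approx_indic_borel (A : set borel2) : measurable A -> approx \1_A.
Proof.
rewrite measurable_quadrantE.
have := @dynkin_induction _ borel2 quadrant (fun S : set (plane R) => approx \1_S)
  measurable_quadrantE quadrantI; apply.
- by rewrite indicT; apply: approx_lipb; exact: lipb_cst.
- exact: approx_indic_quadrant.
- by move=> S mS; apply: approx_indicC; exact: borel_plane.
- by move=> F mF; apply: approx_indic_bigcup => n; exact: borel_plane.
Qed.

Lemma leb2_inf (X : set borel2) : leb2 R X =
  ereal_inf [set (\sum_(k <oo) borel_leb2 R (F k))%E | F in @measurable_cover _ borel2 X].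
Proof. by rewrite /leb2 /= /completed_measure_extension /mu_ext. Qed.

(** The complete measure is an outer measure: the part of [A] in [Om] is covered by Borel sets of
    total measure exceeding its own by less than [e]. Finiteness of the measure of [Om] allows the
    subtraction that bounds the excess of the cover. *)
Lemma approx_indic (A : set (plane R)) : measurable A -> approx \1_A.
Proof.
move=> mA; have mAO : measurable (A `&` Om) by exact: measurableI.
apply: approx_close; first by apply: measurable_funTS; exact: measurable_indic.
move=> e e0.
have fA : leb2 R (A `&` Om) \is a fin_num.
  rewrite ge0_fin_numE; last exact: measure_ge0.
  apply: le_lt_trans Omfin; apply: le_measure; rewrite ?inE //; exact: subIsetr.
rewrite leb2_inf in fA.
have [_ [F [mF AF] <-]] := lb_ereal_inf_adherent e0 fA; rewrite -leb2_inf in fA * => hF.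
pose B := \bigcup_k F k.
have mB : measurable (B : set borel2) by apply: bigcup_measurable => k _; exact: mF.
have mB' := borel_plane mB.
exists \1_B; first exact: approx_indic_borel.
have XB : A `&` Om `<=` B by exact: AF.
have BA : (leb2 R (B `\` (A `&` Om)) <= e%:E)%E.
  have : (leb2 R (A `&` Om) + leb2 R (B `\` (A `&` Om)) <= leb2 R (A `&` Om) + e%:E)%E.
    rewrite -measureU; first last.
    - by rewrite setDIK.
    - exact: measurableD.
    - exact: mAO.
    rewrite setDUK //; apply: le_trans (ltW hF).
    apply: (@le_trans _ _ (\sum_(k <oo) leb2 R (F k))%E).
      by apply: (measure_sigma_subadditive (leb2 R)) => // k; exact: borel_plane.
    by apply: lee_nneseries => k *; rewrite leb2_borel.
  by rewrite leeD2lE.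
apply: le_trans BA; have mD : measurable ((B `\` (A `&` Om)) : set (plane R)) by exact: measurableD.
have E : {in Om, forall x : plane R, `|\1_A x - \1_B x : R|%:E = (\1_(B `\` (A `&` Om)) x)%:E}.
  move=> x /set_mem Ox; congr (_%:E); rewrite !indicE in_setD in_setI (mem_set Ox) andbT.
  have [/set_mem Ax|xA] := boolP (x \in A).
    by rewrite (mem_set (XB _ (conj Ax Ox))) /= subrr normr0.
  by case: (x \in B); rewrite /= ?sub0r ?subrr ?normrN ?normr1 ?normr0.
rewrite (eq_integral _ _ E) integral_indic; [|exact: mOm|exact: mD].
by apply: le_measure; rewrite ?inE; [exact: measurableI|exact: mD|exact: subIsetl].
Qed.

Lemma approx_sum (I : eqType) (s : seq I) (g : I -> plane R -> R) :
  (forall i, i \in s -> approx (g i)) -> approx (fun x => \sum_(i <- s) g i x).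
Proof.
elim: s => [|i s IH] ag.
  by under eq_fun do rewrite big_nil; apply: approx_lipb; exact: lipb_cst.
under eq_fun do rewrite big_cons.
apply: approxD; first by apply: ag; rewrite mem_head.
by apply: IH => j js; apply: ag; rewrite in_cons js orbT.
Qed.

Import HBSimple.

Lemma approx_integrable (g : plane R -> R) : mu.-integrable Om (EFin \o g) -> approx g.
Proof.
move=> ig; apply: approx_close; first exact: intg_measurable ig.
have [g_ [ig_ _ /cvge0_near gg]] := approximation_sfun_integrable mOm ig.
move=> e e0; have [N _ /(_ N (leqnn N))] := gg e e0.
move=> h; exists (g_ N); last exact: h.
rewrite (_ : (g_ N : plane R -> R) = fun x =>
  \sum_(i <- finmap.enum_fset (fset_set (range (g_ N)))) (i * \1_(g_ N @^-1` [set i]) x)).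
  apply: (@approx_sum _ _ (fun i x => i * \1_(g_ N @^-1` [set i]) x)) => i _; apply: approxZ; apply: approx_indic.
  exact: measurable_sfunP.
by apply/funext => x; rewrite fimfunE fsbig_finite.
Qed.

End density.

(** * Compactly supported fields *)

Lemma bounded_closed_compact2 (R : realType) (A : set (R * R)) (M : R) :
  (forall p, A p -> `|p| <= M) -> closed A -> compact A.
Proof.
move=> AM cA; apply: (@subclosed_compact _ _ (`[- M, M]%classic `*` `[- M, M]%classic)) => //.
  by apply: compact_setX; exact: segment_compact.
move=> [a b] /AM; rewrite prod_normE ge_max /= !in_itv/= => /andP[].
by rewrite !ler_norml => -> ->.
Qed.

Lemma continuous_pairl (R : realType) (y : R) : continuous (fun t : R => (t, y)).
Proof.
move=> t; apply/cvgrPdist_lt => e e0; near=> s.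
rewrite prod_normE /= subrr normr0 gt_max e0 andbT; near: s.
by have /cvgrPdist_lt/(_ _ e0) := @cvg_id _ (nbhs t).
Unshelve. all: by end_near. Qed.

Lemma continuous_pairr (R : realType) (y : R) : continuous (fun t : R => (y, t)).
Proof.
move=> t; apply/cvgrPdist_lt => e e0; near=> s.
rewrite prod_normE /= subrr normr0 gt_max e0 /=; near: s.
by have /cvgrPdist_lt/(_ _ e0) := @cvg_id _ (nbhs t).
Unshelve. all: by end_near. Qed.

Section C1_0.
Variable R : realType.
Local Notation mu := (leb2 R).

Section facts.
Context (V : normedModType R) (Om : set (R * R)) (w : R * R -> V).
Hypothesis wC : C1_0 Om w.
Let K := closure [set x | w x != 0].

Lemma C1_0_out x : ~ K x -> w x = 0.
Proof. by move=> nK; apply/eqP; apply: contra_notT nK => wx; exact: subset_closure. Qed.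

Lemma C1_0_D_out v x : ~ K x -> 'D_v w x = 0.
Proof.
move=> nK; have -> : 'D_v w x = 'D_v (cst (0 : V)) x.
  have oK : open (~` K) by apply: closed_openC; exact: closed_closure.
  apply: near_eq_derive; have := open_nbhs_nbhs (conj oK (nK : (~` K) x)).
  by apply: filterS => y /C1_0_out.
exact: derive_cst.
Qed.

Lemma C1_0_continuous : continuous w.
Proof. by move=> x; apply: differentiable_continuous; have [] := wC. Qed.

Lemma C1_0_supp_bounded : exists M : R, forall x, K x -> `|x| <= M.
Proof.
have [_ _ cK _] := wC; have [M [_ /(_ (M + 1))]] := compact_bounded cK.
by rewrite ltrDl => /(_ ltr01) h; exists (M + 1).
Qed.

Lemma supp_bounded (U : normedModType R) (g : R * R -> U) : continuous g ->
  (forall x, ~ K x -> g x = 0) -> exists B, forall x, `|g x| <= B.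
Proof.
move=> cg g0; have [_ _ cK _] := wC.
have [M [_ /(_ (`|M| + 1)) hM]] := compact_bounded (continuous_compact (continuous_subspaceT cg) cK).
exists (`|M| + 1) => x; have [Kx|nK] := pselect (K x).
  by apply: hM; [rewrite ltr_pwDr // ler_norm|exists x].
by rewrite g0 // normr0 addr_ge0.
Qed.

Lemma C1_0_bounded : exists B, forall x, `|w x| <= B.
Proof. by apply: supp_bounded; [exact: C1_0_continuous|exact: C1_0_out]. Qed.

Lemma C1_0_D_bounded v : exists B, forall x, `|'D_v w x| <= B.
Proof. by apply: supp_bounded; [have [] := wC|exact: C1_0_D_out]. Qed.

End facts.

(** Reduces the support condition to vanishing outside some bounded closed subset of [Om], which
    mollified objects provide directly. *)
Lemma C1_0_closed_supp (V : normedModType R) (Om B : set (R * R)) (w : R * R -> V) (M : R) :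
  (forall x, differentiable w x) -> (forall v, continuous (fun x => 'D_v w x)) ->
  closed B -> (forall x, B x -> `|x| <= M) -> B `<=` Om -> (forall x, w x != 0 -> B x) ->
  C1_0 Om w.
Proof.
move=> dw cDw cB BM BO wB; have KB : closure [set x | w x != 0] `<=` B.
  by rewrite [X in _ `<=` X](closure_id B).1 //; apply: closure_subset.
split => //; last by apply: subset_trans BO.
by apply: (bounded_closed_compact2 (M := M)); [move=> p /KB; exact: BM|exact: closed_closure].
Qed.

Lemma derivable_line1 (G : R * R -> R) (a b : R) : differentiable G (a, b) ->
  is_derive a (1 : R) (fun t => G (t, b)) ('D_(e1 R) G (a, b)).
Proof.
move=> dG; have /diff_derivable : differentiable G (a, b) by [].
move=> /(_ (e1 R)) dGe.
have E : (fun h : R => h^-1 *: (((fun t => G (t, b)) \o shift a) (h *: (1 : R)) - G (a, b)))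
   = (fun h : R => h^-1 *: ((G \o shift (a, b)) (h *: e1 R) - G (a, b))).
  apply/funext => h /=; congr (_ *: (G _ - _)); apply: pair_ext; rewrite /= /GRing.scale /= ?mulr1 //; ring.
by apply: DeriveDef; [rewrite /derivable E|rewrite /derive E].
Qed.

Lemma derivable_line2 (G : R * R -> R) (a b : R) : differentiable G (a, b) ->
  is_derive b (1 : R) (fun t => G (a, t)) ('D_(e2 R) G (a, b)).
Proof.
move=> dG; have /diff_derivable : differentiable G (a, b) by [].
move=> /(_ (e2 R)) dGe.
have E : (fun h : R => h^-1 *: (((fun t => G (a, t)) \o shift b) (h *: (1 : R)) - G (a, b)))
   = (fun h : R => h^-1 *: ((G \o shift (a, b)) (h *: e2 R) - G (a, b))).
  apply/funext => h /=; congr (_ *: (G _ - _)); apply: pair_ext; rewrite /= /GRing.scale /= ?mulr1 //; ring.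
by apply: DeriveDef; [rewrite /derivable E|rewrite /derive E].
Qed.

Lemma integral_derive_line (F g : R -> R) (M : R) : 0 <= M ->
  (forall t, is_derive t (1 : R) F (g t)) -> continuous g ->
  (forall t, M < `|t| -> F t = 0 /\ g t = 0) ->
  (\int[@lebesgue_measure R]_t (g t)%:E = 0)%E.
Proof.
move=> M0 dF cg out.
have MM : - (M + 1) < M + 1 by lra.
transitivity (\int[@lebesgue_measure R]_(t in `[(- (M + 1))%R, (M + 1)%R]) (g t)%:E)%E.
  rewrite [RHS]integral_mkcond; apply: eq_integral => t _; rewrite patchE.
  case: ifPn => // /negP; rewrite inE /= in_itv /= -ler_norml => /negP; rewrite -ltNge => h.
  by have [] := out t; [apply: lt_trans h; rewrite ltrDl|move=> _ ->].
rewrite (integral_is_derive MM cg dF).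
have [-> _] : F (M + 1) = 0 /\ g (M + 1) = 0 by apply: out; rewrite ger0_norm ?addr_ge0 // ltrDl.
have [-> _] : F (- (M + 1)) = 0 /\ g (- (M + 1)) = 0 by apply: out; rewrite normrN ger0_norm ?addr_ge0 // ltrDl.
by rewrite subrr.
Qed.

Local Notation borel2 := (measurableTypeR R * measurableTypeR R)%type.

Lemma continuous_supp_integrable (g : R * R -> R) (M B : R) : continuous g ->
  (forall x, `|g x| <= B) -> (forall x, M < `|x| -> g x = 0) ->
  (borel_leb2 R).-integrable setT (EFin \o g : borel2 -> \bar R).
Proof.
move=> cg gB gM; have mg := continuous_borel2 cg.
pose Q : set borel2 := `[(- M), M]%classic `*` `[(- M), M]%classic.
have mQ : measurable Q by apply: measurableX; exact: measurable_itv.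
have QM x : ~ Q x -> M < `|x|.
  move=> nQ; rewrite ltNge; apply/negP => h; apply: nQ; move: h.
  rewrite prod_normE ge_max /Q /= !in_itv /= => /andP[].
  by rewrite !ler_norml => -> ->.
have fQ : (borel_leb2 R Q < +oo)%E.
  have fin : (@lebesgue_measure R `[(- M)%R, M] < +oo)%E.
    by rewrite lebesgue_measure_itv/=; case: ifPn => _; rewrite -?EFinD ltry.
  rewrite /= product_measure1E; [|exact: measurable_itv|exact: measurable_itv].
  by rewrite lte_mul_pinfty// ge0_fin_numE.
have iQ : (borel_leb2 R).-integrable Q (EFin \o (fun=> B)).
  apply/integrableP; split; first by apply/measurable_EFinP; exact: measurable_cst.
  by rewrite (@integral_cst _ _ _ (borel_leb2 R) Q mQ `|B|%:E) lte_mul_pinfty // ?lee_fin.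
have iB := (integrable_mkcond _ mQ).1 iQ.
apply: le_integrable iB.
- exact: measurableT.
- exact/measurable_EFinP.
- move=> x _; rewrite patchE /=; case: ifPn => [_|/negP]; rewrite ?inE /= lee_fin.
    exact: le_trans (gB x) (ler_norm _).
  by move=> /QM/gM ->; rewrite normr0.
Qed.

Section vanish.
Variable G : R * R -> R.
Hypothesis GC : C1_0 setT G.

Let vanish : exists M : R, forall x, `|M| < `|x| -> G x = 0 /\ forall v, 'D_v G x = 0.
Proof.
have [M hM] := C1_0_supp_bounded GC; exists M => x Mx.
have nK : ~ closure [set y | G y != 0] x.
  by move=> /hM; apply/negP; rewrite -ltNge; apply: le_lt_trans Mx; exact: ler_norm.
by split=> [|v]; [exact: C1_0_out nK|exact: C1_0_D_out nK].
Qed.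

Let iD v : (borel_leb2 R).-integrable setT (EFin \o ('D_v G) : borel2 -> \bar R).
Proof.
have [_ cDG _ _] := GC; have [M out] := vanish; have [B hB] := C1_0_D_bounded GC v.
exact: (continuous_supp_integrable (cDG v) hB (fun x Mx => (out x Mx).2 v)).
Qed.

Lemma integral_D1_eq0 : (\int[mu]_x ('D_(e1 R) G x)%:E = 0)%E.
Proof.
have [dG cDG _ _] := GC; have [M out] := vanish.
rewrite (@integral_leb2 R (fun x => ('D_(e1 R) G x)%:E)); last exact: measurable_int (iD _).
rewrite -(integral21_prod_meas1 (iD _)) integral0_eq // => y _.
rewrite /fubini_G /=.
apply: (@integral_derive_line (fun t => G (t, y)) (fun t => 'D_(e1 R) G (t, y)) `|M|) => //.
- by move=> t; exact: derivable_line1.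
- by move=> t; apply: (@continuous_comp _ _ _ (fun t : R => (t, y)) ('D_(e1 R) G)); [exact: continuous_pairl|exact: cDG].
- by move=> t Mt; have [|-> ->] := out (t, y) => //; apply: lt_le_trans Mt _; have [] := norm_prod_ge (t, y).
Qed.

Lemma integral_D2_eq0 : (\int[mu]_x ('D_(e2 R) G x)%:E = 0)%E.
Proof.
have [dG cDG _ _] := GC; have [M out] := vanish.
rewrite (@integral_leb2 R (fun x => ('D_(e2 R) G x)%:E)); last exact: measurable_int (iD _).
rewrite -(integral12_prod_meas1 (iD _)) integral0_eq // => x _.
rewrite /fubini_F /=.
apply: (@integral_derive_line (fun t => G (x, t)) (fun t => 'D_(e2 R) G (x, t)) `|M|) => //.
- by move=> t; exact: derivable_line2.
- by move=> t; apply: (@continuous_comp _ _ _ (fun t : R => (x, t)) ('D_(e2 R) G)); [exact: continuous_pairr|exact: cDG].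
- by move=> t Mt; have [|-> ->] := out (x, t) => //; apply: lt_le_trans Mt _; have [] := norm_prod_ge (x, t).
Qed.

End vanish.

Variables (Om : set (R * R)) (oOm : open Om).
Let mOm := open_plane oOm.

Section ibp.
Variables (v h : R * R -> R).
Hypotheses (dv : forall x, differentiable v x)
  (cDv : forall d, continuous (fun x => 'D_d v x)) (hC : C1_0 Om h).

Let cv : continuous v. Proof. by move=> x; exact: differentiable_continuous. Qed.

Lemma deriveM2 d x : 'D_d (fun y => v y * h y) x = v x * 'D_d h x + 'D_d v x * h x.
Proof.
have [dh _ _ _] := hC; rewrite (_ : (fun y => v y * h y) = v * h) //.
rewrite deriveM; [|exact: diff_derivable|exact: diff_derivable].
by rewrite /GRing.scale /= [h x * _]mulrC.
Qed.

Lemma C1_0_mul : C1_0 setT (fun y => v y * h y).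
Proof.
have [dh cDh cK KO] := hC; have [M hM] := C1_0_supp_bounded hC.
apply: (@C1_0_closed_supp _ _ (closure [set x | h x != 0]) _ M) => //.
- by move=> x; exact: differentiableM.
- move=> d; rewrite (_ : (fun x => 'D_d (fun y => v y * h y) x) = fun x => v x * 'D_d h x + 'D_d v x * h x); last first.
    by apply/funext => x; exact: deriveM2.
  move=> x; apply: cvgD; apply: cvgM; [exact: cv|exact: cDh|exact: cDv|exact: (C1_0_continuous hC)].
- exact: closed_closure.
- by move=> x; rewrite mulf_eq0 negb_or => /andP[_ hx]; exact: subset_closure.
Qed.

(** [v h] has compact support because [h] has, so the integral of its derivative over the plane
    vanishes, and outside [Om] the product rule contributes 0. The vanishing is the premise [ibp0],
    because it is proved separately along each axis, by integrating first along lines parallel to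
    it. *)
Lemma integral_ibp d (ibp0 : (\int[mu]_x ('D_d (fun y => v y * h y) x)%:E = 0)%E) :
  mu.-integrable Om (EFin \o (fun x => v x * 'D_d h x)) ->
  mu.-integrable Om (EFin \o (fun x => 'D_d v x * h x)) ->
  (\int[mu]_(x in Om) (v x * 'D_d h x)%:E = - \int[mu]_(x in Om) ('D_d v x * h x)%:E)%E.
Proof.
move=> i1 i2; have [_ _ _ KO] := hC.
have f2 : (\int[mu]_(x in Om) ('D_d v x * h x)%:E)%E \is a fin_num by exact: integrable_fin_num i2.
have S : (\int[mu]_(x in Om) (v x * 'D_d h x)%:E + \int[mu]_(x in Om) ('D_d v x * h x)%:E = 0)%E.
  rewrite -(integralD_EFin mOm i1 i2) -[RHS]ibp0 integral_mkcond; apply: eq_integral => x _.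
  rewrite patchE deriveM2; case: ifPn => // /negP; rewrite inE => nO.
  have nK : ~ closure [set y | h y != 0] x by move=> /KO.
  by rewrite (C1_0_out nK) (C1_0_D_out _ nK) !mulr0 addr0.
by rewrite -[LHS](addeK _ f2) S add0e.
Qed.

End ibp.

End C1_0.

(** * Contracted mollification *)

Section fubini_on.
Variables (R : realType) (D : set (plane R)) (mD : measurable D).
Local Notation mu := (leb2 R).
Local Open Scope ereal_scope.

Let integral_on (F : plane R * plane R -> \bar R) :
  \int[mu]_(x in D) \int[mu]_(y in D) F (x, y) =
  \int[mu]_x \int[mu]_y (F \_ (D `*` D)) (x, y).
Proof.
rewrite integral_mkcond; apply: eq_integral => x _; rewrite patchE.
have [xD|xD] := boolP (x \in D).
  rewrite integral_mkcond; apply: eq_integral => y _.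
  by rewrite !patchE in_setX /= xD.
rewrite integral0_eq // => y _.
by rewrite patchE in_setX /= (negbTE xD).
Qed.

Let integral_on_swap (F : plane R * plane R -> \bar R) :
  \int[mu]_(y in D) \int[mu]_(x in D) F (x, y) =
  \int[mu]_y \int[mu]_x (F \_ (D `*` D)) (x, y).
Proof.
rewrite integral_mkcond; apply: eq_integral => y _; rewrite patchE.
have [yD|yD] := boolP (y \in D).
  rewrite integral_mkcond; apply: eq_integral => x _.
  by rewrite !patchE in_setX /= yD andbT.
rewrite integral0_eq // => x _.
by rewrite patchE in_setX /= (negbTE yD) andbF.
Qed.

Let mDD : measurable (D `*` D). Proof. exact: measurableX. Qed.

Lemma tonelli_on_measurable (F : plane R * plane R -> \bar R) :
  measurable_fun (D `*` D) F -> (forall z, D z.1 -> D z.2 -> 0 <= F z) ->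
  measurable_fun D (fun x => \int[mu]_(y in D) F (x, y)).
Proof.
move=> mF F0; have m : measurable_fun setT (fun x => \int[mu]_y (F \_ (D `*` D)) (x, y)).
  apply: tonelli_leb2_measurable; first by apply/(measurable_restrictT _ mDD).
  by move=> z; rewrite patchE; case: ifPn => // /set_mem[]; exact: F0.
apply: (eq_measurable_fun (fun x => \int[mu]_y (F \_ (D `*` D)) (x, y))).
  move=> x xD; rewrite [RHS]integral_mkcond; apply: eq_integral => y _.
  by rewrite !patchE in_setX /= xD.
exact: measurable_funTS.
Qed.

Lemma fubini_on (F : plane R * plane R -> \bar R) : measurable_fun (D `*` D) F ->
  \int[mu]_(x in D) \int[mu]_(y in D) `|F (x, y)| < +oo ->
  \int[mu]_(x in D) \int[mu]_(y in D) F (x, y) =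
  \int[mu]_(y in D) \int[mu]_(x in D) F (x, y).
Proof.
move=> mF fin; rewrite integral_on integral_on_swap; apply: fubini_leb2.
  by apply/(measurable_restrictT _ mDD).
rewrite (integral_on (fun z => `|F z|)) in fin; apply: le_lt_trans fin.
rewrite le_eqVlt; apply/orP; left; apply/eqP; apply: eq_integral => x _; apply: eq_integral => y _.
by rewrite !patchE; case: ifPn => //; rewrite abse0.
Qed.

End fubini_on.

Section kernel.
Variables (R : realType) (D : set (plane R)) (mD : measurable D).
Local Notation mu := (leb2 R).
Local Notation intg f := (mu.-integrable D (EFin \o f)).

Lemma measurable_fst_on (Z : plane R -> R) : measurable_fun D Z ->
  measurable_fun (D `*` D) (fun z : plane R * plane R => Z z.1).
Proof.
move=> mZ; apply: (measurable_comp mD _ mZ); first by move=> _ [z [z1 _] <-].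
by apply: measurable_funTS; exact: measurable_fst.
Qed.

Lemma measurable_snd_on (Z : plane R -> R) : measurable_fun D Z ->
  measurable_fun (D `*` D) (fun z : plane R * plane R => Z z.2).
Proof.
move=> mZ; apply: (measurable_comp mD _ mZ); first by move=> _ [z [_ z2] <-].
by apply: measurable_funTS; exact: measurable_snd.
Qed.

Lemma EFin_Rintegral (f : plane R -> R) : intg f ->
  (\int[mu]_(x in D) (f x)%:E = (\int[mu]_(x in D) f x)%R%:E)%E.
Proof. by move=> fi; rewrite /Rintegral fineK //; exact: integrable_fin_num. Qed.

(** This is the adjointness between mollifying [u] and mollifying a field. A bounded kernel makes
    the integrand dominated by [C |Z(x)| |u(y)|], whose double integral is finite. *)
Lemma fubini_kernel (u Z : plane R -> R) (k : plane R -> plane R -> R) C : 0 <= C ->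
  intg u -> intg Z ->
  measurable_fun setT (fun z : plane R * plane R => k z.1 z.2) ->
  (forall x, measurable_fun D (k x)) -> (forall y, measurable_fun D (k^~ y)) ->
  (forall x y, `|k x y| <= C) ->
  \int[mu]_(y in D) (u y * \int[mu]_(x in D) (Z x * k x y)) =
  \int[mu]_(x in D) (Z x * \int[mu]_(y in D) (u y * k x y)).
Proof.
move=> C0 iu iZ mk mk1 mk2 kC.
have muu := intg_measurable iu; have mZ := intg_measurable iZ.
have ix x : intg (fun y => u y * k x y) by apply: (intgM_bounded mD iu (mk1 x)) => y _; exact: kC.
have iy y : intg (fun x => Z x * k x y) by apply: (intgM_bounded mD iZ (mk2 y)) => x _; exact: kC.
pose F (z : plane R * plane R) := (Z z.1 * u z.2 * k z.1 z.2)%:E.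
pose H (z : plane R * plane R) := (`|Z z.1| * (C * `|u z.2|))%:E.
have mDD : measurable (D `*` D) by exact: measurableX.
have mF : measurable_fun (D `*` D) F.
  apply/measurable_EFinP; apply: measurable_funM; last exact: measurable_funTS.
  by apply: measurable_funM; [exact: measurable_fst_on|exact: measurable_snd_on].
have mH : measurable_fun (D `*` D) H.
  apply/measurable_EFinP; apply: measurable_funM.
    by apply: (measurable_fst_on (Z := fun x => `|Z x|)); apply: measurableT_comp mZ; exact: normr_measurable.
  apply: measurable_funM; first exact: measurable_cst.
  by apply: (measurable_snd_on (Z := fun x => `|u x|)); apply: measurableT_comp muu; exact: normr_measurable.
have mFn : measurable_fun (D `*` D) (fun z => `|F z|%E).
  by apply: measurableT_comp mF; exact: abse_measurable.
have inu := intgZ mD C (intg_norm iu).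
have fin : (\int[mu]_(x in D) \int[mu]_(y in D) `|F (x, y)| < +oo)%E.
  apply: (@le_lt_trans _ _ (\int[mu]_(x in D) \int[mu]_(y in D) H (x, y))%E).
    apply: ge0_le_integral; [exact: mD| | | |].
    - by move=> x _; apply: integral_ge0 => y _; exact: abse_ge0.
    - by apply: (tonelli_on_measurable mD mFn) => z _ _; exact: abse_ge0.
    - by apply: (tonelli_on_measurable mD mH) => z _ _; rewrite lee_fin !mulr_ge0.
    - move=> x Dx; apply: ge0_le_integral; [exact: mD| | | |].
      + by move=> y _; exact: abse_ge0.
      + apply: measurableT_comp; first exact: abse_measurable.
        rewrite (_ : (fun y => F (x, y)) = EFin \o (fun y => Z x * (u y * k x y))).
          exact: measurable_int (intgZ mD (Z x) (ix x)).
        by apply/funext => y; rewrite /F /= mulrA.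
      + exact: measurable_int (intgZ mD `|Z x| inu).
      + move=> y Dy; rewrite /F /H /= lee_fin !normrM -mulrA ler_wpM2l // mulrC ler_wpM2r //.
  rewrite (eq_integral (fun x => (`|Z x| * \int[mu]_(y in D) (C * `|u y|))%:E)); last first.
    move=> x _; rewrite -(RintegralZl _ mD inu) -EFin_Rintegral //.
    exact: intgZ.
  by apply: integrable_lty; [exact: mD|exact: (intgZr mD _ (intg_norm iZ))].
have := fubini_on mD mF fin.
rewrite (eq_integral (fun x => (Z x * \int[mu]_(y in D) (u y * k x y))%:E)); last first.
  move=> x _; rewrite -(RintegralZl _ mD (ix x)) -(EFin_Rintegral (intgZ mD _ (ix x))).
  by apply: eq_integral => y _; rewrite /F /= mulrA.
rewrite [in X in _ = X -> _](eq_integral (fun y => (u y * \int[mu]_(x in D) (Z x * k x y))%:E)); last first.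
  move=> y _; rewrite -(RintegralZl _ mD (iy y)) -(EFin_Rintegral (intgZ mD _ (iy y))).
  by apply: eq_integral => x _; rewrite /F /= mulrCA mulrA.
by move=> e; rewrite /Rintegral -e.
Qed.

End kernel.

Lemma sqr_add3_le (R : realDomainType) (a b c : R) :
  (a + b - c) ^+ 2 <= 3 * (a ^+ 2 + b ^+ 2 + c ^+ 2).
Proof.
have := sqr_ge0 (a - b); have := sqr_ge0 (a + c); have := sqr_ge0 (b + c).
by rewrite !expr2; lra.
Qed.

Definition clamp (R : realType) (N t : R) : R := Num.max (- N) (Num.min N t).

Lemma clamp_le (R : realType) (N t : R) : 0 <= N -> `|clamp N t| <= N.
Proof.
move=> N0; rewrite ler_norml /clamp le_max lexx /= ge_max ge_min lexx /= andbT; lra.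
Qed.

Lemma clamp_id (R : realType) (N t : R) : `|t| <= N -> clamp N t = t.
Proof.
by rewrite ler_norml => /andP[a b]; rewrite /clamp (min_idPr b) (max_idPr a).
Qed.

Lemma clamp_dist (R : realType) (N t : R) : 0 <= N -> `|t - clamp N t| <= `|t|.
Proof.
move=> N0; rewrite /clamp; case: (leP N t) => h1; case: (leP (- N) _) => h2;
  by rewrite ler_norml; case: (ler0P t) => h3; apply/andP; split; lra.
Qed.

Lemma clamp_norm (R : realType) (N t : R) : 0 <= N -> `|clamp N t| <= `|t|.
Proof.
move=> N0; rewrite /clamp; case: (leP N t) => h1; case: (leP (- N) _) => h2;
  by rewrite ler_norml; case: (ler0P t) => h3; apply/andP; split; lra.
Qed.

Lemma add3_le_sixth (R : realFieldType) (a b c e : R) :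
  a <= 4 * c -> b <= e / 6 -> c <= e / 6 -> a + b + c <= e.
Proof. lra. Qed.

Lemma add3_le_tenth (R : realFieldType) (a b c e : R) :
  a <= 4 * c -> b <= e / 6 -> c <= e / 30 -> 3 * (a + b + c) <= e.
Proof. lra. Qed.

(** With [sg <= 1/2] this bounds the mass [lam ^- 2] of the kernel in its first variable: origin of
    the factor 4 in the $L^1$ estimates. *)
Lemma inv_sqr_le4 (R : realFieldType) (t : R) : t <= 2^-1 -> (1 - t) ^- 2 <= 4.
Proof.
move=> t1; have h4 : 4^-1 <= (1 - t) ^+ 2 by rewrite expr2; nra.
by rewrite -[leRHS]invrK lef_pV2 ?posrE ?invr_gt0 ?exprn_gt0 //; lra.
Qed.

Section C1_0_pair.
Variable R : realType.

Lemma derive_pair (w1 w2 : R * R -> R) v x : differentiable w1 x -> differentiable w2 x ->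
  'D_v (fun y => (w1 y, w2 y)) x = ('D_v w1 x, 'D_v w2 x).
Proof.
move=> d1 d2; rewrite !deriveE //; last exact: differentiable_pair.
by rewrite diff_pair.
Qed.

Lemma C1_0_pair (Om B : set (R * R)) (M : R) (w1 w11 w12 w2 w21 w22 : R * R -> R) (C1 C2 : R) :
  c11 w1 w11 w12 C1 -> c11 w2 w21 w22 C2 ->
  closed B -> (forall x, B x -> `|x| <= M) -> B `<=` Om ->
  (forall x, (w1 x, w2 x) != 0 -> B x) ->
  C1_0 Om (fun y => (w1 y, w2 y)) /\ div (fun y => (w1 y, w2 y)) = (fun y => w11 y + w22 y).
Proof.
move=> h1 h2 cB BM BO wB; split.
  apply: C1_0_closed_supp cB BM BO wB.
    move=> x; apply: differentiable_pair; [exact: c11_differentiable h1|exact: c11_differentiable h2].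
  move=> v; have -> : (fun x => 'D_v (fun y => (w1 y, w2 y)) x) = (fun x => ('D_v w1 x, 'D_v w2 x)).
    by apply/funext => x; apply: derive_pair; [exact: c11_differentiable h1|exact: c11_differentiable h2].
  have c1 := c11_continuous_derive (v := v) h1; have c2 := c11_continuous_derive (v := v) h2.
  move=> x; exact: (cvg_pair (c1 x) (c2 x)).
apply/funext => x; rewrite /div !derive_pair; try exact: c11_differentiable h1; try exact: c11_differentiable h2.
by rewrite /= (c11_derive _ _ h1) (c11_derive _ _ h2) /linear2 /=; ring.
Qed.

End C1_0_pair.

(* The point [x0] is the centre of the contraction used to push [Om] into itself. *)
Record geometry (R : realType) (Om : set (R * R)) (x0 : R * R) (r M : R) : Prop := {
  geo_open : open Om ;
  geo_fin : (leb2 R Om < +oo)%E ;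
  geo_convex : forall (x y : R * R) (t : R), Om x -> Om y -> 0 <= t <= 1 ->
    Om (t *: x + (1 - t) *: y) ;
  geo_r : 0 < r ;
  geo_box : forall p : R * R, `|p - x0| <= 2 * r -> Om p ;
  geo_M : forall x : R * R, Om x -> `|x - x0| <= M }.

Section mollify.
Variables (R : realType) (Om : set (R * R)) (x0 : R * R) (r M : R).
Hypothesis geo : geometry Om x0 r M.
Let oOm := geo_open geo.
Let Omfin := geo_fin geo.
Let r0 := geo_r geo.
Local Notation mu := (leb2 R).
Local Notation intg f := (mu.-integrable Om (EFin \o f)).
Local Notation msble f := (measurable_fun (Om : set (plane R)) (f : plane R -> R)).

Lemma geo_center : Om x0.
Proof. by apply: (geo_box geo); rewrite subrr normr0 mulr_ge0 // ltW. Qed.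

Lemma geo_M_ge0 : 0 <= M.
Proof. by apply: le_trans (geo_M geo geo_center); rewrite subrr normr0. Qed.

Lemma geo_measurable : measurable (Om : set (plane R)).
Proof. exact: open_plane. Qed.
Let mOm := geo_measurable.

Lemma c11_intg k k1 k2 C : c11 k k1 k2 C -> [/\ intg k, intg k1 & intg k2].
Proof.
move=> kc; have [_ _ b] := kc.
split; apply: (le_intg mOm (g := fun=> C)); try exact: intg_cst.
- by apply: continuous_plane; exact: c11_continuous kc.
- by move=> x _; apply: le_trans (ler_norm _); have [] := b x.
- by apply: continuous_plane; exact: c11_continuous1 kc.
- by move=> x _; apply: le_trans (ler_norm _); have [] := b x.
- by apply: continuous_plane; exact: c11_continuous2 kc.
- by move=> x _; apply: le_trans (ler_norm _); have [] := b x.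
Qed.

Section fixed_sigma.
Variable sg : R.
Hypothesis sg01 : 0 < sg <= 2^-1.

Let sg0 : 0 < sg. Proof. by have /andP[] := sg01. Qed.
Local Notation lam := (1 - sg).
Local Notation dl := (sg * r).
Let lam0 : 0 < lam. Proof. by have /andP[] := sg01; lra. Qed.
Let dl0 : 0 < dl. Proof. by rewrite mulr_gt0. Qed.
Local Notation T := (shrink x0 lam).
Local Notation K := (moll x0 lam dl).

Lemma shrink_in x q : Om x -> `|q| <= 2 * dl -> Om (T x + q).
Proof.
move=> Ox qd.
(* Convexity: the displacement [q] is carried by the point [x0 + q / sg], which stays in the box of
   radius [2 r] around the centre. *)
rewrite (_ : T x + q = lam *: x + (1 - lam) *: (x0 + sg^-1 *: q)).
  apply: (geo_convex geo) => //; last by have /andP[] := sg01; lra.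
  apply: (geo_box geo); rewrite addrAC subrr add0r normrZ gtr0_norm ?invr_gt0 // mulrC ler_pdivrMr //.
  by move: qd; lra.
have sgn0 : sg != 0 by exact: lt0r_neq0.
by apply: pair_ext; rewrite /shrink /= /GRing.scale /=; field.
Qed.

Lemma shrink_dist x : Om x -> `|T x - x| <= sg * M.
Proof.
move=> Ox; rewrite (_ : T x - x = - (sg *: (x - x0))).
  by rewrite normrN normrZ gtr0_norm // ler_wpM2l ?(ltW sg0) // (geo_M geo).
by apply: pair_ext; rewrite /shrink /= /GRing.scale /=; ring.
Qed.

(** On the support of the kernel, [|y - x| <= |y - T x| + |T x - x| < sg r + sg M]. Values of
    [phi^*] at two points will be compared only within this range. *)
Lemma moll_dist x y : Om x -> sg * (r + M) < `|y - x| ->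
  [/\ K x y = 0, moll1 x0 lam dl x y = 0 & moll2 x0 lam dl x y = 0].
Proof.
move=> Ox yx; apply: moll_out => //; rewrite leNgt; apply/negP => h.
have := shrink_dist Ox; have := ler_normB (T x - x) (T x - y).
rewrite (_ : T x - x - (T x - y) = y - x); last by apply: pair_ext; rewrite /=; ring.
by move: yx h; lra.
Qed.

Lemma moll_in x y : Om x -> ~ Om y ->
  [/\ K x y = 0, moll1 x0 lam dl x y = 0 & moll2 x0 lam dl x y = 0].
Proof.
move=> Ox nOy; apply: moll_out => //; rewrite leNgt; apply/negP => h; apply: nOy.
rewrite -(subrK (T x) y) addrC; apply: shrink_in => //.
by rewrite distrC; have := dl0; lra.
Qed.

Lemma integral_moll_Om x : Om x -> (\int[mu]_(y in Om) (K x y)%:E = 1)%E.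
Proof.
move=> Ox; rewrite -(integral_moll_r x0 lam dl0 x) integral_mkcond.
apply: eq_integral => y _; rewrite patchE; case: ifPn => // /negP.
rewrite inE => nOy; by have [->] := moll_in Ox nOy.
Qed.

Lemma moll_intg x : intg (K x).
Proof.
apply: (le_intg mOm (g := fun=> dl ^- 2)); last exact: intg_cst.
  exact: moll_r_measurable.
move=> y _; rewrite !ger0_norm ?moll_ge0 ?moll_le //.
by rewrite invr_ge0 exprn_ge0 // ltW.
Qed.

Lemma Rintegral_moll x : Om x -> \int[mu]_(y in Om) K x y = 1.
Proof. by move=> Ox; rewrite /Rintegral integral_moll_Om. Qed.

Definition mollify (u : R * R -> R) (x : R * R) : R := \int[mu]_(y in Om) (u y * K x y).

Lemma mulK_intg u x : intg u -> intg (fun y => u y * K x y).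
Proof.
move=> iu; apply: (intgM_bounded mOm iu (M := dl ^- 2)).
  exact: moll_r_measurable.
by move=> y _; rewrite ger0_norm ?moll_ge0 // moll_le.
Qed.

Lemma mollifyB u v x : intg u -> intg v ->
  mollify (fun y => u y - v y) x = mollify u x - mollify v x.
Proof.
move=> iu iv; rewrite /mollify -RintegralB //; try exact: mulK_intg.
by apply: eq_Rintegral => y _; rewrite mulrBl.
Qed.

Lemma c11_mollify u : intg u -> c11 (mollify u)
  (fun x => \int[mu]_(y in Om) (u y * (lam * moll1 x0 lam dl x y)))
  (fun x => \int[mu]_(y in Om) (u y * (lam * moll2 x0 lam dl x y)))
  (moll_C lam dl * \int[mu]_(y in Om) `|u y|).
Proof.
move=> iu; refine (@c11_Rintegral _ _ _ mu Om mOm u (fun y x => K x y)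
  (fun y x => lam * moll1 x0 lam dl x y) (fun y x => lam * moll2 x0 lam dl x y) (moll_C lam dl) iu _ _ _ _).
- by move=> y _; apply: c11_moll_l.
- by move=> x; apply: moll_r_measurable.
- move=> x; apply: measurable_funM; first exact: measurable_cst.
  by apply: moll1_r_measurable.
- move=> x; apply: measurable_funM; first exact: measurable_cst.
  by apply: moll2_r_measurable.
Qed.

Lemma Rintegral_mollM c x : Om x -> c = \int[mu]_(y in Om) (c * K x y).
Proof. by move=> Ox; rewrite (RintegralZl _ mOm (moll_intg x)) Rintegral_moll // mulr1. Qed.

Lemma Rintegral_moll_l_le y : \int[mu]_(x in Om) K x y <= lam ^- 2.
Proof.
have iK : intg (fun x => K x y).
  apply: (le_intg mOm (g := fun=> dl ^- 2)); [by apply: moll_l_measurable| |exact: intg_cst].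
  by move=> x _; rewrite !ger0_norm ?moll_ge0 ?moll_le // invr_ge0 exprn_ge0 // ltW.
rewrite -lee_fin -(EFin_Rintegral mOm iK) -(integral_moll_l x0 lam0 dl0 y).
apply: ge0_subset_integral; [exact: mOm|exact: measurableT| | |exact: subsetT].
  by apply/measurable_EFinP; apply: moll_l_measurable.
by move=> x _; rewrite lee_fin moll_ge0.
Qed.

Lemma c11_moll_Rintegral Z : intg Z -> c11 (fun y => \int[mu]_(x in Om) (Z x * K x y))
  (fun y => \int[mu]_(x in Om) (Z x * - moll1 x0 lam dl x y))
  (fun y => \int[mu]_(x in Om) (Z x * - moll2 x0 lam dl x y))
  (moll_C lam dl * \int[mu]_(x in Om) `|Z x|).
Proof.
move=> iZ; refine (@c11_Rintegral _ _ _ mu Om mOm Z (fun x => K x) (fun x y => - moll1 x0 lam dl x y)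
  (fun x y => - moll2 x0 lam dl x y) (moll_C lam dl) iZ (fun x _ => c11_moll_r x0 lam0 dl0 x) _ _ _) => y.
- by apply: moll_l_measurable.
- by apply: measurable_funN; apply: moll1_l_measurable.
- by apply: measurable_funN; apply: moll2_l_measurable.
Qed.

Lemma mollify_intg u : intg u -> intg (mollify u).
Proof. by move=> iu; have [] := c11_intg (c11_mollify iu). Qed.

Lemma moll_norm_le x y : `|K x y| <= dl ^- 2.
Proof. by rewrite ger0_norm ?moll_ge0 // moll_le. Qed.

(** Fubini moves the kernel onto the constant 1, and its mass in the first variable is at most
    [lam ^- 2 <= 4]. *)
Lemma mollify_L1 u : intg u ->
  \int[mu]_(x in Om) `|mollify u x| <= 4 * \int[mu]_(x in Om) `|u x|.
Proof.
move=> iu; have im := intg_norm (mollify_intg iu); have iv := intg_norm iu.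
have dl2 : 0 <= dl ^- 2 by rewrite invr_ge0 sqr_ge0.
have i1 : intg (fun=> 1) := intg_cst mOm Omfin 1.
have mKl y : msble (K^~ y) by apply: moll_l_measurable.
have mKr x : msble (K x) by apply: moll_r_measurable.
have := @fubini_kernel R Om mOm (fun y => `|u y|) (fun=> 1) K (dl ^- 2) dl2 iv i1
  (moll_measurable x0 lam dl) mKr mKl moll_norm_le.
have -> : \int[mu]_(x in Om) (1 * \int[mu]_(y in Om) (`|u y| * K x y)) = \int[mu]_(x in Om) mollify (fun y => `|u y|) x.
  by apply: eq_Rintegral => x _; rewrite mul1r.
move=> E; apply: (@le_trans _ _ (\int[mu]_(x in Om) mollify (fun y => `|u y|) x)).
  apply: le_Rintegral; [exact: mOm|exact: im|exact: mollify_intg|move=> x _].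
  apply: norm_Rintegral_le; [exact: mOm|exact: mulK_intg|exact: mulK_intg|].
  by move=> y _; rewrite normrM (ger0_norm (moll_ge0 _ _ dl0 _ _)).
rewrite -E -(RintegralZl _ mOm iv).
have c1 := c11_moll_Rintegral i1; have [_ _ b1] := c1.
apply: le_Rintegral; [exact: mOm| |exact: (intgZ mOm)|].
  by apply: (intgM_bounded mOm iv (continuous_plane (c11_continuous c1))) => y _; have [+ _ _] := b1 y; exact.
move=> y _; rewrite mulrC ler_wpM2r //; under eq_Rintegral do rewrite mul1r.
apply: le_trans (Rintegral_moll_l_le y) _.
by apply: inv_sqr_le4; case/andP: sg01.
Qed.

(** [K x] is a probability density on [Om]: expand the integral of [(u - a)^2 K x], where [a] is the
    mean of [u]. *)
Lemma mollify_sqr_le u x : intg u -> intg (fun y => u y ^+ 2) -> Om x ->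
  mollify u x ^+ 2 <= mollify (fun y => u y ^+ 2) x.
Proof.
move=> iu iu2 Ox; pose a := mollify u x.
have iK := mulK_intg x iu; have iK2 := mulK_intg x iu2; have iK0 := moll_intg x.
have : 0 <= \int[mu]_(y in Om) (u y ^+ 2 * K x y - (2 * a * (u y * K x y) - a ^+ 2 * K x y)).
  apply: Rintegral_ge0 => y _.
  rewrite (_ : _ - _ = (u y - a) ^+ 2 * K x y); last by ring.
  by rewrite mulr_ge0 ?sqr_ge0 // moll_ge0.
have iZ1 := intgZ mOm (2 * a) iK; have iZ2 := intgZ mOm (a ^+ 2) iK0.
have iB := intgB mOm iZ1 iZ2.
rewrite (RintegralB mOm iK2 iB) (RintegralB mOm iZ1 iZ2) (RintegralZl _ mOm iK) (RintegralZl _ mOm iK0).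
rewrite Rintegral_moll // -/(mollify u x) -/(mollify _ x) -/a mulr1 -mulrA -expr2 (_ : 2 * a ^+ 2 - a ^+ 2 = a ^+ 2) ?subr_ge0 //; ring.
Qed.

Lemma mollify_lip (h : R * R -> R) C B x : 0 <= C ->
  (forall p q : R * R, `|h (p + q) - h p| <= C * `|q|) -> (forall p, `|h p| <= B) ->
  Om x -> `|mollify h x - h x| <= C * (sg * (r + M)).
Proof.
move=> C0 hC hB Ox; have iK0 := moll_intg x.
have mh : msble h by apply: continuous_plane; exact: lipschitz_continuous hC.
have ih : intg h.
  apply: (le_intg mOm mh (g := fun=> B)); last exact: intg_cst.
  by move=> y _; rewrite (le_trans (hB y)) // ler_norm.
have ihK := mulK_intg x ih; have ixK := intgZ mOm (h x) iK0.
rewrite [X in _ - X](Rintegral_mollM _ Ox) -(RintegralB mOm ihK ixK).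
rewrite [leRHS](Rintegral_mollM _ Ox).
apply: norm_Rintegral_le; [exact: mOm|exact: (intgB mOm ihK ixK)|exact: (intgZ mOm _ iK0)|].
move=> y Oy; rewrite -mulrBl normrM (ger0_norm (moll_ge0 _ _ dl0 _ _)).
have [yx|yx] := leP `|y - x| (sg * (r + M)); last first.
  by have [-> _ _] := moll_dist Ox yx; rewrite !mulr0.
rewrite ler_wpM2r ?moll_ge0 //.
have := hC x (y - x); rewrite [x + _]addrC subrK => /le_trans; apply.
by rewrite ler_wpM2l.
Qed.

Lemma mollify_bounded (u : R * R -> R) N x : intg u -> (forall y, `|u y| <= N) ->
  Om x -> `|mollify u x| <= N.
Proof.
move=> iu uN Ox; have iK0 := moll_intg x.
rewrite [leRHS](Rintegral_mollM _ Ox).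
apply: norm_Rintegral_le; [exact: mOm|exact: mulK_intg|exact: (intgZ mOm)|].
by move=> y _; rewrite normrM (ger0_norm (moll_ge0 _ _ dl0 _ _)) ler_wpM2r // moll_ge0.
Qed.

(** One closed set contains the supports of all kernels [K x], hence of any superposition of them.
    Taking the closure does not leave [Om], because the box around [T x] known to lie in [Om] has
    radius [2 dl], twice that of the kernel. *)
Definition moll_supp : set (R * R) :=
  closure [set y | exists2 x, Om x & `|T x - y| < sg * r].

Lemma moll_supp_sub : moll_supp `<=` Om.
Proof.
move=> y /(_ (ball y (sg * r)) (nbhsx_ballx y _ dl0))[z [[x Ox Tx] yz]].
rewrite -(subrK (T x) y) addrC; apply: shrink_in => //.
rewrite -ball_normE /= in yz.
rewrite (_ : y - T x = (y - z) - (T x - z)); last by rewrite opprB addrA subrK.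
by apply: le_trans (ler_normB _ _) _; rewrite mulrDl mul1r lerD // ltW.
Qed.

Lemma moll_supp_le y : moll_supp y -> `|y| <= M + `|x0|.
Proof.
move=> /moll_supp_sub Oy; rewrite -[y](subrK x0).
by apply: le_trans (ler_normD _ _) _; rewrite lerD2r; exact: (geo_M geo).
Qed.

Lemma moll_supp_closed : closed moll_supp.
Proof. exact: closed_closure. Qed.

Lemma moll_suppP x y : Om x -> K x y != 0 -> moll_supp y.
Proof.
move=> Ox Kxy; apply: subset_closure; exists x => //.
rewrite ltNge; apply/negP => /(moll_out dl0)[h _ _]; first by rewrite h eqxx in Kxy.
Qed.

Lemma C1_0_moll x : Om x -> C1_0 Om (K x).
Proof.
move=> Ox; have kc := c11_moll_r x0 lam0 dl0 x.
apply: (C1_0_closed_supp _ _ moll_supp_closed moll_supp_le moll_supp_sub) => [y|v|y].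
- exact: c11_differentiable kc.
- exact: c11_continuous_derive kc.
- exact: moll_suppP.
Qed.

(** The adjoint of [mollify]: integration runs over the first variable of the kernel, and the
    supports in the second one all lie in [moll_supp], so the field is an admissible test field. *)
Definition moll_field (Z1 Z2 : R * R -> R) (y : R * R) : R * R :=
  (\int[mu]_(x in Om) (Z1 x * K x y), \int[mu]_(x in Om) (Z2 x * K x y)).

Lemma C1_0_moll_field Z1 Z2 : intg Z1 -> intg Z2 ->
  C1_0 Om (moll_field Z1 Z2) /\
  div (moll_field Z1 Z2) = (fun y =>
    \int[mu]_(x in Om) (Z1 x * - moll1 x0 lam dl x y) +
    \int[mu]_(x in Om) (Z2 x * - moll2 x0 lam dl x y)).
Proof.
move=> i1 i2; have c1 := c11_moll_Rintegral i1; have c2 := c11_moll_Rintegral i2.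
apply: (C1_0_pair c1 c2 moll_supp_closed moll_supp_le moll_supp_sub) => y W0.
apply: contrapT => nS; case/negP: W0; apply/eqP.
have z (Z : R * R -> R) : \int[mu]_(x in Om) (Z x * K x y) = 0.
  transitivity (\int[mu]_(x in Om) (0 : R)); last by rewrite (Rintegral_cst mu mOm) mul0r.
  apply: eq_Rintegral => x /set_mem Ox.
  have [->|/(moll_suppP Ox)//] := eqVneq (K x y) 0; exact: mulr0.
by rewrite !z.
Qed.

End fixed_sigma.

(** Approximate [g] by a bounded Lipschitz [h]. Mollification moves [h] by at most [C sg (r + M)],
    while [g - h] enters once mollified, with the factor 4, and once as it stands; hence the sixths
    of [e]. *)
Lemma mollify_cvg_L1 (g : R * R -> R) : intg g -> forall e : R, 0 < e ->
  exists2 s : R, 0 < s & forall sg, 0 < sg <= 2^-1 -> sg < s ->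
    \int[mu]_(x in Om) `|mollify sg g x - g x| <= e.
Proof.
move=> ig e e0; have e60 : 0 < e / 6 by rewrite divr_gt0.
have [mg ag] := approx_integrable mOm Omfin ig.
have [h lh gh] := ag _ e60; have [[C hC] [B hB]] := lh.
have ih : intg h.
  apply: (le_intg mOm (lipb_measurable lh) (g := fun=> B)); last exact: intg_cst.
  by move=> y _; rewrite (le_trans (hB y)) // ler_norm.
have igh := intgB mOm ig ih; have ngh := intg_norm igh.
rewrite (EFin_Rintegral mOm ngh) lee_fin in gh.
have C0 : 0 <= C by have := le_trans (normr_ge0 _) (hC 0 (1, 0)); rewrite prod_normE /= normr0 normr1 (max_idPl ler01) mulr1.
pose m := fine (mu Om); pose D := C * (r + M) * m + 1.
have m0 : 0 <= m by exact: fine_ge0.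
have D0 : 0 < D by rewrite ltr_wpDl // !mulr_ge0 ?geo_M_ge0 // addr_ge0 ?geo_M_ge0 // ltW.
exists (e / 6 / D); first by rewrite divr_gt0.
move=> sg sg01 sgs; have sg0 : 0 < sg by case/andP: sg01.
have ic := intg_cst mOm Omfin (C * (sg * (r + M))).
have iA := intg_norm (mollify_intg sg01 igh).
apply: (@le_trans _ _ (\int[mu]_(x in Om) (`|mollify sg (fun y => g y - h y) x| + C * (sg * (r + M)) + `|g x - h x|))).
  apply: le_Rintegral; [exact: mOm|exact: (intg_norm (intgB mOm (mollify_intg sg01 ig) ig))
    |exact: (intgD mOm (intgD mOm iA ic) ngh)|move=> x Ox].
  rewrite mollifyB // (_ : mollify sg g x - g x = (mollify sg g x - mollify sg h x) + (mollify sg h x - h x) + (h x - g x)); last by ring.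
  apply: le_trans (ler_normD _ _) _; apply: lerD; last by rewrite distrC.
  apply: le_trans (ler_normD _ _) _; apply: lerD => //.
  exact: (mollify_lip sg01 C0 hC hB Ox).
rewrite (RintegralD mOm (intgD mOm iA ic) ngh) (RintegralD mOm iA ic) (Rintegral_cst mu mOm) -/m.
have : C * (sg * (r + M)) * m <= e / 6.
  rewrite (_ : _ * m = sg * (C * (r + M) * m)); last by ring.
  move: sgs; rewrite ltr_pdivlMr // => /ltW; apply: le_trans.
  by rewrite ler_wpM2l ?(ltW sg0) // /D lerDl.
move=> Ce; exact: (add3_le_sixth (mollify_L1 sg01 igh) Ce gh).
Qed.

Lemma clamp_L2 (u : R * R -> R) : intg u -> intg (fun y => u y ^+ 2) -> forall e : R, 0 < e ->
  exists2 N : R, 0 <= N & \int[mu]_(x in Om) ((u x - clamp N (u x)) ^+ 2) <= e.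
Proof.
move=> iu iu2 e e0; have mu' := intg_measurable iu.
have mcl (n : nat) : msble (fun x => u x - clamp n%:R (u x)).
  apply: measurable_funB; first exact: mu'.
  rewrite /clamp; apply: measurable_maxr; first exact: measurable_cst.
  by apply: measurable_minr; [exact: measurable_cst|exact: mu'].
have mc (n : nat) : measurable_fun (Om : set (plane R)) (fun x => (`|u x - clamp n%:R (u x)| ^+ 2)%:E).
  apply/measurable_EFinP; apply: measurable_funX; apply: measurableT_comp; first exact: normr_measurable.
  exact: mcl.
have i2 (n : nat) : intg (fun x => (u x - clamp n%:R (u x)) ^+ 2).
  apply: (le_intg mOm _ _ iu2) => [|x _]; last by rewrite !normrX lerXn2r ?nnegrE // clamp_dist.
  by apply: measurable_funX; exact: mcl.
have m0 : measurable_fun (Om : set (plane R)) (fun=> 0%E : \bar R) by exact: measurable_cst.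
have cv : {ae mu, forall x, Om x -> (`|u x - clamp n%:R (u x)| ^+ 2)%:E @[n --> \oo] --> 0%E}.
  apply: aeW => x _; apply: cvg_EFin; first exact: nearW.
  apply: (@cvg_eventually_cst _ _ 0 (Num.trunc `|u x|).+1) => n hn.
  rewrite /= clamp_id ?subrr ?normr0 ?expr0n //.
  by apply: le_trans (ltW (truncnS_gt _)) _; rewrite ler_nat.
have dm : {ae mu, forall x n, Om x -> (`|(`|u x - clamp n%:R (u x)| ^+ 2)%:E| <= (u x ^+ 2)%:E)%E}.
  apply: aeW => x n _; rewrite /= lee_fin ger0_norm ?exprn_ge0 // -[leRHS]real_normK ?num_real //.
  by rewrite lerXn2r ?nnegrE // clamp_dist.
have [_ _] := dominated_convergence mOm mc m0 cv iu2 dm.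
rewrite integral0 => /cvge0_near/(_ e e0)[N _ /(_ N (leqnn N))] h.
exists N%:R => //; rewrite -lee_fin -(EFin_Rintegral mOm (i2 N)); apply: le_trans h.
rewrite le_eqVlt; apply/orP; left; apply/eqP; apply: eq_integral => x _.
by rewrite real_normK ?num_real.
Qed.

(** Split [u] into its truncation [v], whose boundedness turns $L^1$ into $L^2$ convergence, and a
    tail [w] with small square integral, controlled by the $L^1$ bound applied to [w^2] through
    [mollify_sqr_le]. The constants add up as [3 * (4/30 + 1/6 + 1/30) = 1]. *)
Lemma mollify_cvg_L2 (u : R * R -> R) : intg u -> intg (fun y => u y ^+ 2) -> forall e : R, 0 < e ->
  exists2 s : R, 0 < s & forall sg, 0 < sg <= 2^-1 -> sg < s ->
    \int[mu]_(x in Om) ((mollify sg u x - u x) ^+ 2) <= e.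
Proof.
move=> iu iu2 e e0; have e30 : 0 < e / 30 by rewrite divr_gt0.
have [N N0 hN] := clamp_L2 iu iu2 e30.
pose v x := clamp N (u x); pose w x := u x - v x.
have mu' := intg_measurable iu.
have mv : msble v.
  rewrite /v /clamp; apply: measurable_maxr; first exact: measurable_cst.
  by apply: measurable_minr; [exact: measurable_cst|exact: mu'].
have iv : intg v.
  apply: (le_intg mOm mv (g := u)); last exact: iu.
  by move=> x _; exact: clamp_norm.
have iw : intg w by exact: intgB.
have iw2 : intg (fun y => w y ^+ 2).
  apply: (le_intg mOm _ (g := fun y => u y ^+ 2)); last exact: iu2.
    by apply: measurable_funX; exact: intg_measurable iw.
  by move=> x _; rewrite !normrX lerXn2r ?nnegrE // clamp_dist.
have N1 : 0 < 12 * (N + 1) by rewrite mulr_gt0 // ltr_wpDl.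
have e12 : 0 < e / (12 * (N + 1)) by rewrite divr_gt0.
have [s s0 hs] := mollify_cvg_L1 iv e12.
exists s => // sg sg01 sgs; have {}hs := hs sg sg01 sgs.
have iA := intg_norm (mollify_intg sg01 iw2).
have iB := intg_norm (intgB mOm (mollify_intg sg01 iv) iv).
have iB' := intgZ mOm (2 * N) iB.
have iR := intgZ mOm 3 (intgD mOm (intgD mOm iA iB') iw2).
have B x : Om x -> (mollify sg u x - u x) ^+ 2 <=
    3 * (`|mollify sg (fun y => w y ^+ 2) x| + 2 * N * `|mollify sg v x - v x| + w x ^+ 2).
  move=> Ox; have Aw : mollify sg w x = mollify sg u x - mollify sg v x by rewrite mollifyB.
  have h1 : mollify sg w x ^+ 2 <= `|mollify sg (fun y => w y ^+ 2) x|.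
    by apply: le_trans (ler_norm _); exact: mollify_sqr_le.
  have h2 : (mollify sg v x - v x) ^+ 2 <= 2 * N * `|mollify sg v x - v x|.
    rewrite -real_normK ?num_real // expr2 ler_wpM2r //; apply: le_trans (ler_normB _ _) _.
    rewrite mulrDl mul1r; apply: lerD; last exact: clamp_le.
    exact: (mollify_bounded sg01 iv (fun y => clamp_le (u y) N0) Ox).
  have -> : mollify sg u x - u x = mollify sg w x + (mollify sg v x - v x) - w x.
    by rewrite Aw /w; ring.
  apply: le_trans (sqr_add3_le _ _ _) _; apply: ler_wpM2l => //.
  by rewrite lerD2r; apply: lerD.
apply: (@le_trans _ _ (\int[mu]_(x in Om) (3 * (`|mollify sg (fun y => w y ^+ 2) x| + 2 * N * `|mollify sg v x - v x| + w x ^+ 2)))).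
  apply: le_Rintegral; [exact: mOm| |exact: iR|exact: B].
  apply: (le_intg mOm _ _ iR).
    by apply: measurable_funX; exact: intg_measurable (intgB mOm (mollify_intg sg01 iu) iu).
  by move=> x Ox; rewrite ger0_norm ?sqr_ge0 // (le_trans (B x Ox)) // ler_norm.
rewrite (RintegralZl _ mOm (intgD mOm (intgD mOm iA iB') iw2)) (RintegralD mOm (intgD mOm iA iB') iw2).
rewrite (RintegralD mOm iA iB') (RintegralZl _ mOm iB).
have I1 := mollify_L1 sg01 iw2.
have E : \int[mu]_(x in Om) `|w x ^+ 2| = \int[mu]_(x in Om) (w x ^+ 2).
  by apply: eq_Rintegral => x _; rewrite ger0_norm ?sqr_ge0.
have I2 : 2 * N * \int[mu]_(x in Om) `|mollify sg v x - v x| <= e / 6.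
  apply: (@le_trans _ _ (2 * N * (e / (12 * (N + 1))))); first by rewrite ler_wpM2l ?mulr_ge0.
  rewrite mulrA ler_pdivrMr // (_ : e / 6 * _ = 2 * N * e + 2 * e); last by field.
  by rewrite lerDl mulr_ge0 // ltW.
rewrite E in I1; exact: (add3_le_tenth I1 I2 hN).
Qed.

Lemma L1_intg g : L1 Om g -> intg g.
Proof. by move=> [mg fg]; apply/integrableP; split; first exact/measurable_EFinP. Qed.

Lemma intg_L1 g : intg g -> L1 Om g.
Proof. by move=> ig; split; [exact: intg_measurable ig|case/integrableP: ig]. Qed.

Lemma C1_0_mul_intg g h : intg g -> C1_0 Om h -> intg (fun x => g x * h x).
Proof.
move=> ig hC; have [B hB] := C1_0_bounded hC.
apply: (intgM_bounded mOm ig (continuous_plane (C1_0_continuous hC)) (M := B)) => x _; exact: hB.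
Qed.

Lemma C1_0_mul_D_intg g h v : intg g -> C1_0 Om h -> intg (fun x => g x * 'D_v h x).
Proof.
move=> ig hC; have [B hB] := C1_0_D_bounded hC v; have [_ cD _ _] := hC.
by apply: (intgM_bounded mOm ig (continuous_plane (cD v)) (M := B)) => x _; exact: hB.
Qed.

Lemma weak_gradient_c11 k k1 k2 C : c11 k k1 k2 C ->
  is_weak_gradient Om k (fun x => (k1 x, k2 x)).
Proof.
move=> kc; have [ik ik1 ik2] := c11_intg kc.
split; [exact: intg_L1|exact: intg_L1|] => h hC.
have dk x : differentiable k x by exact: c11_differentiable kc.
have cDk d : continuous (fun x => 'D_d k x) by exact: c11_continuous_derive kc.
have D1 x : 'D_(e1 R) k x = k1 x by rewrite (c11_derive _ _ kc) /linear2 /= mulr1 mulr0 addr0.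
have D2 x : 'D_(e2 R) k x = k2 x by rewrite (c11_derive _ _ kc) /linear2 /= mulr1 mulr0 add0r.
have i1 : intg (fun x => 'D_(e1 R) k x * h x).
  rewrite (_ : (fun x => _) = fun x => k1 x * h x); last by apply/funext => x; rewrite D1.
  exact: C1_0_mul_intg.
have i2 : intg (fun x => 'D_(e2 R) k x * h x).
  rewrite (_ : (fun x => _) = fun x => k2 x * h x); last by apply/funext => x; rewrite D2.
  exact: C1_0_mul_intg.
have GC := C1_0_mul dk cDk hC.
split.
- rewrite (integral_ibp oOm dk hC (integral_D1_eq0 GC) (C1_0_mul_D_intg _ ik hC) i1).
  by under eq_integral do rewrite D1.
- rewrite (integral_ibp oOm dk hC (integral_D2_eq0 GC) (C1_0_mul_D_intg _ ik hC) i2).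
  by under eq_integral do rewrite D2.
Qed.

(** Each kernel [K x] is an admissible test function, so every mollification of [g] vanishes on
    [Om], while these tend to [g] in $L^1$. *)
Lemma intg_eq0_ae (g : R * R -> R) : intg g ->
  (forall h, C1_0 Om h -> (\int[mu]_(x in Om) (g x * h x)%:E = 0)%E) ->
  {ae mu, forall x, Om x -> g x = 0}.
Proof.
move=> ig g0; have z sg x : 0 < sg <= 2^-1 -> Om x -> mollify sg g x = 0.
  by move=> sg01 Ox; rewrite /mollify /Rintegral (g0 _ (C1_0_moll sg01 Ox)) fine0.
have : (\int[mu]_(x in Om) `|(g x)%:E| = 0)%E.
  rewrite (EFin_Rintegral mOm (intg_norm ig)); congr EFin; apply/eqP.
  rewrite eq_le Rintegral_ge0 // andbT; apply/ler_addgt0Pr => e e0; rewrite add0r.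
  have [s s0 hs] := mollify_cvg_L1 ig e0.
  pose sg := Num.min 2^-1 (s / 2).
  have sg01 : 0 < sg <= 2^-1 by rewrite /sg lt_min ge_min lexx divr_gt0 // invr_gt0 ltr0n.
  have sgs : sg < s by rewrite /sg gt_min; apply/orP; right; lra.
  apply: le_trans (hs _ sg01 sgs); rewrite le_eqVlt; apply/orP; left; apply/eqP.
  by apply: eq_Rintegral => x /set_mem Ox; rewrite (z _ _ sg01 Ox) sub0r normrN.
have mg : measurable_fun (Om : set (plane R)) (fun x => (g x)%:E) := measurable_int _ ig.
move=> /(ae_eq_integral_abs _ mOm mg).
by apply: filterS => x h Ox; have [] := h Ox.
Qed.

(** [grad] is an arbitrary choice among weak gradients; uniqueness identifies it almost everywhere
    with the classical gradient of a smooth function. *)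
Lemma weak_gradient_unique u G G' : is_weak_gradient Om u G -> is_weak_gradient Om u G' ->
  {ae mu, forall x, Om x -> G x = G' x}.
Proof.
move=> [/L1_intg i1 /L1_intg i2 wG] [/L1_intg i1' /L1_intg i2' wG'].
have sub0 g g' h (e : \bar R) : intg g -> intg g' -> C1_0 Om h ->
    (e = - \int[mu]_(x in Om) (g x * h x)%:E)%E -> (e = - \int[mu]_(x in Om) (g' x * h x)%:E)%E ->
    (\int[mu]_(x in Om) ((g x - g' x) * h x)%:E = 0)%E.
  move=> ig ig' hC -> /eqP; rewrite eqe_opp => /eqP E.
  have j := C1_0_mul_intg ig hC; have j' := C1_0_mul_intg ig' hC.
  under eq_integral do rewrite mulrBl EFinB.
  rewrite (integralB_EFin mOm j j') E subee //; exact: integrable_fin_num j'.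
have E1 : {ae mu, forall x, Om x -> (G x).1 - (G' x).1 = 0}.
  apply: intg_eq0_ae; first exact: intgB.
  by move=> h hC; apply: (sub0 _ _ _ _ i1 i1' hC); [exact: (wG h hC).1|exact: (wG' h hC).1].
have E2 : {ae mu, forall x, Om x -> (G x).2 - (G' x).2 = 0}.
  apply: intg_eq0_ae; first exact: intgB.
  by move=> h hC; apply: (sub0 _ _ _ _ i2 i2' hC); [exact: (wG h hC).2|exact: (wG' h hC).2].
have F : Filter (almost_everywhere mu) by exact: ae_filter_ringOfSetsType.
apply: (@filterS2 _ _ F _ _ _ _ E1 E2) => x h1 h2 Ox; apply: pair_ext; apply/eqP; rewrite -subr_eq0; apply/eqP; [exact: h1|exact: h2].
Qed.

End mollify.

(** * The integrand and its conjugate *)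

Record phi_growth (R : realType) (Om : set (R * R)) (phi : R * R -> R -> \bar R) (b L : R) : Prop := {
  pg_c : Phi_c Om phi ;
  pg_b : 0 < b <= 1 ;
  pg_A0 : forall x, Om x -> (phi x b <= 1)%E /\ (1 <= phi x b^-1%R)%E ;
  pg_L : 1 <= L ;
  pg_aDec : forall (x : R * R) (s t : R), Om x -> 0 < s -> s <= t ->
      (phi x t / (t ^+ 2)%:E <= L%:E * (phi x s / (s ^+ 2)%:E))%E }.

Section phi_function.
Variables (R : realType) (Om : set (R * R)) (phi : R * R -> R -> \bar R) (b L : R).
Hypothesis pg : phi_growth Om phi b L.
Let phi_c := pg_c pg.
Let b01 := pg_b pg.
Let A0b := pg_A0 pg.
Let L1 := pg_L pg.
Let aDecL := pg_aDec pg.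

Let b0 : 0 < b. Proof. by case/andP: b01. Qed.
Let L0' : 0 < L. Proof. exact: lt_le_trans L1. Qed.
Let phi_w := Phi_c_w phi_c.

Definition rphi x t : R := fine (phi x t).

(** (A0) makes [phi x b] finite and (aDec)_2 compares larger arguments with [b], which excludes
    infinite values there. From here on the real-valued [rphi] replaces [phi]. *)
Lemma phi_fin x t : Om x -> 0 <= t -> phi x t = (rphi x t)%:E.
Proof.
move=> Ox t0; rewrite /rphi fineK // ge0_fin_numE; last exact: Phi_w_ge0 phi_w _ _ Ox t0.
have [tb|bt] := leP t b.
  apply: le_lt_trans (ltry 1); apply: le_trans (A0b Ox).1.
  exact: Phi_w_incr phi_w _ _ _ Ox t0 tb.
have tt0 : 0 < t by exact: lt_trans bt.
have := aDecL Ox b0 (ltW bt).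
have fb : phi x b \is a fin_num.
  rewrite ge0_fin_numE; last by apply: Phi_w_ge0 phi_w _ _ Ox _; exact: ltW.
  by apply: le_lt_trans (ltry 1); exact: (A0b Ox).1.
case: (phi x t) (Phi_w_ge0 phi_w Ox t0) => [q _ _|_|//]; first exact: ltry.
rewrite -(fineK fb) !inver !gt_eqF ?exprn_gt0 // mulyr gtr0_sg ?invr_gt0 ?exprn_gt0 // mul1e -!EFinM.
by rewrite leye_eq.
Qed.

Lemma rphi_ge0 x t : Om x -> 0 <= t -> 0 <= rphi x t.
Proof. by move=> Ox t0; rewrite /rphi fine_ge0 // (Phi_w_ge0 phi_w). Qed.

Lemma rphi_incr x s t : Om x -> 0 <= s -> s <= t -> rphi x s <= rphi x t.
Proof.
move=> Ox s0 st; have t0 := le_trans s0 st.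
by have := Phi_w_incr phi_w Ox s0 st; rewrite !phi_fin // lee_fin.
Qed.

Lemma rphi0 x : Om x -> rphi x 0 = 0.
Proof. by move=> Ox; rewrite /rphi (Phi_w_0 phi_w Ox). Qed.

(** The weights are not normalised, so that chord inequalities come out free of quotients and can be
    fed to linear arithmetic. *)
Lemma rphi_convex x s t A B : Om x -> 0 <= s -> 0 <= t -> 0 <= A -> 0 <= B -> 0 < A + B ->
  (A + B) * rphi x ((A * s + B * t) / (A + B)) <= A * rphi x s + B * rphi x t.
Proof.
move=> Ox s0 t0 A0 B0 AB; pose a := A / (A + B).
have ABn0 : A + B != 0 by exact: lt0r_neq0.
have a01 : 0 <= a <= 1 by rewrite /a divr_ge0 ?(ltW AB) //= ler_pdivrMr // mul1r lerDl.
have := Phi_c_convex phi_c Ox s0 t0 a01.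
have c0 : 0 <= a * s + (1 - a) * t.
  by case/andP: a01 => a0 a1; apply: addr_ge0; apply: mulr_ge0 => //; rewrite subr_ge0.
rewrite !phi_fin //.
rewrite -!EFinM -EFinD lee_fin.
rewrite (_ : a * s + (1 - a) * t = (A * s + B * t) / (A + B)); last by rewrite /a; field.
rewrite -(ler_pM2l AB) => /le_trans; apply; rewrite le_eqVlt; apply/orP; left; apply/eqP.
by rewrite /a; field.
Qed.

Lemma rphi_double x t : Om x -> 0 <= t -> rphi x (2 * t) <= 4 * L * rphi x t.
Proof.
move=> Ox; rewrite le_eqVlt => /predU1P[<-|t0].
  by rewrite mulr0 rphi0 // mulr0.
have tt : t <= 2 * t by lra.
have := aDecL Ox t0 tt; rewrite !phi_fin ?mulr_ge0 ?(ltW t0) //.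
rewrite !inver !gt_eqF ?exprn_gt0 ?mulr_gt0 // -!EFinM lee_fin.
rewrite ler_pdivrMr ?exprn_gt0 ?mulr_gt0 // => /le_trans; apply.
rewrite le_eqVlt; apply/orP; left; apply/eqP; field; exact: lt0r_neq0.
Qed.

Lemma rphi_le_quadratic x t : Om x -> 0 <= t -> rphi x t <= L * (t / b) ^+ 2 + 1.
Proof.
move=> Ox t0; have hb : rphi x b <= 1.
  by have := (A0b Ox).1; rewrite phi_fin ?(ltW b0) // lee_fin.
have [tb|bt] := leP t b.
  apply: le_trans (rphi_incr Ox t0 tb) (le_trans hb _).
  by rewrite lerDr mulr_ge0 ?(ltW L0') // sqr_ge0.
have tt0 : 0 < t by exact: lt_trans bt.
have := aDecL Ox b0 (ltW bt); rewrite !phi_fin ?(ltW b0) //.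
rewrite !inver !gt_eqF ?exprn_gt0 // -!EFinM lee_fin ler_pdivrMr ?exprn_gt0 //.
move=> /le_trans; apply; apply: (@le_trans _ _ (L * (t / b) ^+ 2)); last by rewrite lerDl.
rewrite (_ : L * (rphi x b / b ^+ 2) * t ^+ 2 = L * (t / b) ^+ 2 * rphi x b); last by field; exact: lt0r_neq0.
by rewrite ler_piMr // mulr_ge0 ?(ltW L0') // sqr_ge0.
Qed.

Lemma rphi_slope x s t : Om x -> 0 < s -> s <= t -> rphi x s * t <= rphi x t * s.
Proof.
move=> Ox s0 st; have t0 := lt_le_trans s0 st.
have AB : 0 < (t - s) + s by rewrite subrK.
have := rphi_convex Ox (lexx 0) (ltW t0) (_ : 0 <= t - s) (ltW s0) AB.
rewrite subr_ge0 st => /(_ isT); rewrite subrK rphi0 // !mulr0 !add0r.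
by rewrite mulfK ?gt_eqF // mulrC [X in _ <= X]mulrC.
Qed.

(* Difference quotient standing for a subgradient of [rphi x] at [t]; it is 0 at [t = 0]. *)
Definition slope h x t : R := (rphi x ((1 + h) * t) - rphi x t) / (h * t).

Section slope.
Variables (h : R) (x : R * R).
Hypotheses (h01 : 0 < h <= 1) (Ox : Om x).
Let h0 : 0 < h. Proof. by case/andP: h01. Qed.

Lemma slope0 : slope h x 0 = 0.
Proof. by rewrite /slope !mulr0 invr0 mulr0. Qed.

Lemma slope_ge0 t : 0 <= t -> 0 <= slope h x t.
Proof.
move=> t0; rewrite /slope divr_ge0 ?mulr_ge0 ?(ltW h0) // subr_ge0 rphi_incr //.
by rewrite ler_peMl // lerDl ltW.
Qed.

Lemma slopeM t : 0 < t -> slope h x t * (h * t) = rphi x ((1 + h) * t) - rphi x t.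
Proof. by move=> t0; rewrite /slope divfK // mulf_neq0 ?gt_eqF. Qed.

(** Since [(1 + h) t = (1 - h) t + h (2 t)], convexity bounds the difference quotient by
    [(phi(2t) - phi(t)) / t], and doubling costs [4 L]. *)
Lemma slope_le t : 0 <= t -> slope h x t * t <= 4 * L * rphi x t.
Proof.
rewrite le_eqVlt => /predU1P[<-|t0].
  by rewrite mulr0 rphi0 // mulr0.
have h1 : h <= 1 by case/andP: h01.
have AB : 0 < (1 - h) + h by rewrite subrK.
have := rphi_convex Ox (ltW t0) (_ : 0 <= 2 * t) (_ : 0 <= 1 - h) (ltW h0) AB.
rewrite mulr_ge0 ?(ltW t0) // subr_ge0 h1 => /(_ isT isT); rewrite subrK divr1 mul1r.
rewrite (_ : (1 - h) * t + h * (2 * t) = (1 + h) * t); last by ring.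
move=> c; have := slopeM t0; have := rphi_double Ox (ltW t0); have := rphi_ge0 Ox (ltW t0).
rewrite -(ler_pM2l h0) => p0 d e.
rewrite -(ler_pM2l h0) mulrCA e.
have := ler_wpM2l (ltW h0) d; nra.
Qed.

(** For [tau <= t] and for [tau >= (1 + h) t], monotonicity of chord slopes gives the bound without
    the last term. In between only monotonicity of [phi] is used:
    [s tau - phi(tau) <= s (1 + h) t - phi(t)], whence the error [h s t]. *)
Lemma conjugate_slope t : 0 <= t ->
  (conjugate phi x (slope h x t) <= (slope h x t * t - rphi x t + h * (slope h x t * t))%:E)%E.
Proof.
move=> t0; apply: ge_ereal_sup => _ [tau /= tau0 <-].
rewrite phi_fin // -EFinB lee_fin.
have s0 := slope_ge0 t0.
have p0 := rphi_ge0 Ox tau0.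
move: t0; rewrite le_eqVlt => /predU1P[t0|t0].
  by rewrite -t0 slope0 rphi0 // !(mul0r, mulr0); lra.
have sM := slopeM t0; set s := slope h x t in s0 sM *.
have ht : 0 < h * t by rewrite mulr_gt0.
have [tt|tt] := leP tau t.
  have AB : 0 < h * t + (t - tau) by rewrite ltr_pwDl // subr_ge0.
  have q1 : 0 <= (1 + h) * t by rewrite mulr_ge0 ?(ltW t0) // addr_ge0 // ltW.
  have q2 : 0 <= t - tau by rewrite subr_ge0.
  have := rphi_convex Ox tau0 q1 (ltW ht) q2 AB.
  rewrite (_ : (h * t * tau + _) / _ = t); last by field; exact: lt0r_neq0.
  move=> c.
  have : h * t * (rphi x t - rphi x tau) <= h * t * (s * (t - tau)).
    rewrite (_ : h * t * (s * (t - tau)) = (t - tau) * (s * (h * t))); last by ring.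
    by rewrite sM; lra.
  rewrite ler_pM2l // => k.
  have : 0 <= h * (s * t) by apply: mulr_ge0; [exact: ltW|apply: mulr_ge0 => //; exact: ltW].
  lra.
have [t1|t1] := leP ((1 + h) * t) tau.
  have AB : 0 < (tau - (1 + h) * t) + h * t by rewrite ltr_wpDl // subr_ge0.
  have := rphi_convex Ox (ltW t0) tau0 (_ : 0 <= tau - (1 + h) * t) (ltW ht) AB.
  rewrite subr_ge0 t1 => /(_ isT).
  rewrite (_ : ((tau - (1 + h) * t) * t + _) / _ = (1 + h) * t); last by field; exact: lt0r_neq0.
  move=> c.
  have : h * t * (s * (tau - (1 + h) * t)) <= h * t * (rphi x tau - rphi x ((1 + h) * t)).
    rewrite (_ : h * t * (s * _) = (tau - (1 + h) * t) * (s * (h * t))); last by ring.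
    by rewrite sM; lra.
  rewrite ler_pM2l // => k.
  have : 0 <= h * (s * t) by apply: mulr_ge0; [exact: ltW|apply: mulr_ge0 => //; exact: ltW].
  lra.
have : s * tau <= s * ((1 + h) * t) by rewrite ler_wpM2l // ltW.
have : rphi x t <= rphi x tau by apply: rphi_incr => //; exact: ltW.
lra.
Qed.

End slope.

Lemma conjugate_ge x s tau : Om x -> 0 <= tau -> ((s * tau - rphi x tau)%:E <= conjugate phi x s)%E.
Proof.
by move=> Ox tau0; rewrite mulrC EFinB -phi_fin //; apply: ereal_sup_ubound; exists tau.
Qed.

Lemma conjugate_ge0 x s : Om x -> (0 <= conjugate phi x s)%E.
Proof. by move=> Ox; have := conjugate_ge s Ox (lexx 0); rewrite mulr0 rphi0 // subr0. Qed.

Lemma conjugate_le x s (e : \bar R) : Om x ->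
  (forall tau, 0 <= tau -> ((s * tau - rphi x tau)%:E <= e)%E) -> (conjugate phi x s <= e)%E.
Proof.
move=> Ox H; apply: ge_ereal_sup => _ [tau /= tau0 <-].
by rewrite phi_fin // -EFinB mulrC; exact: H.
Qed.

Lemma conjugate_incr x s t : Om x -> s <= t -> (conjugate phi x s <= conjugate phi x t)%E.
Proof.
move=> Ox st; apply: conjugate_le => // tau tau0; apply: le_trans (conjugate_ge t Ox tau0).
by rewrite lee_fin lerB // ler_wpM2r.
Qed.

Lemma conjugate0 x : Om x -> conjugate phi x 0 = 0%E.
Proof.
move=> Ox; apply/eqP; rewrite eq_le conjugate_ge0 // andbT; apply: conjugate_le => // tau tau0.
by rewrite mul0r sub0r lee_fin oppr_le0 rphi_ge0.
Qed.

Lemma rphi_measurable (g : R * R -> R) : L0 Om g ->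
  measurable_fun (Om : set (plane R)) (fun x : plane R => rphi x `|g x|).
Proof. by move=> mg; apply: measurableT_comp (Phi_w_meas phi_w mg); exact: fine_measurable. Qed.

(** The supremum reduces to rational arguments: replacing [tau] by a slightly smaller rational
    lowers [|g| tau] by less than the available margin [d] and can only decrease [phi]. *)
Lemma conjugate_measurable (g : R * R -> R) : measurable (Om : set (plane R)) -> L0 Om g ->
  measurable_fun (Om : set (plane R)) (fun x : plane R => conjugate phi x `|g x|).
Proof.
move=> mOm mg; apply: (measurability _ (ErealGenOInfty.measurableE R)).
move=> _ [_ [a ->] <-].
rewrite (_ : _ `&` _ = \bigcup_(q in [set: rat])
  (Om `&` [set x : plane R | a < `|g x| * `|ratr q| - rphi x `|ratr q|])); last first.
  apply/seteqP; split => x.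
    move=> [Ox /=]; rewrite in_itv/= andbT => /ereal_sup_gt[_ [tau /= tau0 <-]].
    rewrite phi_fin // -EFinB lte_fin mulrC => h.
    (* [tau = 0] leaves no room below it, but is itself rational. *)
    have [t0|t0] := eqVneq tau 0.
      exists 0 => //; split => //=; rewrite raddf0 normr0.
      by move: h; rewrite t0.
    have {}tau0 : 0 < tau by rewrite lt0r t0.
    pose d := `|g x| * tau - rphi x tau - a.
    have d0 : 0 < d by rewrite /d; lra.
    pose m := Num.max 0 (tau - d / (`|g x| + 1)).
    have g1 : 0 < `|g x| + 1 by rewrite ltr_wpDl.
    have /rat_in_itvoo[q] : m < tau by rewrite /m gt_max tau0 ltrBlDr ltrDl divr_gt0.
    rewrite in_itv /= => /andP[mq qt]; exists q => //; split => //=.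
    move: mq; rewrite /m gt_max => /andP[q0 mq].
    rewrite (gtr0_norm q0).
    have rq : rphi x (ratr q) <= rphi x tau by apply: rphi_incr => //; exact: ltW.
    have : `|g x| * (tau - ratr q) < d.
      have : (tau - ratr q) * (`|g x| + 1) < d by rewrite -ltr_pdivlMr //; lra.
      apply: le_lt_trans; rewrite mulrC ler_wpM2l ?lerDl //; lra.
    rewrite /d mulrBr; lra.
  move=> [q _ [Ox /= h]]; split=> //=; rewrite in_itv /= andbT.
  by apply: lt_le_trans (conjugate_ge _ Ox (normr_ge0 (ratr q))); rewrite lte_fin.
apply: bigcupT_measurable_rat => q.
have mf : measurable_fun (Om : set (plane R)) (fun x : plane R => `|g x| * `|ratr q| - rphi x `|ratr q|).
  apply: measurable_funB.
    apply: measurable_funM; last exact: measurable_cst.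
    by apply: measurableT_comp mg; exact: normr_measurable.
  have := @rphi_measurable (fun=> ratr q); apply; exact: measurable_cst.
have := mf mOm `]a, +oo[%classic (measurable_itv _).
by rewrite (_ : _ @^-1` _ = [set x : plane R | a < `|g x| * `|ratr q| - rphi x `|ratr q|]) //;
  apply/seteqP; split => x /=; rewrite in_itv/= andbT.
Qed.

End phi_function.

(** * Auxiliary facts: Euclidean norm, components of fields, powers, limits *)

Section enorm.
Variable R : realType.
Implicit Types v w : R * R.

Lemma enorm_ge0 v : 0 <= enorm v. Proof. exact: sqrtr_ge0. Qed.

Lemma enorm_sqr v : enorm v ^+ 2 = v.1 ^+ 2 + v.2 ^+ 2.
Proof. by rewrite /enorm sqr_sqrtr // addr_ge0 // sqr_ge0. Qed.

Lemma enorm_mul v : enorm v * enorm v = v.1 * v.1 + v.2 * v.2.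
Proof. by rewrite -!expr2 enorm_sqr. Qed.

Lemma enorm_pair_continuous (v1 v2 : R * R -> R) : continuous v1 -> continuous v2 ->
  continuous (fun x => enorm (v1 x, v2 x)).
Proof.
move=> c1 c2 x; apply: (@continuous_comp _ _ _ (fun x => v1 x ^+ 2 + v2 x ^+ 2) (@Num.sqrt R)); last exact: sqrt_continuous.
by apply: cvgD; apply: (@continuous_comp _ _ _ _ (fun t : R => t ^+ 2)); try exact: exprn_continuous; [exact: c1|exact: c2].
Qed.

Lemma enorm_comp_continuous (w : R * R -> R * R) : continuous w -> continuous (fun x => enorm (w x)).
Proof.
move=> cw; apply: (@enorm_pair_continuous (fun x => (w x).1) (fun x => (w x).2)) => x.
  by apply: (@continuous_comp _ _ _ w fst); [exact: cw|exact: cvg_fst].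
by apply: (@continuous_comp _ _ _ w snd); [exact: cw|exact: cvg_snd].
Qed.

Lemma enorm_le v : enorm v <= 2 * `|v|.
Proof.
have v0 : 0 <= 2 * `|v| by rewrite mulr_ge0.
rewrite -(ger0_norm v0) -sqrtr_sqr ler_wsqrtr //.
have [] := norm_prod_ge v; move: `|v| {v0} => n h1 h2.
have a1 : v.1 ^+ 2 <= n ^+ 2 by rewrite -real_normK ?num_real // lerXn2r ?nnegrE // (le_trans _ h1).
have a2 : v.2 ^+ 2 <= n ^+ 2 by rewrite -real_normK ?num_real // lerXn2r ?nnegrE // (le_trans _ h2).
by rewrite exprMn; have := sqr_ge0 n; lra.
Qed.

Lemma enorm_le_sum v : enorm v <= `|v.1| + `|v.2|.
Proof.
have h0 : 0 <= `|v.1| + `|v.2| by rewrite addr_ge0.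
rewrite -(ger0_norm h0) -sqrtr_sqr ler_wsqrtr // sqrrD !real_normK ?num_real //.
by rewrite lerD2r lerDl mulrn_wge0 // mulr_ge0.
Qed.

Lemma enorm_dot v w : v.1 * w.1 + v.2 * w.2 <= enorm v * enorm w.
Proof.
have h : (v.1 * w.1 + v.2 * w.2) ^+ 2 <= (enorm v * enorm w) ^+ 2.
  rewrite exprMn !enorm_sqr; have := sqr_ge0 (v.1 * w.2 - v.2 * w.1).
  rewrite !expr2; lra.
apply: le_trans (ler_norm _) _; rewrite -[leRHS]ger0_norm ?mulr_ge0 ?enorm_ge0 //.
by rewrite -!sqrtr_sqr ler_wsqrtr.
Qed.

Lemma enorm_dot_mul v w a : 0 <= a ->
  v.1 * (w.1 * a) + v.2 * (w.2 * a) <= enorm v * (enorm w * a).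
Proof. by move=> a0; rewrite !mulrA -mulrDl ler_wpM2r // enorm_dot. Qed.

Lemma enormZ a v : enorm (a * v.1, a * v.2) = `|a| * enorm v.
Proof. by rewrite /enorm /= !exprMn -mulrDr sqrtrM ?sqr_ge0 // sqrtr_sqr. Qed.

End enorm.

Lemma C1_0_zero (R : realType) (Om : set (R * R)) : C1_0 Om (fun=> 0 : R * R).
Proof.
have E : [set x : R * R | (0 : R * R) != 0] = set0 by apply/seteqP; split => x //=; rewrite eqxx.
split; rewrite ?E ?closure0 //; last exact: compact0.
by move=> v x; rewrite (_ : (fun x => _) = fun=> 0);
  [exact: cvg_cst|apply/funext => y; exact: derive_cst].
Qed.

Lemma modulus_small (R : realType) (w : R -> \bar R) (d : R) : modulus w -> 0 < d ->
  exists2 s : R, 0 < s & forall t : R, 0 <= t -> t <= s -> (w t <= d%:E)%E.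
Proof.
move=> [w0 wi _ wc] d0.
have : \forall t \near 0^'+, (w t < d%:E)%E.
  have N : nbhs (0%E : \bar R) [set y | (y < d%:E)%E].
    apply: open_nbhs_nbhs; split; first exact: open_ereal_lt_ereal.
    by rewrite /= lte_fin.
  exact: (wc _ N).
rewrite near_withinE => /nbhs_ballP[e /= e0 H].
exists (e / 2) => [|t t0 te]; first by rewrite divr_gt0.
apply: le_trans (wi _ _ t0 te) _; apply: ltW; apply: H; last by rewrite /= divr_gt0.
by rewrite /ball /= sub0r normrN gtr0_norm ?divr_gt0 //; lra.
Qed.

Section components.
Variables (R : realType) (Om : set (R * R)) (w : R * R -> R * R).
Hypothesis wC : C1_0 Om w.
Let dw : forall x, differentiable w x. Proof. by have [] := wC. Qed.

Lemma differentiable_fst x : differentiable (fun y => (w y).1) x.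
Proof.
apply: (@differentiable_comp _ _ _ _ w fst) => //; apply: linear_differentiable.
by move=> p; exact: cvg_fst.
Qed.

Lemma differentiable_snd x : differentiable (fun y => (w y).2) x.
Proof.
apply: (@differentiable_comp _ _ _ _ w snd) => //; apply: linear_differentiable.
by move=> p; exact: cvg_snd.
Qed.

Lemma derive_components v x :
  'D_v w x = ('D_v (fun y => (w y).1) x, 'D_v (fun y => (w y).2) x).
Proof.
rewrite -(derive_pair v (differentiable_fst x) (differentiable_snd x)); congr ('D_v _ x).
by apply/funext => y; case: (w y).
Qed.

Lemma C1_0_components : C1_0 Om (fun y => (w y).1) /\ C1_0 Om (fun y => (w y).2).
Proof.
have [_ cD _ KO] := wC; have [M hM] := C1_0_supp_bounded wC.
have sub (c : R * R -> R) : c 0 = 0 -> forall x, c (w x) != 0 -> closure [set x | w x != 0] x.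
  by move=> c0 x cx; apply: subset_closure => /=; apply: contra_neq cx => ->.
split.
- apply: (@C1_0_closed_supp _ _ _ (closure [set x | w x != 0]) _ M) => //.
  + exact: differentiable_fst.
  + move=> v x; rewrite (_ : (fun x => _) = fun x => ('D_v w x).1); last by apply/funext => y; rewrite derive_components.
    by apply: (@continuous_comp _ _ _ ('D_v w) fst); [exact: cD|exact: cvg_fst].
  + exact: closed_closure.
  + exact: (sub fst).
- apply: (@C1_0_closed_supp _ _ _ (closure [set x | w x != 0]) _ M) => //.
  + exact: differentiable_snd.
  + move=> v x; rewrite (_ : (fun x => _) = fun x => ('D_v w x).2); last by apply/funext => y; rewrite derive_components.
    by apply: (@continuous_comp _ _ _ ('D_v w) snd); [exact: cD|exact: cvg_snd].
  + exact: closed_closure.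
  + exact: (sub snd).
Qed.

Lemma div_components x : div w x = 'D_(e1 R) (fun y => (w y).1) x + 'D_(e2 R) (fun y => (w y).2) x.
Proof. by rewrite /div !derive_components. Qed.

End components.

(** Young's inequality for [a * 1] with exponents [p] and [p / (p - 1)]; the coefficients [1/p] and
    [(p - 1)/p] are then enlarged to [1] and [p - 1]. *)
Lemma powR_ge_affine (R : realType) (a p : R) : 0 <= a -> 1 < p -> a <= powR a p + (p - 1).
Proof.
move=> a0 p1; have p0 : 0 < p by lra.
have q0 : 0 < p / (p - 1) by rewrite divr_gt0 // subr_gt0.
have pn : p - 1 != 0 by rewrite subr_eq0 gt_eqF.
have := @conjugate_powR R a 1 p (p / (p - 1)) a0 ler01 p0 q0.
rewrite mulr1 powR1 => h; apply: le_trans (h _) _.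
  by field; rewrite pn gt_eqF.
have ip : p^-1 <= 1 by rewrite invf_le1 // ltW.
apply: lerD; first by rewrite ler_piMr // powR_ge0.
by rewrite mul1r invf_div ler_piMr // subr_ge0 ltW.
Qed.

(** Young's inequality for [a^q * 1] with exponents [1/q] and [1/(1 - q)]. *)
Lemma powR_le_affine (R : realType) (a q : R) : 0 <= a -> 0 < q < 1 -> powR a q <= 1 + q * a.
Proof.
move=> a0 /andP[q0 q1].
have p0 : 0 < q^-1 by rewrite invr_gt0.
have q'0 : 0 < (1 - q)^-1 by rewrite invr_gt0 subr_gt0.
have := @conjugate_powR R (powR a q) 1 q^-1 (1 - q)^-1 (powR_ge0 _ _) ler01 p0 q'0.
rewrite mulr1 powR1 !invrK => h; apply: le_trans (h _) _; first by ring.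
rewrite -powRrM mulfV ?gt_eqF // powRr1 //; lra.
Qed.

Lemma limn_einf_ge (R : realType) (a : nat -> \bar R) (x : R) :
  (forall e : R, 0 < e -> exists N, forall k, (N <= k)%N -> ((x - e)%:E <= a k)%E) ->
  (x%:E <= limn_einf a)%E.
Proof.
move=> H; rewrite limn_einf_lim (cvg_lim _ (@cvg_einfs_sup _ a)) //.
apply/lee_subgt0Pr => e e0; have [N HN] := H e e0.
apply: (@le_trans _ _ (einfs a N)); last by apply: ereal_sup_ubound; exists N.
by apply: le_ereal_inf_tmp => _ [k /= Nk <-]; rewrite -EFinB; exact: HN.
Qed.

Lemma limn_esup_le (R : realType) (a : nat -> \bar R) (x : R) :
  (forall e : R, 0 < e -> exists N, forall k, (N <= k)%N -> (a k <= (x + e)%:E)%E) ->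
  (limn_esup a <= x%:E)%E.
Proof.
move=> H; rewrite limn_esup_lim (cvg_lim _ (@cvg_esups_inf _ a)) //.
apply/lee_addgt0Pr => e e0; have [N HN] := H e e0.
apply: (@le_trans _ _ (esups a N)); first by apply: ereal_inf_lbound; exists N.
by apply: ge_ereal_sup => _ [k /= Nk <-]; rewrite -EFinD; exact: HN.
Qed.

Lemma cvg_near1 (R : realType) (p : nat -> R) (d : R) : p k @[k --> \oo] --> (1 : R) -> 0 < d ->
  exists N, forall k, (N <= k)%N -> p k - 1 <= d.
Proof.
move=> /cvgrPdist_lt h d0; have [N _ hN] := h d d0; exists N => k Nk.
by have := hN k Nk; rewrite distrC => /ltW; apply: le_trans; exact: ler_norm.
Qed.

Lemma cvg_L2_small (R : realType) (Om : set (R * R)) (u_ : nat -> R * R -> R) (u : R * R -> R) (d : R) :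
  cvg_L2 Om u_ u -> 0 < d ->
  exists N, forall k, (N <= k)%N -> (\int[leb2 R]_(x in Om) (`|u_ k x - u x| ^+ 2)%:E <= d%:E)%E.
Proof.
move=> cu d0; have [N _ hN] := cvge0_near cu d0; exists N => k Nk; exact: hN.
Qed.

(** [j k] is the largest [i <= k] with [N i <= k]. Once [k] is at least [J] and [N J], the index [J]
    competes: the maximum is then at least [J] and is attained, which gives both conclusions. *)
Lemma diagonal_index (N : nat -> nat) : exists j : nat -> nat,
  forall J, exists K, forall k, (K <= k)%N -> (J <= j k)%N /\ (N (j k) <= k)%N.
Proof.
exists (fun k => \max_(i in [pred i : 'I_k.+1 | (N i <= k)%N]) i)%N => J.
exists (maxn J (N J)) => k; rewrite geq_max => /andP[Jk NJk].
pose i : 'I_k.+1 := Ordinal (Jk : (J < k.+1)%N).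
have iA : i \in [pred i : 'I_k.+1 | (N i <= k)%N] by [].
split; first exact: (@leq_bigmax_cond _ (mem [pred i : 'I_k.+1 | (N i <= k)%N]) (fun i => nat_of_ord i) i iA).
have cA : (0 < #|[pred i : 'I_k.+1 | (N i <= k)%N]|)%N by apply/card_gt0P; exists i.
by have [i0 i0A ->] := eq_bigmax_cond (fun i : 'I_k.+1 => nat_of_ord i) cA.
Qed.

Lemma inv_succ_small (R : realType) (e : R) : 0 < e -> exists J, forall j, (J <= j)%N -> j.+1%:R^-1 <= e.
Proof.
move=> e0; have ie0 : 0 <= e^-1 by rewrite invr_ge0 ltW.
exists (Num.bound e^-1) => j Jj; rewrite -[e]invrK lef_pV2 ?posrE ?invr_gt0 //.
by apply: le_trans (ltW (archi_boundP ie0)) _; rewrite ler_nat ltnW.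
Qed.

(** * The dual modular *)

Section gamma_limit.
Variables (R : realType) (Om : set (R * R)) (x0 : R * R) (r M : R).
Hypothesis geo : geometry Om x0 r M.
Variables (phi : R * R -> R -> \bar R) (b L : R).
Hypothesis pg : phi_growth Om phi b L.
Local Notation mu := (leb2 R).
Local Notation intg f := (mu.-integrable Om (EFin \o f)).
Local Notation msble f := (measurable_fun (Om : set (plane R)) (f : plane R -> R)).
Local Notation P := (rphi phi).
Local Notation conj := (conjugate phi).
Let mOm := geo_measurable geo.
Let Omfin := geo_fin geo.
Let r0 := geo_r geo.
Let M0 := geo_M_ge0 geo.
Let Lge1 := pg_L pg.
Let Lpos : 0 < L. Proof. exact: lt_le_trans Lge1. Qed.
Let b0 : 0 < b. Proof. by have /andP[] := pg_b pg. Qed.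

Lemma conj_enorm_measurable (w : R * R -> R * R) : continuous w ->
  measurable_fun (Om : set (plane R)) (fun x : plane R => conj x (enorm (w x))).
Proof.
move=> cw; rewrite (_ : (fun x => _) = fun x : plane R => conj x `|enorm (w x)|); last first.
  by apply/funext => x; rewrite ger0_norm ?enorm_ge0.
apply: (conjugate_measurable pg) => //.
exact: continuous_plane (enorm_comp_continuous cw).
Qed.

Lemma conj_enorm_integrable (w : R * R -> R * R) : C1_0 Om w ->
  (\int[mu]_(x in Om) conj x (enorm (w x)) < +oo)%E ->
  mu.-integrable Om (fun x => conj x (enorm (w x))).
Proof.
move=> wC fin; apply/integrableP; split.
  exact: conj_enorm_measurable (C1_0_continuous wC).
rewrite (eq_integral (fun x : plane R => conj x (enorm (w x)))) // => x /set_mem Ox.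
by rewrite gee0_abs // (conjugate_ge0 pg).
Qed.

Lemma div_bounded (w : R * R -> R * R) : C1_0 Om w -> exists2 B, 0 <= B & forall x, `|div w x| <= B.
Proof.
move=> wC; have [B1 h1] := C1_0_D_bounded wC (e1 R); have [B2 h2] := C1_0_D_bounded wC (e2 R).
have H x : `|div w x| <= B1 + B2.
  apply: le_trans (ler_normD _ _) _; apply: lerD.
    by apply: le_trans (h1 x); have [] := norm_prod_ge ('D_(e1 R) w x).
  by apply: le_trans (h2 x); have [] := norm_prod_ge ('D_(e2 R) w x).
by exists (B1 + B2) => //; exact: le_trans (H 0).
Qed.

Definition sqdist (u v : R * R -> R) : R := \int[mu]_(x in Om) (`|u x - v x| ^+ 2).

Section dual.
Variable u : R * R -> R.
Hypothesis iu : intg u.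

Lemma div_intg (w : R * R -> R * R) : C1_0 Om w -> intg (fun x => u x * div w x).
Proof.
move=> wC; have [_ cD _ _] := wC; have [B _ dB] := div_bounded wC.
apply: (intgM_bounded mOm iu (M := B)) => [|x _]; last exact: dB.
apply: continuous_plane => x; apply: cvgD.
  by apply: (@continuous_comp _ _ _ ('D_(e1 R) w) fst); [exact: cD|exact: cvg_fst].
by apply: (@continuous_comp _ _ _ ('D_(e2 R) w) snd); [exact: cD|exact: cvg_snd].
Qed.

(** The form in which test fields are used: a real bound [c] on the conjugate term suffices, and it
    also excludes the value [-oo] of the pairing. *)
Lemma dual_ge (w : R * R -> R * R) (c : R) : C1_0 Om w ->
  (\int[mu]_(x in Om) conj x (enorm (w x)) <= c%:E)%E ->
  ((\int[mu]_(x in Om) (u x * div w x) - c)%:E <= dual_modular Om phi u)%E.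
Proof.
move=> wC hc; apply: (@le_trans _ _ (dual_pairing Om phi u w)); last first.
  by apply: ereal_sup_ubound; exists w.
have ic := conj_enorm_integrable wC (le_lt_trans hc (ltry c)).
have iD := div_intg wC.
rewrite /dual_pairing; case: ifPn => [/eqP E|_].
  by rewrite E leNgt ltry in hc.
rewrite (integralB mOm iD ic) EFinB; apply: leeB; last exact: hc.
rewrite /Rintegral fineK //; exact: integrable_fin_num iD.
Qed.

Lemma dual_ge0 : (0 <= dual_modular Om phi u)%E.
Proof.
have := @dual_ge _ 0 (C1_0_zero Om); rewrite integral0_eq; last first.
  by move=> x Ox; rewrite (_ : enorm _ = 0) ?(conjugate0 pg) // /enorm /= expr0n addr0 sqrtr0.
move=> /(_ (lexx _)); rewrite (_ : Rintegral _ _ _ = 0) ?subr0 //.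
transitivity (\int[mu]_(x in Om) (0 : R)); last by rewrite (Rintegral_cst mu mOm) mul0r.
by apply: eq_Rintegral => x _; rewrite /div !derive_cst /= addr0 mulr0.
Qed.

Variable rho : R.
Hypothesis rhoE : dual_modular Om phi u = rho%:E.
Let rho0 : 0 <= rho. Proof. by have := dual_ge0; rewrite rhoE lee_fin. Qed.

Section scale.
Variable sg : R.
Hypothesis sg01 : 0 < sg <= 2^-1.
Local Notation lam := (1 - sg).
Local Notation dl := (sg * r).
Let dl0 : 0 < dl. Proof. by rewrite mulr_gt0 ?(geo_r geo) //; case/andP: sg01. Qed.
Let lam0 : 0 < lam. Proof. by case/andP: sg01; lra. Qed.
Local Notation K := (moll x0 (1 - sg) (sg * r)).
Local Notation K1 := (moll1 x0 (1 - sg) (sg * r)).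
Local Notation K2 := (moll2 x0 (1 - sg) (sg * r)).

Definition dv1 x := \int[mu]_(y in Om) (u y * (lam * K1 x y)).
Definition dv2 x := \int[mu]_(y in Om) (u y * (lam * K2 x y)).
Definition ndv x := enorm (dv1 x, dv2 x).

(** Every affine function in the supremum satisfies it, because [t * phi(y, tau) <= phi(y, tau)]. *)
Lemma conj_scale y s t : Om y -> 0 <= t <= 1 -> (conj y (t * s) <= t%:E * conj y s)%E.
Proof.
move=> Oy /andP[t0 t1]; apply: (conjugate_le pg) => // tau tau0.
apply: (@le_trans _ _ (t%:E * (s * tau - P y tau)%:E)%E).
  rewrite -EFinM lee_fin mulrBr mulrA lerB // ler_piMl //.
  exact: (rphi_ge0 pg).
apply: lee_wpmul2l; first by rewrite lee_fin.
exact: (conjugate_ge pg).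
Qed.

(* The test field is [y |-> dl^2 s K x y e], [e] opposite to the gradient at [x]; [dl^2 K <= 1]. *)
Lemma crude_dual x s kap : Om x -> 0 <= s -> 0 <= kap ->
  (forall y, Om y -> `|y - x| <= sg * (r + M) -> (conj y s <= kap%:E)%E) ->
  s * ndv x <= rho / dl ^+ 2 + kap.
Proof.
move=> Ox s0 kap0 hk; have d20 : 0 < dl ^+ 2 by rewrite exprn_gt0.
have [n0|n0] := eqVneq (ndv x) 0.
  by rewrite n0 mulr0 addr_ge0 // divr_ge0 // ltW.
have np : 0 < ndv x by rewrite lt0r n0 enorm_ge0.
pose a1 := - (dl ^+ 2 * s / ndv x) * dv1 x; pose a2 := - (dl ^+ 2 * s / ndv x) * dv2 x.
have c1 := c11_scale a1 (c11_moll_r x0 lam0 dl0 x); have c2 := c11_scale a2 (c11_moll_r x0 lam0 dl0 x).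
have [] := C1_0_pair c1 c2 (@moll_supp_closed _ Om x0 r sg) (moll_supp_le geo sg01) (moll_supp_sub geo sg01).
  move=> y Wn; apply: (moll_suppP geo sg01 Ox); apply: contra_neq Wn => ->.
  by rewrite !mulr0.
set W := (fun y => (a1 * K x y, _)) => WC divW.
have K0 y : 0 <= K x y by apply: moll_ge0.
have q0 : 0 <= dl ^+ 2 * s / ndv x by apply: divr_ge0; [apply: mulr_ge0 => //; exact: ltW|exact: ltW].
have nW y : enorm (W y) = (dl ^+ 2 * K x y) * s.
  rewrite (_ : W y = (K x y * (a1, a2).1, K x y * (a1, a2).2)); last by rewrite /W /= ![K x y * _]mulrC.
  rewrite enormZ ger0_norm //.
  rewrite (_ : (a1, a2) = (- (dl ^+ 2 * s / ndv x) * (dv1 x, dv2 x).1, - (dl ^+ 2 * s / ndv x) * (dv1 x, dv2 x).2)) //.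
  by rewrite enormZ normrN ger0_norm // -/(ndv x); field.
have ic : (\int[mu]_(y in Om) conj y (enorm (W y)) <= (dl ^+ 2 * kap)%:E)%E.
  apply: (@le_trans _ _ (\int[mu]_(y in Om) ((dl ^+ 2 * kap)%:E * (K x y)%:E))%E).
    apply: ge0_le_integral.
    - exact: mOm.
    - by move=> y Oy; exact: (conjugate_ge0 pg).
    - apply: conj_enorm_measurable; exact: C1_0_continuous WC.
    - apply: measurable_funeM; apply/measurable_EFinP; apply: moll_r_measurable => //.
    - move=> y Oy; rewrite nW -EFinM; have [yx|yx] := leP `|y - x| (sg * (r + M)); last first.
        have [-> _ _] := moll_dist geo sg01 Ox yx.
        by rewrite mulr0 mul0r (conjugate0 pg Oy) mulr0.
      apply: le_trans (conj_scale _ Oy _) _.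
        rewrite mulr_ge0 ?(ltW d20) //= -ler_pdivlMl // mulr1; apply: moll_le => //.
      apply: (@le_trans _ _ ((dl ^+ 2 * K x y)%:E * kap%:E)%E).
        by apply: lee_wpmul2l; [rewrite lee_fin mulr_ge0 // ltW|exact: hk].
      by rewrite -EFinM lee_fin mulrAC.
  rewrite ge0_integralZl; first last.
  - by rewrite lee_fin mulr_ge0 // ltW.
  - by move=> y _; rewrite lee_fin.
  - by apply/measurable_EFinP; apply: moll_r_measurable.
  - exact: mOm.
  by rewrite (integral_moll_Om geo sg01 Ox) mule1.
have iK (k : R * R -> R) : (forall y, `|- k y| <= moll_C lam dl) -> msble k -> intg (fun y => u y * (lam * k y)).
  move=> kC mk; apply: (intgM_bounded mOm iu (M := lam * moll_C lam dl)) => [|y _].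
    by apply: measurable_funM; [exact: measurable_cst|exact: mk].
  by rewrite normrM gtr0_norm // ler_wpM2l ?(ltW lam0) // -normrN.
have [_ _ bK] := c11_moll_r x0 lam0 dl0 x.
have i1 : intg (fun y => u y * (lam * K1 x y)).
  by apply: iK => [y|]; [have [] := bK y|apply: moll1_r_measurable].
have i2 : intg (fun y => u y * (lam * K2 x y)).
  by apply: iK => [y|]; [have [] := bK y|apply: moll2_r_measurable].
have := dual_ge WC ic; rewrite rhoE lee_fin.
(* The divergence of [W] is [- (a1 K1 + a2 K2)], whereas the gradient at [x] is built from [lam K1]
   and [lam K2]. Hence the factor [1 / lam], which is at least 1 and is dropped at the end. *)
have -> : \int[mu]_(y in Om) (u y * div W y) = dl ^+ 2 * s * ndv x / lam.
  have lamn0 : lam != 0 by exact: lt0r_neq0.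
  transitivity (\int[mu]_(y in Om) (- a1 / lam * (u y * (lam * K1 x y)) + - a2 / lam * (u y * (lam * K2 x y)))).
    by apply: eq_Rintegral => y _; rewrite divW; field.
  rewrite (RintegralD mOm (intgZ mOm _ i1) (intgZ mOm _ i2)) (RintegralZl _ mOm i1) (RintegralZl _ mOm i2).
  rewrite -/(dv1 x) -/(dv2 x) /a1 /a2.
  transitivity (dl ^+ 2 * s / ndv x / lam * (ndv x ^+ 2)); last by field; rewrite lamn0 n0.
  have -> : ndv x ^+ 2 = dv1 x ^+ 2 + dv2 x ^+ 2 by rewrite enorm_sqr.
  by field; rewrite lamn0 n0.
move=> h.
have l1 : lam <= 1 by rewrite gerBl ltW //; case/andP: sg01.
rewrite -(ler_pM2l d20) mulrDr [_ * (rho / _)]mulrC divfK ?gt_eqF // -lerBlDr.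
apply: le_trans h; rewrite lerD2r mulrA.
by apply: ler_peMr; [apply: mulr_ge0; [apply: mulr_ge0 => //; exact: ltW|exact: enorm_ge0]|rewrite invf_ge1].
Qed.

Variables (om K1 : R).
Hypothesis om01 : 0 <= om <= 1.
Hypothesis VAs : forall x y t, Om x -> Om y -> 0 <= t -> `|y - x| <= sg * (r + M) ->
  (conj x t <= K1%:E -> conj y (t / (1 + om)) <= conj x t + om%:E)%E.
Local Notation B1 := (rho / dl ^+ 2 + 1).
Hypothesis K1E : 128 * L ^+ 3 * B1 <= K1.
Local Notation N := ndv.

Let B11 : 1 <= B1. Proof. by rewrite lerDr divr_ge0 // sqr_ge0. Qed.
Let om0 : 0 <= om. Proof. by case/andP: om01. Qed.
Let om1 : 0 < 1 + om. Proof. exact: ltr_wpDr. Qed.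

(** [phi^*(x, s) <= (1 + h) s t <= 8 L phi(x, t)], so the hypothesis on [P x t] keeps [phi^*(x, s)]
    under the threshold [K1] and (VA1) transports the bound to [y]. *)
Lemma conj_slope_bound h x t y : 0 < h <= 1 -> Om x -> Om y -> 0 <= t -> 8 * L * P x t <= K1 ->
  `|y - x| <= sg * (r + M) ->
  (conj y (slope phi h x t / (1 + om)) <= (slope phi h x t * t - P x t + h * (slope phi h x t * t) + om)%:E)%E.
Proof.
move=> h01 Ox Oy t0 hK yx; have s0 := slope_ge0 pg h01 Ox t0.
have c := conjugate_slope pg h01 Ox t0.
apply: le_trans (VAs Ox Oy s0 yx _) _; last by rewrite [leRHS]EFinD; exact: leeD.
apply: le_trans c _; rewrite lee_fin; apply: le_trans hK.
have p0 := rphi_ge0 pg Ox t0; have := slope_le pg h01 Ox t0.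
have st0 : 0 <= slope phi h x t * t by exact: mulr_ge0.
case/andP: h01 => _ h1; have := ler_wpM2r st0 h1; lra.
Qed.

(** With [h = 1] the bound on [phi^*] fed to [crude_dual] is [2 s t - phi(x, t) + om], while
    [4 t <= N x] and [1 + om <= 2] make the left side there at least [2 s t]. The terms [2 s t]
    cancel and leave [phi(x, t)]. *)
Lemma crude_step x t : Om x -> 0 <= t -> 4 * t <= N x -> 8 * L * P x t <= K1 -> P x t <= B1.
Proof.
move=> Ox t0 tN hK; have h01 : 0 < (1 : R) <= 1 by rewrite ltr01 lexx.
have s0 := slope_ge0 pg h01 Ox t0; set s := slope phi 1 x t in s0.
have p0 := rphi_ge0 pg Ox t0.
have [kap0|kap0] := leP 0 (s * t - P x t + 1 * (s * t) + om); last first.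
  have st0 : 0 <= s * t by exact: mulr_ge0.
  have c := conjugate_slope pg h01 Ox t0; have := le_trans (conjugate_ge0 pg _ Ox) c.
  by rewrite lee_fin -/s; move: om0; lra.
have S0 : 0 <= s / (1 + om) by rewrite divr_ge0 // ltW.
have := crude_dual Ox S0 kap0 (fun y Oy yx => conj_slope_bound h01 Ox Oy t0 hK yx).
have : 2 * (s * t) <= s / (1 + om) * N x.
  apply: (@le_trans _ _ (s / (1 + om) * (4 * t))); last exact: ler_wpM2l.
  rewrite (_ : s / (1 + om) * (4 * t) = 4 * (s * t) / (1 + om)); last by field; exact: lt0r_neq0.
  rewrite ler_pdivlMr //; have st0 : 0 <= s * t by exact: mulr_ge0.
  case/andP: om01 => _ o1; have := ler_wpM2l st0 o1; lra.
case/andP: om01; lra.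
Qed.

(* (VA1) may be used only below the threshold [K1]: start from a small multiple of the gradient and
   double the argument, [crude_step] restoring the bound [B1] each time. *)
Lemma crude_bound x : Om x -> P x (N x) <= 16 * L ^+ 2 * B1.
Proof.
move=> Ox; have N0 : 0 <= N x by exact: enorm_ge0.
have B10 : 0 < B1 by exact: lt_le_trans B11.
(* A value at most [B1] becomes at most [4 L B1] after one doubling, and [crude_step] asks for [8 L]
   times the value to be below [K1]. *)
have L32 : 8 * L * (4 * L * B1) <= K1.
  apply: le_trans K1E; rewrite (_ : 8 * L * (4 * L * B1) = (32 * L ^+ 2 * B1) * 1); last by ring.
  rewrite (_ : 128 * L ^+ 3 * B1 = (32 * L ^+ 2 * B1) * (4 * L)); last by ring.
  apply: ler_wpM2l; first by rewrite mulr_ge0 ?(ltW B10) // mulr_ge0 // sqr_ge0.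
  by move: Lge1; lra.
pose a j := N x / 4 * 2^-1 ^+ j.
have a0 j : 0 <= a j by rewrite mulr_ge0 ?divr_ge0 // exprn_ge0.
have aN j : 4 * a j <= N x.
  rewrite (_ : 4 * a j = N x * 2^-1 ^+ j); last by rewrite /a; field.
  by rewrite ler_piMr // exprn_ile1 // invf_le1 // ler1n.
have aS j : a j = 2 * a j.+1 by rewrite /a exprS; field.
have half j : P x (a j.+1) <= P x (a j) / 2.
  have := a0 j.+1; rewrite le_eqVlt => /predU1P[z|ap].
    by rewrite -z (rphi0 pg Ox) divr_ge0 // (rphi_ge0 pg).
  have le1 : a j.+1 <= a j by rewrite (aS j) ler_peMl ?ler1n ?(ltW ap).
  rewrite ler_pdivlMr // -(ler_pM2r ap); apply: le_trans (rphi_slope pg Ox ap le1).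
  by rewrite (aS j) mulrA.
have step j : P x (a j.+1) <= B1 -> P x (a j) <= B1.
  move=> h; apply: crude_step => //; apply: le_trans L32; apply: ler_wpM2l; first by rewrite mulr_ge0 // ltW.
  rewrite (aS j); apply: le_trans (rphi_double pg Ox (a0 _)) _.
  by apply: ler_wpM2l => //; rewrite mulr_ge0 // ltW.
have small j : P x (a j) <= P x (a 0) / 2 ^+ j.
  elim: j => [|j IH]; first by rewrite expr0 divr1.
  apply: le_trans (half j) _; rewrite exprS invfM [leRHS]mulrCA mulrC ler_wpM2l ?invr_ge0 //.
(* Halving the argument at least halves the value, by convexity, so the bound holds after finitely
   many halvings. *)
have [j hj] : exists j, P x (a j) <= B1.
  exists (Num.bound (P x (a 0))); apply: le_trans (small _) _.
  apply: le_trans B11; rewrite ler_pdivrMr ?exprn_gt0 // mul1r.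
  apply: le_trans (ltW (archi_boundP (rphi_ge0 pg Ox (a0 _)))) _.
  by rewrite -natrX ler_nat ltnW // ltn_expl.
have h0 : P x (a 0) <= B1 by elim: j hj => // j IH /step.
(* [crude_step] stops at a quarter of the gradient. Two more doublings cost [(4 L)^2 = 16 L^2], and
   [128 L^3 = 8 L * 16 L^2] is the origin of the threshold. *)
have E : N x = 2 * (2 * a 0) by rewrite /a expr0; field.
rewrite E; apply: le_trans (rphi_double pg Ox (mulr_ge0 _ (a0 _))) _ => //.
rewrite (_ : 16 * L ^+ 2 * B1 = 4 * L * (4 * L * B1)); last by ring.
apply: ler_wpM2l; first by rewrite mulr_ge0 // ltW.
apply: le_trans (rphi_double pg Ox (a0 _)) _.
by apply: ler_wpM2l => //; rewrite mulr_ge0 // ltW.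
Qed.

Variable h : R.
Hypothesis h01 : 0 < h <= 1.
Local Notation s x := (slope phi h x (N x)).
Local Notation S x := (slope phi h x (N x) / (1 + om)).
Local Notation G x := (s x * N x - P x (N x) + h * (s x * N x) + om).

Let N0 x : 0 <= N x. Proof. exact: enorm_ge0. Qed.

Let PK x : Om x -> 8 * L * P x (N x) <= K1.
Proof.
move=> Ox; apply: le_trans K1E; rewrite (_ : 128 * L ^+ 3 * B1 = 8 * L * (16 * L ^+ 2 * B1)); last by ring.
apply: ler_wpM2l; first by rewrite mulr_ge0 // ltW.
exact: crude_bound.
Qed.

Let s0 x : Om x -> 0 <= s x. Proof. by move=> Ox; exact: (slope_ge0 pg h01 Ox). Qed.
Let S0 x : Om x -> 0 <= S x. Proof. by move=> Ox; rewrite divr_ge0 ?s0 // ltW. Qed.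

(** The bound [G x] is the same for all [y] reached by the kernel at [x]: this is what lets Jensen's
    inequality exchange [phi^*] at [y] for a quantity at [x]. *)
Let GS x y : Om x -> Om y -> `|y - x| <= sg * (r + M) -> (conj y (S x) <= (G x)%:E)%E.
Proof. by move=> Ox Oy yx; apply: (conj_slope_bound h01 Ox Oy (N0 x) (PK Ox) yx). Qed.

Let GSx x : Om x -> (conj x (S x) <= (G x)%:E)%E.
Proof.
move=> Ox; apply: GS => //; rewrite subrr normr0 mulr_ge0 ?addr_ge0 ?(geo_M_ge0 geo) // ltW ?(geo_r geo) //.
by case/andP: sg01.
Qed.

Let G0 x : Om x -> 0 <= G x.
Proof. by move=> Ox; have := le_trans (conjugate_ge0 pg _ Ox) (GSx Ox); rewrite lee_fin. Qed.

Let sN x : Om x -> s x * N x <= 4 * L * P x (N x).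
Proof. by move=> Ox; exact: (slope_le pg h01 Ox). Qed.

Let Gle x : Om x -> G x <= K1 + 1.
Proof.
move=> Ox; have := sN Ox; have := PK Ox; have := rphi_ge0 pg Ox (N0 x).
have st0 : 0 <= s x * N x by apply: mulr_ge0; [exact: s0|exact: N0].
case/andP: h01 => _ h1; have := ler_wpM2r st0 h1; case/andP: om01 => _.
set a := s x * N x; set c := P x (N x); set d := h * a; set g := L * c; rewrite -!mulrA -/g; lra.
Qed.

(** Young's inequality at the argument [b], where [phi] is at most 1:
    [S b - 1 <= phi^*(x, S) <= K1 + 1]. *)
Let Sle x : Om x -> S x <= (K1 + 2) / b.
Proof.
move=> Ox; rewrite ler_pdivlMr //.
have := le_trans (conjugate_ge pg (S x) Ox (ltW b0)) (GSx Ox); rewrite lee_fin.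
have := Gle Ox; have := (pg_A0 pg Ox).1; rewrite (phi_fin pg Ox (ltW b0)) lee_fin.
set g := G x; lra.
Qed.

Let dvc := c11_mollify geo sg01 iu.

Let mN : L0 Om N.
Proof. exact: continuous_plane (enorm_pair_continuous (c11_continuous1 dvc) (c11_continuous2 dvc)). Qed.

Let mP c : 0 <= c -> msble (fun x => P x (c * N x)).
Proof.
move=> c0; rewrite (_ : (fun x => _) = fun x : plane R => P x `|c * N x|); last first.
  by apply/funext => x; rewrite ger0_norm // mulr_ge0.
by apply: (rphi_measurable pg); apply: measurable_funM; [exact: measurable_cst|exact: mN].
Qed.

Let miN : msble (fun x => (N x)^-1).
Proof.
rewrite (_ : (fun x => _) = fun x : plane R => powR (N x) (-1)); last first.
  by apply/funext => x; rewrite powR_inv1.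
exact: (measurableT_comp (measurable_powR (-1)) mN).
Qed.

Let mP1 : msble (fun x => P x (N x)).
Proof. by have := mP ler01; under eq_fun do rewrite mul1r. Qed.

Let ms : msble (fun x => s x).
Proof.
rewrite (_ : (fun x => _) = fun x : plane R => (P x ((1 + h) * N x) - P x (N x)) * (h^-1 * (N x)^-1)); last first.
  by apply/funext => x; rewrite /slope invfM.
apply: measurable_funM; [apply: measurable_funB; [|exact: mP1]|].
  by apply: mP; case/andP: h01; lra.
by apply: measurable_funM; [exact: measurable_cst|exact: miN].
Qed.

Let bounded_intg (f : R * R -> R) C : msble f ->
  (forall x, Om x -> 0 <= f x <= C) -> intg f.
Proof.
move=> mf fC; apply: (le_intg mOm mf (g := fun=> C)); last exact: (intg_cst mOm Omfin).
by move=> x Ox; have /andP[f0 fle] := fC x Ox; rewrite !ger0_norm // (le_trans f0).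
Qed.

Lemma rphi_ndv_intg : intg (fun x => P x (N x)).
Proof.
apply: (bounded_intg (C := K1) mP1) => x Ox; rewrite (rphi_ge0 pg) //=.
apply: le_trans (PK Ox); rewrite ler_peMl ?(rphi_ge0 pg) //; move: Lge1; lra.
Qed.

Let isN : intg (fun x => s x * N x).
Proof.
apply: (bounded_intg (C := K1)); first by apply: measurable_funM; [exact: ms|exact: mN].
move=> x Ox; rewrite mulr_ge0 ?s0 //=; apply: le_trans (sN Ox) _; apply: le_trans (PK Ox).
by apply: ler_wpM2r; [exact: (rphi_ge0 pg)|move: Lge1; lra].
Qed.

Let iG : intg (fun x => G x).
Proof.
apply: (intgD mOm); last exact: (intg_cst mOm Omfin).
by apply: (intgD mOm); [apply: (intgB mOm isN rphi_ndv_intg)|exact: (intgZ mOm)].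
Qed.

Let mS : msble (fun x => S x).
Proof. by apply: measurable_funM; [exact: ms|exact: measurable_cst]. Qed.

Let iS : intg (fun x => S x).
Proof. by apply: (bounded_intg (C := (K1 + 2) / b) mS) => x Ox; rewrite S0 //= Sle. Qed.

(* [lam^2 S e], [e] opposite to the direction of the gradient and 0 where the latter vanishes. *)
Definition dual_field1 x := - (lam ^+ 2 * S x / N x) * dv1 x.
Definition dual_field2 x := - (lam ^+ 2 * S x / N x) * dv2 x.
Local Notation Z1 := dual_field1.
Local Notation Z2 := dual_field2.

Let enormZ12 x : Om x -> enorm (Z1 x, Z2 x) = lam ^+ 2 * S x.
Proof.
move=> Ox; rewrite (_ : (Z1 x, Z2 x) = (- (lam ^+ 2 * S x / N x) * (dv1 x, dv2 x).1, - (lam ^+ 2 * S x / N x) * (dv1 x, dv2 x).2)) //.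
have q0 : 0 <= lam ^+ 2 * S x by rewrite mulr_ge0 ?S0 // sqr_ge0.
rewrite enormZ normrN ger0_norm ?divr_ge0 // -/(N x).
have [n0|n0] := eqVneq (N x) 0; last by rewrite divfK.
by rewrite n0 mulr0 slope0 mul0r mulr0.
Qed.

Let iZ (d : R * R -> R) : msble d ->
  (forall x, `|d x| <= N x) -> intg (fun x => - (lam ^+ 2 * S x / N x) * d x).
Proof.
move=> md dN; apply: (le_intg mOm (g := fun x => lam ^+ 2 * S x)); last exact: (intgZ mOm).
  apply: measurable_funM; last exact: md.
  apply: measurable_funN; apply: measurable_funM; last exact: miN.
  by apply: measurable_funM; [exact: measurable_cst|exact: mS].
move=> x Ox; have q0 : 0 <= lam ^+ 2 * S x by rewrite mulr_ge0 ?S0 // sqr_ge0.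
rewrite normrM normrN (@ger0_norm _ (_ / _)) ?divr_ge0 // [leRHS]ger0_norm // -mulrA.
apply: ler_piMr => //; have [n0|n0] := eqVneq (N x) 0; first by rewrite n0 invr0 mul0r.
by rewrite mulrC ler_pdivrMr ?mul1r // lt0r n0 N0.
Qed.

Let iZ1 : intg Z1.
Proof.
apply: iZ; first exact: continuous_plane (c11_continuous1 dvc).
by move=> x; rewrite -[`|_|]sqrtr_sqr ler_wsqrtr //= lerDl sqr_ge0.
Qed.

Let iZ2 : intg Z2.
Proof.
apply: iZ; first exact: continuous_plane (c11_continuous2 dvc).
by move=> x; rewrite -[`|_|]sqrtr_sqr ler_wsqrtr //= lerDr sqr_ge0.
Qed.

Local Notation W := (moll_field Om x0 r sg Z1 Z2).

Let K0 x y : 0 <= K x y. Proof. exact: moll_ge0. Qed.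
Let mKl y : msble (fun x => K x y).
Proof. exact: moll_l_measurable. Qed.
Let iK (f : R * R -> R) y : intg f -> intg (fun x => f x * K x y).
Proof.
move=> fi; apply: (intgM_bounded mOm fi (mKl y) (M := dl ^- 2)) => x _.
by rewrite ger0_norm // moll_le.
Qed.

(** The weight [lam^2] compensates the mass [lam ^- 2], so averages over [x] are taken against a
    sub-probability. This suffices for Jensen's inequality, as [phi^*] vanishes at 0. *)
Let intK y : \int[mu]_(x in Om) (lam ^+ 2 * K x y) <= 1.
Proof.
have i1 : intg (fun x => 1 * K x y) by apply: (iK y (f := fun=> 1)); exact: (intg_cst mOm Omfin).
have {}i1 : intg (K^~ y) by move: i1; under eq_fun do rewrite mul1r.
rewrite (RintegralZl _ mOm i1) -ler_pdivlMl ?exprn_gt0 // mulr1.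
exact: (Rintegral_moll_l_le geo sg01).
Qed.

(** The length of an integral is at most the integral of the lengths: pair [W y] with itself, use
    Cauchy-Schwarz under the integral and divide by its length. *)
Let enorm_W y : enorm (W y) <= \int[mu]_(x in Om) ((lam ^+ 2 * S x) * K x y).
Proof.
have iSK := iK y (intgZ mOm (lam ^+ 2) iS).
have [n0|n0] := eqVneq (enorm (W y)) 0.
  rewrite n0; apply: Rintegral_ge0 => x Ox; apply: mulr_ge0; last exact: K0.
  by apply: mulr_ge0; [exact: sqr_ge0|exact: S0].
have np : 0 < enorm (W y) by rewrite lt0r n0 enorm_ge0.
have j1 := iK y iZ1; have j2 := iK y iZ2.
have k1 := intgZ mOm (W y).1 j1; have k2 := intgZ mOm (W y).2 j2.
have e : enorm (W y) * enorm (W y) = \int[mu]_(x in Om) ((W y).1 * (Z1 x * K x y) + (W y).2 * (Z2 x * K x y)).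
  rewrite (RintegralD mOm k1 k2) (RintegralZl _ mOm j1) (RintegralZl _ mOm j2).
  exact: enorm_mul.
have e2 : enorm (W y) * \int[mu]_(x in Om) ((lam ^+ 2 * S x) * K x y) =
    \int[mu]_(x in Om) (enorm (W y) * ((lam ^+ 2 * S x) * K x y)) by rewrite (RintegralZl _ mOm iSK).
rewrite -(ler_pM2l np) e e2.
apply: le_Rintegral; [exact: mOm|exact: (intgD mOm k1 k2)|exact: (intgZ mOm _ iSK)|].
move=> x Ox; rewrite -(enormZ12 Ox); exact: (enorm_dot_mul (W y) (Z1 x, Z2 x) (K0 x y)).
Qed.

(** Jensen's inequality, applied by hand to each affine function [s tau - phi(y, tau)] of the
    supremum. As the total mass is at most 1, [phi(y, tau)] may be multiplied by it; where the
    kernel is nonzero, [S x tau - phi(y, tau) <= G x]. *)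
Let conj_W y : Om y -> (conj y (enorm (W y)) <= (\int[mu]_(x in Om) ((lam ^+ 2 * G x) * K x y))%:E)%E.
Proof.
move=> Oy; apply: (conjugate_le pg) => // tau tau0; rewrite lee_fin.
have p0 := rphi_ge0 pg Oy tau0.
have iSK := iK y (intgZ mOm (lam ^+ 2) iS).
have i1 : intg (fun x => lam ^+ 2 * K x y).
  by apply: (iK y (f := fun=> lam ^+ 2)); exact: (intg_cst mOm Omfin).
apply: (@le_trans _ _ (tau * \int[mu]_(x in Om) ((lam ^+ 2 * S x) * K x y) - P y tau * \int[mu]_(x in Om) (lam ^+ 2 * K x y))).
  apply: lerB; first by rewrite mulrC ler_wpM2l // enorm_W.
  by apply: ler_piMr => //; exact: intK.
rewrite -(RintegralZl _ mOm iSK) -(RintegralZl _ mOm i1).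
have k1 := intgZ mOm tau iSK; have k2 := intgZ mOm (P y tau) i1.
rewrite -(RintegralB mOm k1 k2).
apply: le_Rintegral; [exact: mOm|exact: (intgB mOm k1 k2)|exact: (iK y (intgZ mOm _ iG))|].
move=> x Ox; rewrite (_ : _ - _ = lam ^+ 2 * K x y * (S x * tau - P y tau)); last by ring.
rewrite (mulrAC _ (G x)).
have q0 : 0 <= lam ^+ 2 * K x y by rewrite mulr_ge0 // sqr_ge0.
have [yx|yx] := leP `|y - x| (sg * (r + M)).
  apply: ler_wpM2l => //; have := le_trans (conjugate_ge pg (S x) Oy tau0) (GS Ox Oy yx).
  by rewrite lee_fin.
by have [-> _ _] := moll_dist geo sg01 Ox yx; rewrite !mulr0 !mul0r.
Qed.

(** By Fubini: the kernel has mass 1 in [y], and [lam^2 <= 1] is dropped since [G] is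
    nonnegative. *)
Let int_conj_W : (\int[mu]_(y in Om) conj y (enorm (W y)) <= (\int[mu]_(x in Om) G x)%:E)%E.
Proof.
have igG := intgZ mOm (lam ^+ 2) iG.
have [WC _] := C1_0_moll_field geo sg01 iZ1 iZ2.
have [iGK _ _] := c11_intg geo (c11_moll_Rintegral geo sg01 igG).
apply: (@le_trans _ _ (\int[mu]_(y in Om) (\int[mu]_(x in Om) ((lam ^+ 2 * G x) * K x y))%R%:E)%E).
  apply: ge0_le_integral; [exact: mOm| | | |].
  - by move=> y Oy; exact: (conjugate_ge0 pg).
  - by apply: (conj_enorm_measurable); exact: C1_0_continuous WC.
  - exact: measurable_int iGK.
  - exact: conj_W.
rewrite (EFin_Rintegral mOm iGK) lee_fin.
have i1 : intg (fun=> 1) by exact: (intg_cst mOm Omfin).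
have dl2 : 0 <= dl ^- 2 by rewrite invr_ge0 sqr_ge0.
have E1 : \int[mu]_(y in Om) (\int[mu]_(x in Om) ((lam ^+ 2 * G x) * K x y)) =
    \int[mu]_(y in Om) (1 * \int[mu]_(x in Om) ((lam ^+ 2 * G x) * K x y)).
  by apply: eq_Rintegral => y _; rewrite mul1r.
have E2 : \int[mu]_(x in Om) ((lam ^+ 2 * G x) * \int[mu]_(y in Om) (1 * K x y)) = \int[mu]_(x in Om) (lam ^+ 2 * G x).
  apply: eq_Rintegral => x /set_mem Ox.
  have -> : \int[mu]_(y in Om) (1 * K x y) = 1.
    by rewrite -[RHS](Rintegral_moll geo sg01 Ox); apply: eq_Rintegral => y _; rewrite mul1r.
  by rewrite mulr1.
have mKr x : measurable_fun (Om : set (plane R)) (K x : plane R -> R).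
  by apply: moll_r_measurable.
have := @fubini_kernel R Om mOm (fun=> 1) (fun x => lam ^+ 2 * G x) K (dl ^- 2) dl2 i1 igG
  (moll_measurable x0 lam dl) mKr mKl (moll_norm_le geo sg01).
rewrite -E1 E2 => ->; apply: le_Rintegral; [exact: mOm|exact: igG|exact: iG|].
move=> x Ox; apply: ler_piMl; first exact: G0.
by rewrite exprn_ile1 ?(ltW lam0) // gerBl ltW //; case/andP: sg01.
Qed.

Let swap (Z d : R * R -> R) (k : R * R -> R * R -> R) : intg Z ->
  measurable_fun setT (fun z : plane R * plane R => k z.1 z.2) ->
  (forall x, measurable_fun (Om : set (plane R)) (k x : plane R -> R)) ->
  (forall y, measurable_fun (Om : set (plane R)) (k^~ y : plane R -> R)) ->
  (forall x y, `|- k x y| <= moll_C lam dl) ->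
  (forall x, d x = \int[mu]_(y in Om) (u y * (lam * k x y))) ->
  \int[mu]_(y in Om) (u y * \int[mu]_(x in Om) (Z x * - k x y)) = \int[mu]_(x in Om) (- lam^-1 * (Z x * d x)).
Proof.
move=> zi mk mk1 mk2 kC dE.
have C0 : 0 <= moll_C lam dl by exact: c11_ge0 (c11_moll_r x0 lam0 dl0 x0).
have m1 x : msble (fun y => - k x y).
  by apply: measurable_funN; exact: mk1.
have m2 y : msble (fun x => - k x y).
  by apply: measurable_funN; exact: mk2.
rewrite (@fubini_kernel R Om mOm u Z (fun x y => - k x y) (moll_C lam dl) C0 iu zi (measurable_funN mk) m1 m2 kC).
apply: eq_Rintegral => x _; rewrite mulrCA; congr (_ * _); rewrite dE.
have iku : intg (fun y => u y * - k x y) by apply: (intgM_bounded mOm iu (m1 x)) => y _; exact: kC.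
rewrite (_ : \int[mu]_(y in Om) (u y * (lam * k x y)) = - lam * \int[mu]_(y in Om) (u y * - k x y)).
  by rewrite mulrA mulNr mulrN opprK mulVf ?mul1r // lt0r_neq0.
by rewrite -(RintegralZl _ mOm iku); apply: eq_Rintegral => y _; ring.
Qed.

(** Adjointness turns [u] against the divergence of [W] into the field against the gradient of the
    mollification. The field is opposite to that gradient with length [lam^2 S], and trading
    derivatives in [y] for derivatives in [x] divides by [- lam]. *)
Let div_W : \int[mu]_(y in Om) (u y * div W y) = lam * \int[mu]_(x in Om) (S x * N x).
Proof.
have [_ ->] := C1_0_moll_field geo sg01 iZ1 iZ2.
have c1 := c11_moll_Rintegral geo sg01 iZ1; have c2 := c11_moll_Rintegral geo sg01 iZ2.
have j1 : intg (fun y => u y * \int[mu]_(x in Om) (Z1 x * - moll1 x0 lam dl x y)).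
  apply: (intgM_bounded mOm iu); first by exact: continuous_plane (c11_continuous1 c1).
  by move=> y _; have [_ _ /(_ y)[_ + _]] := c1; exact.
have j2 : intg (fun y => u y * \int[mu]_(x in Om) (Z2 x * - moll2 x0 lam dl x y)).
  apply: (intgM_bounded mOm iu); first by exact: continuous_plane (c11_continuous2 c2).
  by move=> y _; have [_ _ /(_ y)[_ _]] := c2; exact.
transitivity (\int[mu]_(y in Om) (u y * \int[mu]_(x in Om) (Z1 x * - moll1 x0 lam dl x y)) +
   \int[mu]_(y in Om) (u y * \int[mu]_(x in Om) (Z2 x * - moll2 x0 lam dl x y))).
  by rewrite -(RintegralD mOm j1 j2); apply: eq_Rintegral => y _; rewrite mulrDr.
have kb x y : `|- moll1 x0 lam dl x y| <= moll_C lam dl /\ `|- moll2 x0 lam dl x y| <= moll_C lam dl.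
  by have [_ _ /(_ y)[]] := c11_moll_r x0 lam0 dl0 x.
have r1 x : measurable_fun (Om : set (plane R)) (moll1 x0 lam dl x : plane R -> R) by apply: moll1_r_measurable.
have l1 y : msble ((moll1 x0 lam dl)^~ y) by apply: moll1_l_measurable.
have r2 x : measurable_fun (Om : set (plane R)) (moll2 x0 lam dl x : plane R -> R) by apply: moll2_r_measurable.
have l2 y : msble ((moll2 x0 lam dl)^~ y) by apply: moll2_l_measurable.
rewrite (@swap Z1 dv1 (moll1 x0 lam dl) iZ1 (moll1_measurable x0 lam dl) r1 l1 (fun x y => (kb x y).1) (fun x => erefl)).
rewrite (@swap Z2 dv2 (moll2 x0 lam dl) iZ2 (moll2_measurable x0 lam dl) r2 l2 (fun x y => (kb x y).2) (fun x => erefl)).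
have i1 : intg (fun x => - lam^-1 * (Z1 x * dv1 x)).
  apply: (intgZ mOm); apply: (intgM_bounded mOm iZ1); first by exact: continuous_plane (c11_continuous1 dvc).
  by move=> y _; have [_ _ /(_ y)[_ + _]] := dvc; exact.
have i2 : intg (fun x => - lam^-1 * (Z2 x * dv2 x)).
  apply: (intgZ mOm); apply: (intgM_bounded mOm iZ2); first by exact: continuous_plane (c11_continuous2 dvc).
  by move=> y _; have [_ _ /(_ y)[_ _]] := dvc; exact.
have iSN : intg (fun x => S x * N x).
  rewrite (_ : (EFin \o _) = (EFin \o (fun x => (1 + om)^-1 * (s x * N x)))); first exact: (intgZ mOm).
  by apply/funext => x /=; congr EFin; ring.
rewrite -(RintegralD mOm i1 i2) -(RintegralZl _ mOm iSN); apply: eq_Rintegral => x _.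
rewrite /dual_field1 /dual_field2; have := enorm_mul (dv1 x, dv2 x); rewrite -/(N x) /=.
have [n0|n0] := eqVneq (N x) 0; first by rewrite n0 invr0 !mulr0 oppr0 !mul0r !mulr0 addr0.
move: (N x) (dv1 x) (dv2 x) (S x) n0 => n p q t n0 e.
transitivity (lam * t / n * (p * p + q * q)); first by field; rewrite n0 lt0r_neq0.
by rewrite -e; field.
Qed.

(** Let [a] be the integral of [s N] and [p] that of [phi(x, N)]. The test field gives [rho >= lam a
    / (1 + om) - (a - p + h a + om |Om|)], and [lam / (1 + om) >= 1 - sg - om] leaves [p] up to
    [(h + sg + om) a], where [a <= 4 L p]. *)
Lemma modular_ndv_le : (1 - 4 * L * (h + sg + om)) * \int[mu]_(x in Om) P x (N x) <=
  rho + om * fine (mu Om).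
Proof.
have [WC _] := C1_0_moll_field geo sg01 iZ1 iZ2.
have := dual_ge WC int_conj_W; rewrite rhoE lee_fin div_W.
have iP := rphi_ndv_intg.
have iho := intgZ mOm h isN; have ic := intg_cst mOm Omfin om.
have -> : \int[mu]_(x in Om) (S x * N x) = (1 + om)^-1 * \int[mu]_(x in Om) (s x * N x).
  by rewrite -(RintegralZl _ mOm isN); apply: eq_Rintegral => x _; ring.
rewrite (RintegralD mOm (intgD mOm (intgB mOm isN iP) iho) ic) (RintegralD mOm (intgB mOm isN iP) iho).
rewrite (RintegralB mOm isN iP) (RintegralZl _ mOm isN) (Rintegral_cst mu mOm).
have sP : \int[mu]_(x in Om) (s x * N x) <= 4 * L * \int[mu]_(x in Om) P x (N x).
  rewrite -(RintegralZl _ mOm iP); apply: le_Rintegral; [exact: mOm|exact: isN|exact: (intgZ mOm)|exact: sN].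
have s00 : 0 <= \int[mu]_(x in Om) (s x * N x).
  by apply: Rintegral_ge0 => x Ox; rewrite mulr_ge0 ?s0.
move: (\int[mu]_(x in Om) (s x * N x)) (\int[mu]_(x in Om) P x (N x)) (fine (mu Om)) sP s00.
move=> a p m ap a0 hle.
have q : (1 - sg - om) * a <= lam * ((1 + om)^-1 * a).
  rewrite mulrA ler_wpM2r // ler_pdivlMr //.
  by case/andP: sg01 => g0 _; have := mulr_ge0 om0 (ltW g0); have := sqr_ge0 om; rewrite expr2; lra.
have hso : 0 <= h + sg + om by case/andP: h01; case/andP: sg01; move: om0; lra.
have := ler_wpM2l hso ap.
lra.
Qed.

End scale.

(** * Choice of the scale *)

Hypothesis va : VA1 Om conj.

(** The threshold wanted at scale [sg] is at most a constant times [sg ^- 2], and the points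
    compared are within Euclidean distance [2 (r + M) sg]. Their product with squared distance is
    bounded, so [K] can be fixed before [sg] and the modulus does not change with the scale. Its
    value at the largest distance serves as [om]. *)
Lemma conj_VA1 (d : R) : 0 < d -> exists2 s : R, 0 < s & forall sg : R, 0 < sg -> sg <= s -> sg <= 1 ->
  exists2 om : R, 0 <= om <= d &
  forall x y t, Om x -> Om y -> 0 <= t -> `|y - x| <= sg * (r + M) ->
  (conj x t <= (128 * L ^+ 3 * (rho / (sg * r) ^+ 2 + 1))%R%:E ->
   conj y (t / (1 + om)) <= conj x t + om%:E)%E.
Proof.
move=> d0.
have rM : 0 < 2 * (r + M) by rewrite mulr_gt0 // ltr_pwDl.
have c0 : 0 < 128 * L ^+ 3 * (rho / r ^+ 2 + 1).
  by rewrite !mulr_gt0 ?exprn_gt0 // ltr_wpDl // divr_ge0 // sqr_ge0.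
have K0 : 0 < (2 * (r + M)) ^+ 2 * (128 * L ^+ 3 * (rho / r ^+ 2 + 1)) by rewrite mulr_gt0 // exprn_gt0.
have [w [wm wV]] := va K0; have [s s0 ws] := modulus_small wm d0.
exists (s / (2 * (r + M))) => [|sg sg0 sgs sg1]; first by rewrite divr_gt0.
have Dsg : 0 <= 2 * (r + M) * sg by rewrite mulr_ge0 // ltW.
have wD : (w (2 * (r + M) * sg)%R <= d%:E)%E.
  by apply: ws => //; rewrite mulrC -ler_pdivlMr.
have [w0 wi _ _] := wm.
have wf (t : R) : 0 <= t -> t <= 2 * (r + M) * sg -> exists2 a : R, 0 <= a <= fine (w (2 * (r + M) * sg)) & w t = a%:E.
  move=> t0 tD; have h0 := w0 _ t0; have h1 := wi _ _ t0 tD.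
  have fD : w (2 * (r + M) * sg) \is a fin_num.
    by rewrite ge0_fin_numE ?w0 //; apply: le_lt_trans (ltry d).
  have ft : w t \is a fin_num.
    by rewrite ge0_fin_numE //; apply: le_lt_trans (ltry d); exact: le_trans wD.
  exists (fine (w t)); last by rewrite fineK.
  by rewrite fine_ge0 //= fine_le.
have [om /andP[om0 _] omE] := wf _ Dsg (lexx _).
exists om; first by rewrite om0 /= -lee_fin -omE.
move=> x y t Ox Oy t0 yx cK; pose e := enorm (y - x).
have e0 : 0 <= e by exact: enorm_ge0.
have eD : e <= 2 * (r + M) * sg.
  apply: le_trans (enorm_le _) _; rewrite -mulrA ler_wpM2l // mulrC //.
have [a /andP[a0 aom] aE] := wf _ e0 eD; rewrite omE /= in aom.
have := wV y x t Oy Ox t0; rewrite -/e aE.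
have a1 : 0 < 1 + a by rewrite ltr_wpDr.
have om1 : 0 < 1 + om by rewrite ltr_wpDr.
have -> : fine (t%:E / (1 + a%:E))%E = t / (1 + a).
  by rewrite -EFinD inver gt_eqF.
move=> H; apply: (@le_trans _ _ (conj y (t / (1 + a)))).
  by apply: (conjugate_incr pg Oy); rewrite ler_wpM2l // lef_pV2 ?posrE // lerD2l.
apply: le_trans (H _) _; last by apply: leeD => //; rewrite lee_fin.
rewrite (conjugate_ge0 pg _ Ox) /=; apply: le_trans cK _.
(* For [y = x] the range allowed by (VA1) is unbounded, the inverse of 0 being [+oo]. *)
move: e0; rewrite le_eqVlt => /predU1P[<-|ep].
  by rewrite expr0n /= inver eqxx gt0_muley ?lte_fin // leey.
rewrite inver gt_eqF ?exprn_gt0 // -EFinM lee_fin.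
rewrite ler_pdivlMr ?exprn_gt0 //.
apply: (@le_trans _ _ ((128 * L ^+ 3 * (rho / r ^+ 2 + 1) / sg ^+ 2) * (2 * (r + M) * sg) ^+ 2)).
  apply: ler_pM; [ |exact: sqr_ge0| |by apply: lerXn2r; rewrite ?nnegrE ?(ltW ep)].
    by rewrite !mulr_ge0 ?exprn_ge0 ?(ltW Lpos) // addr_ge0 // divr_ge0 // sqr_ge0.
  rewrite -[leRHS]mulrA; apply: ler_wpM2l; first by rewrite mulr_ge0 // exprn_ge0 // ltW.
  rewrite mulrDl mul1r exprMn invfM; apply: lerD; first by rewrite mulrAC mulrA.
  by rewrite invf_ge1 ?exprn_gt0 // exprn_ile1 // ltW.
rewrite le_eqVlt; apply/orP; left; apply/eqP; field.
by rewrite !lt0r_neq0.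
Qed.

Hypothesis iu2 : intg (fun x => u x ^+ 2).

Lemma recovery (e : R) : 0 < e -> exists v v1 v2 : R * R -> R, exists C : R,
  [/\ c11 v v1 v2 C,
      sqdist v u <= e,
      intg (fun x => P x (enorm (v1 x, v2 x))) &
      \int[mu]_(x in Om) P x (enorm (v1 x, v2 x)) <= rho + e].
Proof.
move=> e0; pose m := fine (mu Om); have m0 : 0 <= m by rewrite fine_ge0.
have q0 : 0 < m + 24 * L * (rho + m) + 1.
  by rewrite ltr_wpDl // addr_ge0 // !mulr_ge0 ?(ltW Lpos) // addr_ge0.
(* The first bound makes [12 L d <= 1/2], hence the modular at most [2 (rho + m)]. Feeding this
   back, the error is at most [d (m + 24 L (rho + m))], which the second bound keeps below [e]. *)
pose d := Num.min (24 * L)^-1 (e / (m + 24 * L * (rho + m) + 1)).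
have d0 : 0 < d by rewrite lt_min invr_gt0 mulr_gt0 //= divr_gt0.
have d24 : 24 * L * d <= 1 by rewrite mulrC -ler_pdivlMr ?mulr_gt0 // mul1r ge_min lexx.
have de : d * (m + 24 * L * (rho + m) + 1) <= e by rewrite -ler_pdivlMr // ge_min lexx orbT.
have d1 : d <= 2^-1.
  have : 24 * d <= 24 * L * d by rewrite ler_wpM2r ?(ltW d0) //; move: Lge1; lra.
  lra.
clearbody d; have [s1 s10 V] := conj_VA1 d0; have [s2 s20 C2] := mollify_cvg_L2 geo iu iu2 e0.
pose sg := Num.min d (Num.min s1 (s2 / 2)).
have sg0 : 0 < sg by rewrite !lt_min d0 s10 divr_gt0.
have sgd : sg <= d by rewrite ge_min lexx.
have sgs1 : sg <= s1 by rewrite !ge_min lexx /= orbT.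
have sgs2 : sg < s2 by apply: (@le_lt_trans _ _ (s2 / 2)); [rewrite !ge_min lexx !orbT|lra].
have sg01 : 0 < sg <= 2^-1 by rewrite sg0 (le_trans sgd).
have sg1 : sg <= 1 by lra.
have [om /andP[om0 omd] VAs] := V sg sg0 sgs1 sg1.
have om01 : 0 <= om <= 1 by rewrite om0; lra.
have d01 : 0 < d <= 1 by rewrite d0; lra.
exists (mollify Om x0 r sg u), (dv1 sg), (dv2 sg); eexists; split.
- exact: (c11_mollify geo sg01 iu).
- by rewrite /sqdist; under eq_Rintegral do rewrite real_normK ?num_real //; exact: C2.
- exact: (rphi_ndv_intg sg01 om01 VAs (lexx _)).
have := modular_ndv_le sg01 om01 VAs (lexx _) d01.
have : 0 <= \int[mu]_(x in Om) P x (ndv sg x).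
  by apply: Rintegral_ge0 => x Ox; rewrite (rphi_ge0 pg) // enorm_ge0.
rewrite -/m /ndv; move: (\int[mu]_(x in Om) _) => I I0 hI.
have h12 : 4 * L * (d + sg + om) <= 12 * L * d.
  rewrite (_ : 12 * L * d = 4 * L * (d + d + d)); last by ring.
  by rewrite ler_wpM2l ?mulr_ge0 ?(ltW Lpos) //; lra.
have hJ : (1 - 12 * L * d) * I <= rho + om * m.
  by apply: le_trans hI; rewrite ler_wpM2r //; lra.
have omm : om * m <= d * m by rewrite ler_wpM2r.
have dm : d * m <= m by rewrite ler_piMl //; lra.
have I2 : I <= 2 * (rho + m).
  have : 2^-1 * I <= (1 - 12 * L * d) * I by rewrite ler_wpM2r //; lra.
  lra.
have : 12 * L * d * I <= 12 * L * d * (2 * (rho + m)).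
  by rewrite ler_wpM2l // !mulr_ge0 ?(ltW Lpos) ?(ltW d0).
lra.
Qed.

End dual.

(** * Square-integrable functions and the lower bound *)

Lemma measurable_sqr (g : plane R -> R) : measurable_fun (Om : set (plane R)) g ->
  msble (fun x => g x ^+ 2).
Proof.
move=> mg; have -> : (fun x : plane R => g x ^+ 2) = (fun x : plane R => g x * g x).
  by apply/funext => x; rewrite expr2.
exact: measurable_funM.
Qed.

Lemma L2_intg u : L2 Om u -> intg u /\ intg (fun x => u x ^+ 2).
Proof.
move=> [mu_ fu].
have m2 := measurable_sqr mu_.
have i2 : intg (fun x => u x ^+ 2).
  apply/integrableP; split; first exact/measurable_EFinP.
  apply: le_lt_trans fu; rewrite le_eqVlt; apply/orP; left; apply/eqP; apply: eq_integral => x _.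
  by rewrite /= real_normK ?num_real // ger0_norm ?sqr_ge0.
split=> //; apply: (le_intg mOm mu_ (g := fun x => 1 + u x ^+ 2)).
  move=> x _; rewrite [leRHS]ger0_norm ?addr_ge0 ?sqr_ge0 // -[u x ^+ 2]real_normK ?num_real //.
  by have := sqr_ge0 (`|u x| - 1); have := normr_ge0 (u x); rewrite !expr2; nra.
exact: (intgD mOm (intg_cst mOm Omfin 1) i2).
Qed.

Lemma intg_L2 u : msble u -> intg (fun x => u x ^+ 2) -> L2 Om u.
Proof.
move=> mu_ i2; split => //; case/integrableP: i2 => _; apply: le_lt_trans.
rewrite le_eqVlt; apply/orP; left; apply/eqP; apply: eq_integral => x _.
by rewrite /= real_normK ?num_real // ger0_norm ?sqr_ge0.
Qed.

Lemma L2B u v : L2 Om u -> L2 Om v -> L2 Om (fun x => u x - v x).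
Proof.
move=> uL vL; have [mu_ _] := uL; have [mv _] := vL.
have [_ iu2] := L2_intg uL; have [_ iv2] := L2_intg vL.
have m : msble (fun x => u x - v x) by exact: measurable_funB.
apply: intg_L2 => //; apply: (le_intg mOm (g := fun x => 2 * u x ^+ 2 + 2 * v x ^+ 2)).
- exact: (measurable_sqr m).
- move=> x _; rewrite [leLHS]ger0_norm ?sqr_ge0 // ger0_norm; last first.
    by apply: addr_ge0; apply: mulr_ge0 => //; exact: sqr_ge0.
  by have := sqr_ge0 (u x + v x); rewrite !expr2; lra.
- exact: (intgD mOm (intgZ mOm 2 iu2) (intgZ mOm 2 iv2)).
Qed.

Lemma grad_weak u : W11 Om u -> is_weak_gradient Om u (grad Om u).
Proof. by move=> [_ [G uG]]; rewrite /grad; exact: (xgetPex _ (ex_intro _ G uG)). Qed.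

Lemma enorm_grad_measurable u : W11 Om u -> L0 Om (fun x => enorm (grad Om u x)).
Proof.
move=> /grad_weak[[m1 _] [m2 _] _].
apply: (@measurableT_comp _ _ _ _ _ _ (@Num.sqrt R) _ (fun x : plane R => (grad Om u x).1 ^+ 2 + (grad Om u x).2 ^+ 2)).
  exact: continuous_measurable_fun (@sqrt_continuous R).
apply: measurable_funD; [exact: (measurable_sqr m1)|exact: (measurable_sqr m2)].
Qed.

Lemma phi_measurable (g : R * R -> R) : L0 Om g -> (forall x, 0 <= g x) ->
  measurable_fun (Om : set (plane R)) (fun x : plane R => phi x (g x)).
Proof.
move=> mg g0; rewrite (_ : (fun x => _) = fun x : plane R => phi x `|g x|).
  exact: (Phi_w_meas (Phi_c_w (pg_c pg)) mg).
by apply/funext => x; rewrite ger0_norm.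
Qed.

Lemma phi_ge0 x t : Om x -> 0 <= t -> (0 <= phi x t)%E.
Proof. by move=> Ox t0; rewrite (phi_fin pg) // lee_fin (rphi_ge0 pg). Qed.

Lemma pairing_le u w : W11 Om u -> C1_0 Om w ->
  (dual_pairing Om phi u w <= \int[mu]_(x in Om) phi x (enorm (grad Om u x)))%E.
Proof.
move=> uW wC; rewrite /dual_pairing; case: ifPn => [_|cy]; first exact: leNye.
have iu : intg u by apply: L1_intg; case: uW.
have mc := conj_enorm_measurable (C1_0_continuous wC).
have c0 x : Om x -> (0 <= conj x (enorm (w x)))%E by move=> Ox; exact: (conjugate_ge0 pg).
have ic : mu.-integrable Om (fun x => conj x (enorm (w x))) by apply: (conj_enorm_integrable wC); rewrite ltey.
have iD := div_intg iu wC.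
rewrite (integralB mOm iD ic).
have fc : (\int[mu]_(x in Om) conj x (enorm (w x)))%E \is a fin_num by exact: integrable_fin_num ic.
rewrite leeBlDr //.
have mg := enorm_grad_measurable uW.
have mphi := phi_measurable mg (fun x => enorm_ge0 _).
rewrite -(@ge0_integralD _ _ _ mu Om mOm _ _ (fun x Ox => phi_ge0 Ox (enorm_ge0 _)) mphi c0 mc).
have [[g1 g2 wG] [w1C w2C]] := (grad_weak uW, C1_0_components wC).
set G := grad Om u in g1 g2 wG *.
(* The divergence needs only the first identity for the first component and the second one for the
   second component. *)
have [E1 _] := wG _ w1C; have [_ E2] := wG _ w2C.
have j1 := intgZ mOm (-1) (C1_0_mul_intg geo (L1_intg g1) w1C).
have j2 := C1_0_mul_intg geo (L1_intg g2) w2C.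
have mw := continuous_plane (D := Om) (enorm_comp_continuous (C1_0_continuous wC)).
have iGw : intg (fun x => enorm (G x) * enorm (w x)).
  have [B hB] := C1_0_bounded wC; apply: (intgM_bounded mOm _ mw (M := 2 * B)) => [|x _].
    apply: (le_intg mOm mg (g := fun x => `|(G x).1| + `|(G x).2|)).
      by move=> x _; rewrite [leRHS]ger0_norm ?addr_ge0 // ger0_norm ?enorm_ge0 // enorm_le_sum.
    exact: (intgD mOm (intg_norm (L1_intg g1)) (intg_norm (L1_intg g2))).
  by rewrite ger0_norm ?enorm_ge0 // (le_trans (enorm_le _)) // ler_wpM2l.
have hX : \int[mu]_(x in Om) (u x * div w x) <= \int[mu]_(x in Om) (enorm (G x) * enorm (w x)).
  have k1 := C1_0_mul_D_intg geo (e1 R) iu w1C; have k2 := C1_0_mul_D_intg geo (e2 R) iu w2C.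
  rewrite (_ : Rintegral _ _ _ = \int[mu]_(x in Om) (u x * 'D_(e1 R) (fun y => (w y).1) x + u x * 'D_(e2 R) (fun y => (w y).2) x)).
    rewrite (RintegralD mOm k1 k2) {1 2}/Rintegral E1 E2 !fineN -!/(Rintegral _ _ _).
    rewrite -[- Rintegral _ _ _]mulN1r -(RintegralZl _ mOm (C1_0_mul_intg geo (L1_intg g1) w1C)) -(RintegralB mOm j1 j2).
    apply: le_Rintegral; [exact: mOm|exact: (intgB mOm j1 j2)|exact: iGw|move=> x _].
    have := enorm_dot (-1 * (G x).1, -1 * (G x).2) (w x); rewrite enormZ normrN1 mul1r.
    by apply: le_trans; rewrite /= !mulN1r !mulNr.
  by apply: eq_Rintegral => x _; rewrite (div_components wC) mulrDr.
rewrite (EFin_Rintegral mOm iD); apply: (@le_trans _ _ (\int[mu]_(x in Om) (enorm (G x) * enorm (w x)))%:E).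
  by rewrite lee_fin.
rewrite -(EFin_Rintegral mOm iGw).
apply: ge0_le_integral; [exact: mOm| | | |].
- by move=> x _; rewrite lee_fin mulr_ge0 ?enorm_ge0.
- exact: measurable_int iGw.
- exact: emeasurable_funD.
- move=> x Ox; rewrite (phi_fin pg Ox (enorm_ge0 _)).
  have := conjugate_ge pg (enorm (w x)) Ox (enorm_ge0 (G x)).
  by rewrite EFinB leeBlDr // addeC mulrC.
Qed.

Lemma sqdist_intg u v : L2 Om u -> L2 Om v -> intg (fun x => `|u x - v x| ^+ 2).
Proof.
move=> uL vL; have [_ i] := L2_intg (L2B uL vL).
rewrite (_ : (fun x => _) = fun x => (u x - v x) ^+ 2) //.
by apply/funext => x; rewrite real_normK ?num_real.
Qed.

Lemma sqdistE u v : L2 Om u -> L2 Om v ->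
  (\int[mu]_(x in Om) (`|u x - v x| ^+ 2)%:E = (sqdist u v)%:E)%E.
Proof. by move=> uL vL; exact: (EFin_Rintegral mOm (sqdist_intg uL vL)). Qed.

Lemma sqdist_ge0 u v : 0 <= sqdist u v.
Proof. by apply: Rintegral_ge0 => x _; exact: sqr_ge0. Qed.

(** Expand [t (a + c / t)^2 >= 0] with [a = u - g] and [c = v - u]. With [sqdist_le] it plays the
    role of the triangle inequality of the $L^2$ norm, directly on squares. *)
Lemma sqdist_ge u v g (t : R) : L2 Om u -> L2 Om v -> L2 Om g -> 0 < t ->
  (1 - t) * sqdist u g - t^-1 * sqdist v u <= sqdist v g.
Proof.
move=> uL vL gL t0; have i1 := sqdist_intg uL gL; have i2 := sqdist_intg vL uL.
have j1 := intgZ mOm (1 - t) i1; have j2 := intgZ mOm t^-1 i2.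
rewrite -(RintegralZl _ mOm i1) -(RintegralZl _ mOm i2) -(RintegralB mOm j1 j2).
apply: le_Rintegral; [exact: mOm|exact: (intgB mOm j1 j2)|exact: sqdist_intg|].
move=> x _; rewrite !real_normK ?num_real //.
rewrite (_ : v x - g x = (u x - g x) + (v x - u x)); last by ring.
move: (u x - g x) (v x - u x) => a c.
have : 0 <= t * (a + t^-1 * c) ^+ 2 by rewrite mulr_ge0 ?sqr_ge0 // ltW.
rewrite (_ : t * _ = t * a ^+ 2 + 2 * (a * c) + t^-1 * c ^+ 2); last by field; exact: lt0r_neq0.
have := sqr_ge0 c; rewrite (_ : (a + c) ^+ 2 = a ^+ 2 + 2 * (a * c) + c ^+ 2); last by ring.
rewrite mulrBl mul1r; lra.
Qed.

Lemma sqdist_le u v g (t : R) : L2 Om u -> L2 Om v -> L2 Om g -> 0 < t ->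
  sqdist v g <= (1 + t) * sqdist u g + (1 + t^-1) * sqdist v u.
Proof.
move=> uL vL gL t0; have i1 := sqdist_intg uL gL; have i2 := sqdist_intg vL uL.
have j1 := intgZ mOm (1 + t) i1; have j2 := intgZ mOm (1 + t^-1) i2.
rewrite -(RintegralZl _ mOm i1) -(RintegralZl _ mOm i2) -(RintegralD mOm j1 j2).
apply: le_Rintegral; [exact: mOm|exact: sqdist_intg|exact: (intgD mOm j1 j2)|].
move=> x _; rewrite !real_normK ?num_real //.
rewrite (_ : v x - g x = (u x - g x) + (v x - u x)); last by ring.
move: (u x - g x) (v x - u x) => a c.
have : 0 <= t * (a - t^-1 * c) ^+ 2 by rewrite mulr_ge0 ?sqr_ge0 // ltW.
rewrite (_ : t * _ = t * a ^+ 2 - 2 * (a * c) + t^-1 * c ^+ 2); last by field; exact: lt0r_neq0.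
rewrite (_ : (a + c) ^+ 2 = a ^+ 2 + 2 * (a * c) + c ^+ 2); last by ring.
rewrite mulrDl mul1r mulrDl mul1r; lra.
Qed.

(** [|v - u| <= t + |v - u|^2 / t] controls the $L^1$ distance by the squared $L^2$ distance and the
    measure of [Om]. *)
Lemma div_pairing_close u v (w : R * R -> R * R) (B t : R) : L2 Om u -> L2 Om v -> C1_0 Om w ->
  0 <= B -> (forall x, `|div w x| <= B) -> 0 < t ->
  \int[mu]_(x in Om) (u x * div w x) - B * (t * fine (mu Om) + t^-1 * sqdist v u) <=
  \int[mu]_(x in Om) (v x * div w x).
Proof.
move=> uL vL wC B0 dB t0.
have [iu _] := L2_intg uL; have [iv _] := L2_intg vL.
have iud := div_intg iu wC; have ivd := div_intg iv wC.
have i0 := sqdist_intg vL uL; have it := intgZ mOm t^-1 i0; have ic := intg_cst mOm Omfin t.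
have ij := intgD mOm ic it; have ik := intgZ mOm B ij.
rewrite -(Rintegral_cst mu mOm t) -(RintegralZl _ mOm i0) -(RintegralD mOm ic it) -(RintegralZl _ mOm ij).
rewrite -(RintegralB mOm iud ik).
apply: le_Rintegral; [exact: mOm|exact: (intgB mOm iud ik)|exact: ivd|].
move=> x _; rewrite lerBlDr -lerBlDl -mulrBl.
apply: le_trans (ler_norm _) _; rewrite normrM mulrC distrC; apply: ler_pM => //.
move: (`|v x - u x|) (normr_ge0 (v x - u x)) => a a0.
have [at_|ta] := leP a t.
  by apply: le_trans at_ _; rewrite lerDl mulr_ge0 ?sqr_ge0 // invr_ge0 ltW.
apply: (@le_trans _ _ (t^-1 * a ^+ 2)); last by rewrite lerDr ltW.
by rewrite mulrC ler_pdivlMr // expr2 ler_wpM2l // ltW.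
Qed.

Variable f : R * R -> R.
Hypothesis fL : L2 Om f.

Lemma F_p_ge_pairing v w (c p : R) : L2 Om v -> C1_0 Om w -> 1 < p ->
  (\int[mu]_(x in Om) conj x (enorm (w x)) = c%:E)%E ->
  ((\int[mu]_(x in Om) (v x * div w x) - c + sqdist v f - (p - 1) * fine (mu Om))%:E <= F_p Om phi f p v)%E.
Proof.
move=> vL wC p1 cE; rewrite /F_p; case: asboolP => [[vW _]|_]; last exact: leey.
have [iv _] := L2_intg vL; have iD := div_intg iv wC.
have mg := enorm_grad_measurable vW.
have mphi := phi_measurable mg (fun x => enorm_ge0 _).
have mphip : measurable_fun (Om : set (plane R)) (fun x : plane R => phi x (enorm (grad Om v x)) `^ p)%E.
  exact: (measurableT_comp (measurable_poweR p) mphi).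
have mf : measurable_fun (Om : set (plane R)) (fun x : plane R => (`|v x - f x| ^+ 2)%:E).
  exact: measurable_int (sqdist_intg vL fL).
rewrite ge0_integralD; [|exact: mOm|by move=> x _; exact: poweR_ge0|exact: mphip|by move=> x _; rewrite lee_fin sqr_ge0|exact: mf].
rewrite (sqdistE vL fL).
have hp := pairing_le vW wC.
rewrite /dual_pairing cE /= in hp.
have ic : mu.-integrable Om (fun x => conj x (enorm (w x))).
  by apply: (conj_enorm_integrable wC); rewrite cE ltry.
rewrite (integralB mOm iD ic) cE (EFin_Rintegral mOm iD) -EFinB in hp.
have h2 : (\int[mu]_(x in Om) phi x (enorm (grad Om v x)) <=
   \int[mu]_(x in Om) (phi x (enorm (grad Om v x)) `^ p) + ((p - 1) * fine (mu Om))%:E)%E.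
  have -> : ((p - 1) * fine (mu Om))%:E = (\int[mu]_(x in Om) (cst (p - 1)%:E x))%E.
    by rewrite integral_cst // EFinM fineK // ge0_fin_numE.
  rewrite -ge0_integralD; [|exact: mOm|by move=> x _; exact: poweR_ge0|exact: mphip
    |by move=> x _; rewrite lee_fin subr_ge0 ltW|exact: measurable_cst].
  apply: ge0_le_integral; [exact: mOm| |exact: mphi| |].
  - by move=> x Ox; exact: (phi_ge0 Ox (enorm_ge0 _)).
  - by apply: emeasurable_funD; [exact: mphip|exact: measurable_cst].
  - move=> x Ox; rewrite (phi_fin pg Ox (enorm_ge0 _)) poweR_EFin lee_fin.
    by apply: powR_ge_affine => //; exact: (rphi_ge0 pg Ox (enorm_ge0 _)).
have := le_trans hp h2; rewrite -leeBlDr // -EFinB => h3.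
rewrite (_ : _ - c + _ - _ = (\int[mu]_(x in Om) (v x * div w x) - c - (p - 1) * fine (mu Om)) + sqdist v f); last by ring.
by rewrite EFinD leeD2r.
Qed.

Lemma liminf_F_p (p : nat -> R) (u : R * R -> R) (u_ : nat -> R * R -> R) :
  (forall k, 1 < p k) -> p k @[k --> \oo] --> (1 : R) ->
  L2 Om u -> (forall k, L2 Om (u_ k)) -> cvg_L2 Om u_ u ->
  (dual_modular_fid Om phi f u <= limn_einf (fun k => F_p Om phi f (p k) (u_ k)))%E.
Proof.
move=> p1 pc uL uL_ cu; rewrite /dual_modular_fid (sqdistE uL fL) -leeBrDr //.
(* The left side is a supremum over test fields, so one field can be fixed before passing to the
   limit; this is why the finite fidelity term was moved across. *)
apply: ge_ereal_sup => _ [w wC <-]; rewrite leeBrDr // /dual_pairing.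
case: ifPn => [_|cy]; first by rewrite addNye leNye.
have [iu _] := L2_intg uL; have iD := div_intg iu wC.
have Ic0 : (0 <= \int[mu]_(x in Om) conj x (enorm (w x)))%E.
  by apply: integral_ge0 => x Ox; exact: (conjugate_ge0 pg).
have ic : mu.-integrable Om (fun x => conj x (enorm (w x))) by apply: (conj_enorm_integrable wC); rewrite ltey.
rewrite (integralB mOm iD ic) (EFin_Rintegral mOm iD).
move: cy Ic0; case E : (\int[mu]_(x in Om) _)%E => [c| |] // _ _.
rewrite -EFinB -EFinD; apply: limn_einf_ge => e e0.
have [B B0 dB] := div_bounded wC.
set X := Rintegral _ _ _; set m := fine (mu Om); have m0 : 0 <= m by rewrite fine_ge0.
have A0 := sqdist_ge0 u f; set A := sqdist u f in A0 *.
have q0 : 0 < 3 * (B * m + A + 1) by rewrite mulr_gt0 // ltr_wpDl // addr_ge0 // mulr_ge0.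
(* Three errors of size [e / 3]: the terms with factor [t], those with factor [1 / t], small because
   [u_ k] is close to [u], and the one from [p k - 1]. *)
pose t := e / (3 * (B * m + A + 1)); have t0 : 0 < t by rewrite divr_gt0.
have tE : t * (B * m + A) <= e / 3.
  rewrite /t mulrAC ler_pdivrMr // (_ : e / 3 * (3 * (B * m + A + 1)) = e * (B * m + A + 1)); last by field.
  by rewrite ler_pM2l // lerDl.
have [N1 h1] := cvg_L2_small (d := e / 3 * t / (B + 1)) cu (divr_gt0 (mulr_gt0 (divr_gt0 e0 (ltr0n _ 3)) t0) (ltr_wpDl B0 ltr01)).
have [N2 h2] := cvg_near1 (d := e / 3 / (m + 1)) pc (divr_gt0 (divr_gt0 e0 (ltr0n _ 3)) (ltr_wpDl m0 ltr01)).
exists (maxn N1 N2) => k; rewrite geq_max => /andP[k1 k2].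
apply: le_trans (F_p_ge_pairing (uL_ k) wC (p1 k) E); rewrite lee_fin.
have := div_pairing_close uL (uL_ k) wC B0 dB t0; rewrite -/X -/m.
have := sqdist_ge uL (uL_ k) fL t0; rewrite -/A.
have := h1 k k1; rewrite (sqdistE (uL_ k) uL) lee_fin ler_pdivlMr ?(ltr_wpDl B0) // -ler_pdivrMr //.
have := h2 k k2; rewrite ler_pdivlMr ?(ltr_wpDl m0) //.
have pk : 0 <= p k - 1 by rewrite subr_ge0 ltW.
move: (sqdist_ge0 (u_ k) u) => s0.
set s := sqdist (u_ k) u in s0 *; set Xk := Rintegral _ _ _; set Ak := sqdist (u_ k) f.
rewrite -[_ / t]mulrC mulrDr mulr1 => e1; rewrite mulrCA mulrDr mulr1 => e2; lra.
Qed.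

Hypothesis va : VA1 Om conj.

(** * Recovery sequences *)

Section smooth.
Variables (v v1 v2 : R * R -> R) (C : R).
Hypothesis vc : c11 v v1 v2 C.
Local Notation N x := (enorm (v1 x, v2 x)).

Lemma c11_W11 : W11 Om v.
Proof.
have [iv _ _] := c11_intg geo vc; split; first exact: intg_L1.
by exists (fun x => (v1 x, v2 x)); exact: (weak_gradient_c11 geo vc).
Qed.

Lemma c11_L2 : L2 Om v.
Proof.
have [iv _ _] := c11_intg geo vc; apply: intg_L2; first exact: intg_measurable iv.
rewrite (_ : (fun x => _) = fun x => v x * v x); last by apply/funext => x; rewrite expr2.
apply: (intgM_bounded mOm iv (intg_measurable iv) (M := C)) => x _.
by have [_ _ /(_ x)[]] := vc.
Qed.

Lemma grad_c11_ae : {ae mu, forall x, Om x -> grad Om v x = (v1 x, v2 x)}.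
Proof. exact: (weak_gradient_unique geo (grad_weak c11_W11) (weak_gradient_c11 geo vc)). Qed.

Let B := L * (2 * C / b) ^+ 2 + 1.

Let PB x : Om x -> P x (N x) <= B.
Proof.
move=> Ox; have N0 : 0 <= N x by exact: enorm_ge0.
apply: le_trans (rphi_le_quadratic pg Ox N0) _.
have L0' : 0 <= L by apply: le_trans (pg_L pg).
have C0 := c11_ge0 vc.
have NC : N x <= 2 * C.
  apply: le_trans (enorm_le_sum _) _ => /=; have [_ _ /(_ x)[_ h1 h2]] := vc; lra.
rewrite /B lerD2r ler_wpM2l // lerXn2r ?nnegrE ?divr_ge0 ?mulr_ge0 ?(ltW b0) //.
by rewrite ler_wpM2r // invr_ge0 ltW.
Qed.

Let mN : L0 Om (fun x => N x).
Proof. exact: continuous_plane (enorm_pair_continuous (c11_continuous1 vc) (c11_continuous2 vc)). Qed.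

(** [grad] is first replaced by the classical gradient. Then [a^p = a^(p-1) a] with
    [a^(p-1) <= 1 + (p - 1) a], and [a <= B] because the gradient is bounded and [phi] grows at most
    quadratically. *)
Lemma modular_c11_le p : 1 < p < 2 -> intg (fun x => P x (N x)) ->
  (\int[mu]_(x in Om) (phi x (enorm (grad Om v x)) `^ p) <=
   ((1 + (p - 1) * B) * \int[mu]_(x in Om) P x (N x))%:E)%E.
Proof.
move=> /andP[p1 p2] iP.
have mphi := phi_measurable (enorm_grad_measurable c11_W11) (fun x => enorm_ge0 _).
have mphiN := phi_measurable mN (fun x => enorm_ge0 _).
rewrite (@ge0_ae_eq_integral _ _ _ mu Om _ (fun x => phi x (N x) `^ p)%E mOm
   (measurableT_comp (measurable_poweR p) mphi) (measurableT_comp (measurable_poweR p) mphiN)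
   (fun x _ => poweR_ge0 _ _) (fun x _ => poweR_ge0 _ _)); last first.
  have F : Filter (almost_everywhere mu) by exact: ae_filter_ringOfSetsType.
  by apply: (@filterS _ _ F _ _ _ grad_c11_ae) => x h Ox /=; rewrite (h Ox).
rewrite -(RintegralZl _ mOm iP) -(EFin_Rintegral mOm (intgZ mOm _ iP)).
apply: ge0_le_integral; [exact: mOm|by move=> x _; exact: poweR_ge0| | |].
- exact: (measurableT_comp (measurable_poweR p) mphiN).
- exact: measurable_int (intgZ mOm _ iP).
- move=> x Ox; have N0 : 0 <= N x by exact: enorm_ge0.
  rewrite (phi_fin pg Ox N0) poweR_EFin lee_fin.
  have := PB Ox; have := rphi_ge0 pg Ox N0; move: (P x (N x)) => a a0 aB.
  have -> : powR a p = powR a (p - 1) * a.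
    rewrite -[X in _ * X](@powRr1 _ a) // -powRD; first by rewrite subrK.
    by rewrite subrK gt_eqF ?(lt_trans _ p1).
  apply: ler_wpM2r => //; have p01 : 0 < p - 1 < 1 by apply/andP; split; lra.
  apply: le_trans (powR_le_affine a0 p01) _; rewrite lerD2l ler_wpM2l //; lra.
Qed.

Lemma F_p_c11_le p : 1 < p < 2 -> intg (fun x => P x (N x)) ->
  (F_p Om phi f p v <=
   ((1 + (p - 1) * B) * \int[mu]_(x in Om) P x (N x) + sqdist v f)%:E)%E.
Proof.
move=> p12 iP; have mo := modular_c11_le p12 iP.
have mg := enorm_grad_measurable c11_W11.
rewrite /F_p; case: asboolP => [_|nL]; last first.
  case: nL; split; first exact: c11_W11.
  split; first exact: mg.
  exists 1; split=> //; apply: le_lt_trans (ltry ((1 + (p - 1) * B) * \int[mu]_(x in Om) P x (N x))).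
  apply: le_trans mo; rewrite le_eqVlt; apply/orP; left; apply/eqP; apply: eq_integral => x _.
  by rewrite /Phi_pow mul1r ger0_norm ?enorm_ge0.
have mphi := phi_measurable mg (fun x => enorm_ge0 _).
have mf : measurable_fun (Om : set (plane R)) (fun x : plane R => (`|v x - f x| ^+ 2)%:E).
  exact: measurable_int (sqdist_intg c11_L2 fL).
rewrite ge0_integralD; [|exact: mOm|by move=> x _; exact: poweR_ge0
  |exact: (measurableT_comp (measurable_poweR p) mphi)|by move=> x _; rewrite lee_fin sqr_ge0|exact: mf].
by rewrite (sqdistE c11_L2 fL) EFinD leeD2r.
Qed.

End smooth.

Variable p : nat -> R.
Hypotheses (p1 : forall k, 1 < p k) (pc : p k @[k --> \oo] --> (1 : R)).
Variable u : R * R -> R.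
Hypothesis uL : L2 Om u.

Lemma recovery_near (rho e : R) : dual_modular Om phi u = rho%:E -> 0 < e ->
  exists2 v, L2 Om v & sqdist v u <= e /\
    exists N, forall k, (N <= k)%N -> (F_p Om phi f (p k) v <= (rho + sqdist u f + e)%:E)%E.
Proof.
move=> rhoE e0; have [iu iu2] := L2_intg uL.
have rho0 : 0 <= rho by have := dual_ge0 iu; rewrite rhoE lee_fin.
have A0 := sqdist_ge0 u f; set A := sqdist u f in A0 *.
(* One quarter of [e] pays for [t A] in [sqdist_le], one for [d] from the modular together with
   [(1 + 1/t) d] from the distance, and one for the term with [p k - 1]. *)
pose t := e / (4 * (A + 1)); have t0 : 0 < t by rewrite divr_gt0 // mulr_gt0 // ltr_wpDl.
have tA : t * A <= e / 4.
  rewrite /t mulrAC ler_pdivrMr ?mulr_gt0 ?ltr_wpDl //.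
  rewrite (_ : e / 4 * (4 * (A + 1)) = e * (A + 1)); last by field.
  by rewrite ler_pM2l // lerDl.
have it0 : 0 < t^-1 by rewrite invr_gt0.
pose d := e / (4 * (2 + t^-1)).
have d0 : 0 < d by rewrite divr_gt0 // mulr_gt0 // addr_gt0.
have dE : d * (2 + t^-1) = e / 4 by rewrite /d; field; rewrite gt_eqF //= ; apply/lt0r_neq0; lra.
have [v [v1 [v2 [C [vc vu iP hI]]]]] := recovery iu rhoE va iu2 d0.
have vL := c11_L2 vc.
have dt : d <= e / 4 by rewrite -dE ler_peMr ?(ltW d0) //; lra.
exists v => //; split; first by apply: le_trans vu _; lra.
set I := Rintegral _ _ _ in hI; set B := L * (2 * C / b) ^+ 2 + 1.
have I0 : 0 <= I by apply: Rintegral_ge0 => x Ox; apply: (rphi_ge0 pg Ox); exact: enorm_ge0.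
have B0 : 0 <= B.
  by rewrite addr_ge0 // mulr_ge0 ?sqr_ge0 // (le_trans _ (pg_L pg)).
have q0 : 0 < B * I + 1 by rewrite ltr_wpDl // mulr_ge0.
have [N1 h1] := cvg_near1 (d := e / 4 / (B * I + 1)) pc (divr_gt0 (divr_gt0 e0 (ltr0n _ 4)) q0).
have h20 : 0 < 2^-1 :> R by [].
have [N2 h2] := cvg_near1 pc h20.
exists (maxn N1 N2) => k; rewrite geq_max => /andP[k1 k2].
have pk2 : p k < 2 by have := h2 k k2; lra.
have p12 : 1 < p k < 2 by rewrite p1.
apply: le_trans (F_p_c11_le vc p12 iP) _; rewrite lee_fin -/I -/B.
have := h1 k k1; rewrite ler_pdivlMr // mulrDr mulr1 mulrA => e1.
have := sqdist_le uL vL fL t0; rewrite -/A.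
have : (1 + t^-1) * sqdist v u <= (1 + t^-1) * d.
  by rewrite ler_wpM2l // addr_ge0 // ltW.
have pk : 0 < p k - 1 by rewrite subr_gt0.
move: dE; rewrite mulrDr mulrDl mul1r mulrDl mul1r mulrDl mul1r (mulrC d t^-1) => E1 E2 E3; lra.
Qed.

Lemma limsup_F_p : exists u_ : nat -> R * R -> R,
  [/\ forall k, L2 Om (u_ k), cvg_L2 Om u_ u &
      (limn_esup (fun k => F_p Om phi f (p k) (u_ k)) <= dual_modular_fid Om phi f u)%E].
Proof.
have [iu _] := L2_intg uL.
have := dual_ge0 iu; case E : (dual_modular Om phi u) => [rho| |] // _; last first.
  (* If the dual modular is infinite, any sequence tending to [u] will do. *)
  exists (fun=> u); split => //; last by rewrite /dual_modular_fid E (sqdistE uL fL) addye // leey.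
  rewrite /cvg_L2 (_ : (fun k => _) = fun=> 0%E); first exact: cvg_cst.
  apply/funext => k; rewrite integral0_eq // => x _.
  by rewrite subrr normr0 expr0n.
have e0 j : 0 < j.+1%:R^-1 :> R by rewrite invr_gt0.
have /choice[v vP] : forall j, exists v, L2 Om v /\ sqdist v u <= j.+1%:R^-1 /\
    exists N, forall k, (N <= k)%N -> (F_p Om phi f (p k) v <= (rho + sqdist u f + j.+1%:R^-1)%:E)%E.
  by move=> j; have [v vL h] := recovery_near E (e0 j); exists v.
have /choice[N NP] : forall j, exists N, forall k, (N <= k)%N ->
    (F_p Om phi f (p k) (v j) <= (rho + sqdist u f + j.+1%:R^-1)%:E)%E.
  by move=> j; have [_ [_]] := vP j.
have [j jP] := diagonal_index N.
exists (fun k => v (j k)); split.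
- by move=> k; have [] := vP (j k).
- rewrite /cvg_L2 (_ : (fun k => _) = fun k => (sqdist (v (j k)) u)%:E); last first.
    by apply/funext => k; rewrite (sqdistE) //; have [] := vP (j k).
  apply/fine_cvgP; split; first by near=> k.
  apply/cvgrPdist_le => e e0'; have [J hJ] := inv_succ_small e0'; have [K hK] := jP J.
  exists K => // k /= Kk; have [Jj _] := hK k Kk.
  rewrite sub0r normrN ger0_norm ?sqdist_ge0 //; apply: le_trans (hJ _ Jj).
  by have [_ []] := vP (j k).
- rewrite /dual_modular_fid E (sqdistE uL fL) -EFinD; apply: limn_esup_le => e e0'.
  have [J hJ] := inv_succ_small e0'; have [K hK] := jP J; exists K => k Kk.
  have [Jj Nk] := hK k Kk; apply: le_trans (NP _ _ Nk) _.
  by rewrite lee_fin lerD2l; exact: hJ.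
Unshelve. all: by end_near. Qed.

End gamma_limit.

Lemma geometry_exists (R : realType) (Om : set (R * R)) : open Om -> bounded_set Om -> convex_set Om ->
  Om !=set0 -> exists x0 r M, geometry Om x0 r M.
Proof.
move=> oO bO cO [x0 Ox0]; have fin := bounded_leb2 oO bO.
have [e /= e0 He] : nbhs_ball x0 Om by apply/nbhs_ballP; exact: open_nbhs_nbhs.
have [M [_ HM]] := bO.
have hM x : Om x -> `|x| <= M + 1 by apply: HM; rewrite ltrDl.
exists x0, (e / 4), (M + 1 + `|x0|); split.
- exact: oO.
- exact: fin.
- move=> x y t Ox Oy /andP[t0 t1]; have := cO x y (Itv01 t0 t1).
  by rewrite !inE => /(_ Ox Oy).
- by rewrite divr_gt0.
(* The radius [e / 4] is chosen so that the closed box of radius [2 r = e / 2] fits in the open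
   ball. *)
- move=> q qr; apply: He; rewrite -ball_normE /ball_ /= distrC; apply: le_lt_trans qr _; lra.
- by move=> x Ox; apply: le_trans (ler_normB _ _) _; rewrite lerD2r hM.
Qed.

(** * The empty domain *)

Section empty.
Variables (R : realType) (phi : R * R -> R -> \bar R) (f u : R * R -> R).

Lemma F_p_set0 p : F_p set0 phi f p u = 0%E.
Proof.
have L1z (g : R * R -> R) : L1 set0 g.
  by split; [exact: measurable_fun_set0|rewrite integral_set0 ltry].
rewrite /F_p; case: asboolP => [_|[]]; first by rewrite integral_set0.
split.
  split; first exact: L1z.
  exists (fun=> 0); split; [exact: L1z|exact: L1z|move=> h _].
  by rewrite !integral_set0 oppe0.
split; first exact: measurable_fun_set0.
by exists 1; split => //; rewrite /modular integral_set0 ltry.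
Qed.

Lemma dual_modular_fid_set0 : dual_modular_fid set0 phi f u = 0%E.
Proof.
rewrite /dual_modular_fid integral_set0 adde0; apply/eqP; rewrite eq_le; apply/andP; split.
  apply: ge_ereal_sup => _ [w _ <-]; rewrite /dual_pairing !integral_set0.
  by [].
apply: ereal_sup_ubound; exists (fun=> 0); first exact: C1_0_zero.
by rewrite /dual_pairing !integral_set0.
Qed.

End empty.

Theorem corollary7p3 (R : realType) (Om : set (R * R)%type)
    (f : (R * R)%type -> R) (phi : (R * R)%type -> R -> \bar R)
    (Om_domain : domain Om) (Om_bounded : bounded_set Om)
    (Om_convex : convex_set Om)
    (f_L2 : L2 Om f)
    (phi_c : Phi_c Om phi) (phi_A0 : A0 Om phi) (phi_aDec2 : aDec2 Om phi)
    (phi_VA1 : VA1 Om phi) (phi_conj_VA1 : VA1 Om (conjugate phi)) :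
  Gamma_cvg_L2 Om (F_p Om phi f) (dual_modular_fid Om phi f).
Proof.
(* The hypotheses admit the empty set, which contains no centre of contraction; there all the
   functionals vanish. *)
move=> p p1 pc; have [E|/set0P Om0] := eqVneq Om set0.
  subst Om; split=> [u u_ _ _ _|u uL].
    rewrite dual_modular_fid_set0; apply: limn_einf_ge => e e0; exists 0%N => k _.
    by rewrite F_p_set0 lee_fin sub0r oppr_le0 ltW.
  exists (fun=> u); split; first by [].
    rewrite /cvg_L2 (_ : (fun k => _) = fun=> 0%E); first exact: cvg_cst.
    by apply/funext => k; rewrite integral_set0.
  rewrite dual_modular_fid_set0; apply: limn_esup_le => e e0; exists 0%N => k _.
  by rewrite F_p_set0 lee_fin add0r ltW.
have [x0 [r [M geo]]] := geometry_exists Om_domain.1 Om_bounded Om_convex Om0.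
have [b [b01 bA0]] := phi_A0; have [L [L1 aD]] := phi_aDec2.
have pg : phi_growth Om phi b L by split.
split=> [u u_ uL uL_ cu|u uL]; first exact: (liminf_F_p geo pg f_L2 p1 pc uL uL_ cu).
exact: (limsup_F_p geo pg f_L2 phi_conj_VA1 p1 pc uL).
Qed.
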